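(* Let $\mathcal{H}=(\mathbb{C}^2)^{\otimes n}$ and let $\mathcal{H}'$ be a finite-dimensional Hilbert space with a fixed unit vector $|0\rangle\in\mathcal{H}'$. Let $\sigma$ be the $n$-qubit state $$\sigma=(\mathcal{N}\circ\mathcal{U}_{L_\sigma}\circ\mathcal{N}\circ\cdots\circ\mathcal{N}\circ\mathcal{U}_1\circ\mathcal{N})(\rho_{in}),$$ where $\rho_{in}$ is an arbitrary $n$-qubit density operator, $\mathcal{U}_1,\dots,\mathcal{U}_{L_\sigma}$ are arbitrary unitary channels, and $\mathcal{N}=\bigotimes_{i=1}^n\mathcal{D}_i$ with $\mathcal{D}_i(\tau)=(1-p_i)\tau+p_i\mathrm{Tr}[\tau]\mathbb{I}/2$ a single-qubit depolarizing channel on qubit $i$, $p_i\in(0,1]$; let $q=\max_i(1-p_i)\in[0,1)$. For integers $M\ge1$, $k\ge0$ and any bounded operator $X$ on $\mathcal{H}^{\otimes M}\otimes\mathcal{H}'^{\otimes k}$ define $$E_{\sigma,X,M,k}=\mathrm{Tr}\big[X(\sigma^{\otimes M}\otimes|0\rangle\langle0|^{\otimes k})\big].$$ Then $$\Big|E_{\sigma,X,M,k}-\mathrm{Tr}\Big[X\Big(\frac{\mathbb{I}^{\otimes M}}{2^{Mn}}\otimes|0\rangle\langle0|^{\otimes k}\Big)\Big]\Big|\le \sqrt{\ln 4}\,\|X\|_\infty\,M\,n^{1/2}\,q^{L_\sigma+1},$$ where $\mathbb{I}$ is the $n$-qubit identity and $\|X\|_\infty$ is the operator norm.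
   Context: Quantities of the form $E_{\sigma,X,M,k}$ model expectation values estimated by error mitigation protocols: $M$ copies of a (noisily prepared) state, $k$ clean ancillas, and a general measurement operator $X$. *)

(* Defs.v *)
From HB Require Import structures.
From mathcomp Require Import all_boot all_order all_algebra.
From mathcomp Require Import complex mxtens.
From mathcomp Require Import classical_sets reals exp.
Set Implicit Arguments. Unset Strict Implicit. Unset Printing Implicit Defensive.
Import Order.TTheory GRing.Theory Num.Theory.
Local Open Scope ring_scope.
Local Open Scope complex_scope.

Section QDefs.
Variable R : realType.
Local Notation C := R[i].

Definition adj {m n} (A : 'M[C]_(m, n)) : 'M[C]_(n, m) := (map_mx Num.Def.conjC A)^T.

Definition cabs (z : C) : R := Num.sqrt (complex.Re z ^+ 2 + complex.Im z ^+ 2).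

Definition vnorm {d} (v : 'cV[C]_d) : R :=
  Num.sqrt (\sum_(i < d) cabs (v i 0) ^+ 2).

Definition opnorm {d} (X : 'M[C]_d) : R :=
  sup [set r : R | exists v : 'cV[C]_d, vnorm v = 1 /\ r = vnorm (X *m v)]%classic.

Definition density {d} (rho : 'M[C]_d) : Prop :=
  adj rho = rho /\ (forall v : 'cV[C]_d, 0 <= (adj v *m rho *m v) 0 0) /\ \tr rho = 1.

Definition unitary_channel {d} (U : 'M[C]_d) (tau : 'M[C]_d) : 'M[C]_d :=
  U *m tau *m adj U.

Definition depol (p : R) (tau : 'M[C]_2) : 'M[C]_2 :=
  (1 - p)%:C *: tau + (p%:C * \tr tau / 2) *: 1%:M.

(* tensor product of two linear maps on square matrices, defined by
   linear extension: (Phi (x) Psi)(A (x) B) = Phi A (x) Psi B, i.e.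
   on the matrix-unit basis E_ab (x) E_cd. *)
Definition tens_map {m k} (Phi : 'M[C]_m -> 'M[C]_m) (Psi : 'M[C]_k -> 'M[C]_k)
  (tau : 'M[C]_(m * k)) : 'M[C]_(m * k) :=
  \sum_(a < m) \sum_(b < m) \sum_(c < k) \sum_(e < k)
     tau (mxtens_index (a, c)) (mxtens_index (b, e))
       *: (Phi (delta_mx a b) *t Psi (delta_mx c e)).

(* the noise layer N = D_1 (x) ... (x) D_n on n qubits, qubit i (0-based,
   i-th Kronecker factor from the left) depolarized with probability p i *)
Fixpoint noise (n : nat) (p : nat -> R) : 'M[C]_(2 ^ n) -> 'M[C]_(2 ^ n) :=
  match n return 'M[C]_(2 ^ n) -> 'M[C]_(2 ^ n) with
  | 0 => id
  | n'.+1 => fun tau =>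
      castmx (esym (expnS 2 n'), esym (expnS 2 n'))
        (tens_map (depol (p 0)) (@noise n' (fun i => p i.+1))
           (castmx (expnS 2 n', expnS 2 n') tau))
  end.

Definition noisy_circuit (n : nat) (p : nat -> R) (Us : seq 'M[C]_(2 ^ n))
  (rho : 'M[C]_(2 ^ n)) : 'M[C]_(2 ^ n) :=
  foldl (fun tau U => noise p (unitary_channel U tau)) (noise p rho) Us.

Definition qmax (n : nat) (p : nat -> R) : R := \big[Num.max/0]_(i < n) (1 - p i).

End QDefs.

(* Main.v *)
(* The relative entropy to the maximally mixed state contracts by the factor q^2
   under each noise layer, so after L + 1 layers it is at most q^(2(L+1)) n ln 2,
   and Pinsker's inequality bounds the trace distance between sigma and I/2^n by
   sqrt(ln 4) n^(1/2) q^(L+1). Replacing the M copies of sigma by I/2^n one at a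
   time, and pairing with X, gives the estimate.

   The contraction rests on the modified logarithmic Sobolev inequality
   2 D(rho) <= sum_i Tr[ln rho (rho - E_i rho)] for depolarization, E_i being the
   complete depolarization of qubit i. It follows by the Stroock-Varopoulos
   inequality from the logarithmic Sobolev inequality for sqrt rho, which is proved
   by induction on the qubits from the entropic form of optimal 2-uniform convexity,
   Ent(Y + Z) <= Ent Y + Ent Z + 2 Tr Z^2 for Y even and Z odd under a unitary.

   Derivatives are replaced throughout by increment bounds with quadratic error
   (tele_le). Since ln is singular at 0, the input is first mixed with e I/2^n, and
   e tends to 0 at the very end. *)
Require Import Defs.
From HB Require Import structures.
From mathcomp Require Import all_boot all_order all_algebra.
From mathcomp Require Import complex mxtens.
From mathcomp Require Import classical_sets reals exp.
From mathcomp Require Import ring lra.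
Set Implicit Arguments. Unset Strict Implicit. Unset Printing Implicit Defensive.
Import Order.TTheory GRing.Theory Num.Theory.
Local Open Scope ring_scope.
Local Open Scope complex_scope.

(** * Scalar inequalities *)

Section Scalar.
Variable R : realType.
Implicit Types (x y s t a b l m C : R) (g : R -> R).

(** A classical logarithmic Sobolev inequality tensorises by conditioning on all bits but one.
    Matrices admit no such conditioning, and this obstacle shapes the proof. Instead a qubit is
    peeled off by splitting A into parts that commute or anticommute with its Pauli operators. The
    convexity inequality bounds the excess of the entropy over that of the parts by twice the weight
    of the odd parts, and that weight is exactly the term of the peeled qubit in the Dirichlet form.
    Each part is then traded for matrices that commute with the peeled qubit, with equal entropy (on
    average over two blocks) and no larger Dirichlet form. Everything thus stays on one space C^d,
    and [ln d] is accounted for only at the end, where the matrix has become a scalar. *)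

Lemma le0_of_le_divn x C : (forall n, x <= C / n.+1%:R) -> x <= 0.
Proof.
move=> h; rewrite leNgt; apply/negP => x0.
pose n := Num.bound (`|C| / x).
have hn : `|C| / x < n.+1%:R.
  apply: lt_trans (archi_boundP _) _; first by rewrite divr_ge0 // ltW.
  by rewrite ltr_nat.
have := h n; rewrite ler_pdivlMr ?ltr0Sn // mulrC => h1.
move: hn; rewrite ltr_pdivrMr // => h2.
have := ler_norm C; lra.
Qed.

(** Cutting [a, b] into N equal steps leaves a total loss of C (b - a)^2 / N, and N is arbitrary. *)
Lemma tele_le g a b C : a <= b ->
  (forall s t, a <= s -> s <= t -> t <= b -> g s - C * (t - s) ^+ 2 <= g t) ->
  g a <= g b.
Proof.
move=> ab h; rewrite -subr_le0.
apply: (@le0_of_le_divn _ (C * (b - a) ^+ 2)) => n.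
set N := n.+1; have N0 : 0 < N%:R :> R by rewrite ltr0Sn.
pose u (i : nat) := a + (b - a) * (i%:R / N%:R).
have uS i : u i.+1 - u i = (b - a) / N%:R.
  by rewrite /u -natr1; field; rewrite gt_eqF.
have uN : u N = b by rewrite /u divff ?gt_eqF // mulr1; lra.
have au i : a <= u i by rewrite /u lerDl mulr_ge0 ?divr_ge0 ?subr_ge0.
have ub i : (i <= N)%N -> u i <= b.
  move=> iN; rewrite -uN /u lerD2l ler_wpM2l ?subr_ge0 //.
  by rewrite ler_pM2r ?invr_gt0 // ler_nat.
have H i : (i <= N)%N -> g a - C * ((b - a) / N%:R) ^+ 2 * i%:R <= g (u i).
  elim: i => [_|i IH iN]; first by rewrite mulr0 subr0 /u mul0r mulr0 addr0.
  have := h (u i) (u i.+1) (au i); rewrite uS.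
  have -> : u i <= u i.+1 by rewrite -subr_ge0 uS divr_ge0 ?subr_ge0 ?ler0n.
  move=> /(_ isT (ub _ iN)); have := IH (ltnW iN).
  by rewrite -[i.+1%:R]natr1 mulrDr mulr1; lra.
have := H N (leqnn _); rewrite uN => HN.
suff : C * (b - a) ^+ 2 / N%:R = C * ((b - a) / N%:R) ^+ 2 * N%:R by lra.
by field; rewrite gt_eqF.
Qed.

Lemma le_of_le_addM x y C :
  (forall s, 0 < s -> s <= 1 -> x <= y + C * s) -> x <= y.
Proof.
move=> h; rewrite -subr_le0; apply: (@le0_of_le_divn _ C) => n.
have := h (n.+1%:R^-1); rewrite invr_gt0 ltr0Sn => /(_ isT).
by rewrite invf_le1 ?ltr0Sn // ler1n => /(_ isT); rewrite lerBlDl.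
Qed.

Lemma ln_le_subr1 x : 0 < x -> ln x <= x - 1.
Proof.
by move=> x0; have := @le_ln1Dx R (x - 1); rewrite [1 + _]addrC subrK; apply; lra.
Qed.

Lemma ln_sub_le x y : 0 < x -> 0 < y -> ln x - ln y <= (x - y) / y.
Proof.
move=> x0 y0; rewrite -ln_div ?posrE //.
have := @ln_le_subr1 (x / y); rewrite divr_gt0 // => /(_ isT) h.
by rewrite mulrBl divff ?gt_eqF.
Qed.

Lemma ln_sub_ge x y : 0 < x -> 0 < y -> (x - y) / x <= ln x - ln y.
Proof.
move=> x0 y0; have := @ln_sub_le y x y0 x0.
have -> : (y - x) / x = - ((x - y) / x) by ring.
lra.
Qed.

Lemma le_ln x y : 0 < x -> x <= y -> ln x <= ln y.
Proof. by move=> x0 xy; rewrite ler_ln ?posrE // (lt_le_trans x0). Qed.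

Lemma xlnx_tangent x y : 0 <= x -> 0 < y ->
  y * ln y + (ln y + 1) * (x - y) <= x * ln x.
Proof.
rewrite le_eqVlt => /orP[/eqP <-|x0] y0; first by rewrite mul0r; lra.
have := @ln_sub_ge x y x0 y0; rewrite ler_pdivrMr // => h; lra.
Qed.

Lemma xlnx_semiconcave x y : 0 < x -> 0 < y ->
  x * ln x <= y * ln y + (ln y + 1) * (x - y) + (x - y) ^+ 2 / y.
Proof.
move=> x0 y0; have := @ln_sub_le x y x0 y0; rewrite -(ler_pM2l x0) => h.
have -> : (x - y) ^+ 2 / y = x * ((x - y) / y) - (x - y).
  by field; rewrite gt_eqF.
lra.
Qed.

(** The difference of the two sides vanishes at 1 and has derivative (x - 1)^2 / (x (x + 1)^2). With
    x a ratio, this compares the logarithmic mean with the arithmetic mean. *)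
Lemma ln_ratio_ge x : 1 <= x -> 2 * (x - 1) / (x + 1) <= ln x.
Proof.
move=> x1; rewrite -subr_ge0.
have -> : 0 = ln 1 - 2 * (1 - 1) / (1 + 1) :> R by rewrite ln1; ring.
apply: (@tele_le (fun x => ln x - 2 * (x - 1) / (x + 1)) 1 x 1 x1) => s t s1 st tx.
have := @ln_sub_ge t s; have -> : 0 < t by lra.
have -> : 0 < s by lra.
move=> /(_ isT isT) h.
suff : 2 * (t - 1) / (t + 1) - 2 * (s - 1) / (s + 1)
   <= (t - s) / t + 1 * (t - s) ^+ 2 by lra.
rewrite -subr_ge0.
have -> : (t - s) / t + 1 * (t - s) ^+ 2
   - (2 * (t - 1) / (t + 1) - 2 * (s - 1) / (s + 1)) =
   (t - s) * ((t - 1) ^+ 2 + (t - s) * ((t * s - 1) * (t + 1) + t * (t + 1)))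
     / (t * (t + 1) * (s + 1)).
  by field; rewrite !gt_eqF //=; lra.
apply: divr_ge0; last by rewrite !mulr_ge0 //; lra.
apply: mulr_ge0; first lra.
rewrite addr_ge0 ?sqr_ge0 // mulr_ge0 ?subr_ge0 // addr_ge0 //.
  rewrite mulr_ge0 //; last lra.
  by rewrite subr_ge0 mulr_ege1 //; lra.
by rewrite mulr_ge0 //; lra.
Qed.

(** The two-point case of the Stroock-Varopoulos inequality, to be used on square roots of
    eigenvalues. *)
Lemma ln_sqr_dissipation x y : 0 < x -> 0 < y ->
  4 * (x - y) ^+ 2 <= (x ^+ 2 - y ^+ 2) * (ln (x ^+ 2) - ln (y ^+ 2)).
Proof.
wlog xy : x y / y <= x => [H x0 y0|x0 y0].
  have [xy|/ltW xy] := leP y x; first exact: H.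
  have := H y x xy y0 x0.
  have -> : (y - x) ^+ 2 = (x - y) ^+ 2 by ring.
  by rewrite -[y ^+ 2 - _]opprB -[ln (y ^+ 2) - _]opprB mulrNN.
rewrite !lnXn // !mulr2n.
have h := @ln_ratio_ge (x / y); rewrite ler_pdivlMr // mul1r in h.
have {}h := h xy; rewrite ln_div ?posrE // in h.
have e : 2 * (x / y - 1) / (x / y + 1) = 2 * (x - y) / (x + y).
  by field; rewrite !gt_eqF //=; lra.
rewrite e ler_pdivrMr in h; last lra.
have : 0 <= (x - y) * ((ln x - ln y) * (x + y) - 2 * (x - y)).
  by rewrite mulr_ge0 //; lra.
lra.
Qed.

(** [pinsker_scalar] solved for the logarithm reads [pq x <= ln x]. The derivative of ln x - pq x is
    (x - 1)^3 / (x^2 (x + 2)^2), so the difference decreases up to its zero at 1 and increases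
    afterwards; hence the two cases below. *)
Let pq x := (5 * x ^+ 2 - 4 * x - 1) / (2 * x * (x + 2)).

Lemma pinsker_aux_diff s t : 0 < s -> s <= t ->
  ln t - ln s - (pq t - pq s) >=
  (t - s) * (2 * (t - 1) ^+ 3 + (t - s) * (14 * t + 1 - 2 * (t + 2) * (s + t + 2)))
     / (2 * t * s * (t + 2) * (s + 2)).
Proof.
move=> s0 st; have t0 : 0 < t by lra.
have h := @ln_sub_ge t s t0 s0.
suff -> : (t - s) * (2 * (t - 1) ^+ 3 + (t - s) * (14 * t + 1 - 2 * (t + 2) * (s + t + 2)))
     / (2 * t * s * (t + 2) * (s + 2)) = (t - s) / t - (pq t - pq s).
  lra.
rewrite /pq; by field; rewrite !gt_eqF //=; lra.
Qed.

Lemma pinsker_aux_diff' s t : 0 < s -> s <= t ->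
  ln t - ln s - (pq t - pq s) <=
  (t - s) * (2 * (s - 1) ^+ 3 + (t - s) * (2 * (s + 2) * (s + t + 2) - (14 * s + 1)))
     / (2 * t * s * (t + 2) * (s + 2)).
Proof.
move=> s0 st; have t0 : 0 < t by lra.
have h := @ln_sub_le t s t0 s0.
suff -> : (t - s) * (2 * (s - 1) ^+ 3 + (t - s) * (2 * (s + 2) * (s + t + 2) - (14 * s + 1)))
     / (2 * t * s * (t + 2) * (s + 2)) = (t - s) / s - (pq t - pq s).
  lra.
rewrite /pq; by field; rewrite !gt_eqF //=; lra.
Qed.

Lemma pinsker_aux_ge1 x : 1 <= x -> pq x <= ln x.
Proof.
move=> x1; rewrite -subr_ge0.
have -> : 0 = ln 1 - pq 1 :> R by rewrite ln1 /pq; field.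
apply: (@tele_le (fun x => ln x - pq x) 1 x (2 * x + 2)) => // s t s1 st tx.
have := @pinsker_aux_diff s t; have -> : 0 < s by lra.
move=> /(_ isT st).
set D := 2 * t * s * (t + 2) * (s + 2).
have D0 : 0 < D by rewrite !mulr_gt0 //; lra.
suff : - ((2 * x + 2) * (t - s) ^+ 2) <= (t - s) *
  (2 * (t - 1) ^+ 3 + (t - s) * (14 * t + 1 - 2 * (t + 2) * (s + t + 2))) / D.
  by set X := _ / D; lra.
rewrite ler_pdivlMr // -subr_ge0.
have -> : (t - s) *
    (2 * (t - 1) ^+ 3 + (t - s) * (14 * t + 1 - 2 * (t + 2) * (s + t + 2))) -
   - ((2 * x + 2) * (t - s) ^+ 2) * D =
  2 * ((t - s) * (t - 1) ^+ 3) + (t - s) ^+ 2 * (14 * t + 1) +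
  2 * (t - s) ^+ 2 * (t + 2) *
    ((2 * x - s - t) + (2 * x + 2) * ((t * s - 1) * (s + 2) + (s + 1)))
  by rewrite /D; ring.
have ts1 : 1 <= t * s by rewrite mulr_ege1 //; lra.
have h1 : 0 <= (t - 1) ^+ 3 by rewrite exprn_ge0 //; lra.
have h2 : 0 <= (t - s) ^+ 2 by rewrite sqr_ge0.
apply: addr_ge0; first apply: addr_ge0.
- by rewrite !mulr_ge0 //; lra.
- by rewrite mulr_ge0 //; lra.
apply: mulr_ge0; first by rewrite !mulr_ge0 //; lra.
apply: addr_ge0; first lra.
apply: mulr_ge0; first lra.
by apply: addr_ge0; last lra; apply: mulr_ge0; lra.
Qed.

Lemma pinsker_aux_le1 x : 0 < x -> x <= 1 -> pq x <= ln x.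
Proof.
move=> x0 x1; rewrite -subr_ge0.
have -> : 0 = ln 1 - pq 1 :> R by rewrite ln1 /pq; field.
rewrite -lerN2.
(* The difference decreases on [x, 1], so its opposite is telescoped. The constant blows up at 0,
   which is harmless because x is fixed. *)
apply: (@tele_le (fun x => - (ln x - pq x)) x 1 (2 / x ^+ 2)) => // s t s1 st tx.
have := @pinsker_aux_diff' s t; have -> : 0 < s by lra.
move=> /(_ isT st).
set D := 2 * t * s * (t + 2) * (s + 2).
have D0 : 0 < D by rewrite !mulr_gt0 //; lra.
suff : (t - s) *
  (2 * (s - 1) ^+ 3 + (t - s) * (2 * (s + 2) * (s + t + 2) - (14 * s + 1))) / D
  <= 2 / x ^+ 2 * (t - s) ^+ 2.
  by set X := _ / D; set Y := _ / _ * _; lra.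
rewrite ler_pdivrMr //.
have -> : 2 / x ^+ 2 * (t - s) ^+ 2 * D = D * (2 * (t - s) ^+ 2) / x ^+ 2 by ring.
rewrite ler_pdivlMr ?exprn_gt0 // [_ * x ^+ 2]mulrC.
rewrite -subr_ge0 /D.
have -> : D * (2 * (t - s) ^+ 2) - x ^+ 2 * ((t - s) *
    (2 * (s - 1) ^+ 3 + (t - s) * (2 * (s + 2) * (s + t + 2) - (14 * s + 1)))) =
  x ^+ 2 * (2 * ((t - s) * (1 - s) ^+ 3) + (t - s) ^+ 2 * (14 * s + 1)) +
  2 * (t - s) ^+ 2 * (s + 2) *
    (2 * (t + 2) * (t * s - x ^+ 2) + x ^+ 2 * (2 - s + t))
  by rewrite /D; ring.
have ts1 : x ^+ 2 <= t * s by rewrite expr2 ler_pM //; lra.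
have h1 : 0 <= (1 - s) ^+ 3 by rewrite exprn_ge0 //; lra.
have h2 : 0 <= (t - s) ^+ 2 by rewrite sqr_ge0.
have h3 : 0 <= x ^+ 2 by rewrite sqr_ge0.
apply: addr_ge0.
  apply: mulr_ge0 => //; apply: addr_ge0; first by rewrite !mulr_ge0 //; lra.
  by rewrite mulr_ge0 //; lra.
apply: mulr_ge0; first by rewrite !mulr_ge0 //; lra.
by apply: addr_ge0; rewrite mulr_ge0 //; lra.
Qed.

Lemma pinsker_scalar x : 0 <= x ->
  3 * (x - 1) ^+ 2 <= (2 * x + 4) * (x * ln x - x + 1).
Proof.
rewrite le_eqVlt => /orP[/eqP <-|x0]; first by rewrite mul0r; lra.
have e : (x - 1) * (5 * x + 1) = pq x * (x * (2 * x + 4)).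
  by rewrite /pq; field; rewrite !gt_eqF //=; lra.
have h : pq x <= ln x.
  by have [|/ltW] := leP 1 x; [exact: pinsker_aux_ge1|exact: pinsker_aux_le1].
have : 0 <= (ln x - pq x) * (x * (2 * x + 4)).
  by rewrite !mulr_ge0 ?subr_ge0 //; lra.
rewrite mulrBl -e; lra.
Qed.

(** The derivative ln (r^2 + l) + 2 r^2 / (r^2 + l) of r ln (r^2 + l) is at most (r^2 + l) / m + ln
    m + 1, by the tangent of ln at m. The right-hand side is the integral of this bound from s to t;
    m stays free. *)
Lemma xln_increment_pos l m s t : 0 < l -> 0 < m -> 0 <= s -> s <= t ->
  t * ln (t ^+ 2 + l) - s * ln (s ^+ 2 + l) <=
  (t - s) * ((t ^+ 2 + t * s + s ^+ 2) / 3 + l) / m + (t - s) * (1 + ln m).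
Proof.
move=> l0 m0 s0 st; rewrite -subr_ge0.
pose G x := (x ^+ 3 / 3 + l * x) / m + x * (1 + ln m) - x * ln (x ^+ 2 + l).
have -> : (t - s) * ((t ^+ 2 + t * s + s ^+ 2) / 3 + l) / m
   + (t - s) * (1 + ln m) -
  (t * ln (t ^+ 2 + l) - s * ln (s ^+ 2 + l)) = G t - G s by rewrite /G; ring.
rewrite subr_ge0.
apply: (@tele_le G s t (3 * t / l)) => // u v su uv vt.
have u0 : 0 <= u by lra.
have U0 : 0 < u ^+ 2 + l by rewrite ltr_wpDl ?sqr_ge0.
have V0 : 0 < v ^+ 2 + l by rewrite ltr_wpDl ?sqr_ge0.
have h1 : v * (ln (v ^+ 2 + l) - ln (u ^+ 2 + l))
    <= v * ((v ^+ 2 + l - (u ^+ 2 + l)) / (u ^+ 2 + l)).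
  by rewrite ler_wpM2l ?ln_sub_le //; lra.
have h2 : (v - u) * (ln (u ^+ 2 + l) - ln m) <= (v - u) * ((u ^+ 2 + l - m) / m).
  by rewrite ler_wpM2l ?ln_sub_le //; lra.
have e1 : v * ((v ^+ 2 + l - (u ^+ 2 + l)) / (u ^+ 2 + l)) =
   2 * (v - u) + (v - u) ^+ 2 * (v + 2 * u) / (u ^+ 2 + l) - 2 * l * (v - u) / (u ^+ 2 + l).
  by field; rewrite gt_eqF.
have e2 : (v - u) * ((u ^+ 2 + l - m) / m) =
   (v ^+ 3 / 3 + l * v) / m - (u ^+ 3 / 3 + l * u) / m - (v - u) 
   - (v - u) ^+ 2 * (v + 2 * u) / 3 / m.
  by field; rewrite gt_eqF.
have b1 : 0 <= 2 * l * (v - u) / (u ^+ 2 + l).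
  by rewrite divr_ge0 ?mulr_ge0 //; lra.
have b2 : 0 <= (v - u) ^+ 2 * (v + 2 * u) / 3 / m.
  by rewrite !divr_ge0 ?mulr_ge0 ?sqr_ge0 //; lra.
have b3 : (v - u) ^+ 2 * (v + 2 * u) / (u ^+ 2 + l) <= 3 * t / l * (v - u) ^+ 2.
  have -> : 3 * t / l * (v - u) ^+ 2 = (v - u) ^+ 2 * (3 * t) / l by ring.
  apply: ler_pM; rewrite ?invr_ge0 ?mulr_ge0 ?sqr_ge0 ?ler_wpM2l ?sqr_ge0 //; try lra.
  by rewrite lef_pV2 ?posrE // lerDr sqr_ge0.
rewrite /G.
move: h1 h2; rewrite e1 e2 => h1 h2.
rewrite -!addrA in h1 h2 *.
lra.
Qed.

Lemma xln_increment l m s t : 0 < l -> 0 < m -> s <= t ->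
  t * ln (t ^+ 2 + l) - s * ln (s ^+ 2 + l) <=
  (t - s) * ((t ^+ 2 + t * s + s ^+ 2) / 3 + l) / m + (t - s) * (1 + ln m).
Proof.
move=> l0 m0 st; have [s0|/ltW s0] := leP 0 s; first exact: xln_increment_pos.
have [t0|/ltW t0] := leP t 0.
  have := @xln_increment_pos l m (- t) (- s) l0 m0; rewrite oppr_ge0 => /(_ t0).
  rewrite lerN2 => /(_ st); rewrite !sqrrN => h.
  have -> : (t - s) * ((t ^+ 2 + t * s + s ^+ 2) / 3 + l) / m =
   (- s - - t) * ((s ^+ 2 + - s * - t + t ^+ 2) / 3 + l) / m by ring.
  lra.
(* If 0 lies between s and t, the function being odd, [0, t] and [0, - s] are bounded separately. *)
have h1 := @xln_increment_pos l m 0 t l0 m0 (lexx _) t0.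
have h2 := @xln_increment_pos l m 0 (- s) l0 m0 (lexx _).
rewrite oppr_ge0 in h2; have {}h2 := h2 s0.
rewrite !mul0r !subr0 sqrrN in h2; rewrite !mul0r !subr0 in h1.
have -> : (t - s) * ((t ^+ 2 + t * s + s ^+ 2) / 3 + l) / m =
  t * ((t ^+ 2 + t * 0 + 0 ^+ 2) / 3 + l) / m +
  - s * ((s ^+ 2 + - s * 0 + 0 ^+ 2) / 3 + l) / m by ring.
lra.
Qed.

(* Smooth version of x^2 ln (x^2), with its derivative kreg'. *)
Definition kreg l x := (x ^+ 2 + l) * ln (x ^+ 2 + l).
Definition kreg' l x := 2 * x * (ln (x ^+ 2 + l) + 1).

(** The choice m = l + (x^2 + y^2) / 2 in [xln_increment] leaves, besides the factor (x - y)^2, only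
    the combination x^2 + y^2. For matrices it becomes the operator W |-> (A^2 W + W B^2) / 2, whose
    resolvent can be estimated. *)
Lemma kreg'_increment l x y : 0 < l ->
  (kreg' l x - kreg' l y) * (x - y) <=
  (x - y) ^+ 2 * (6 + 2 * ln (l + (x ^+ 2 + y ^+ 2) / 2)).
Proof.
move=> l0; wlog xy : x y / y <= x => [H|].
  have [|/ltW xy] := leP y x; first exact: H.
  have := H y x xy; rewrite [y ^+ 2 + _]addrC.
  by rewrite -[x - y]opprB sqrrN -[kreg' l x - _]opprB mulrNN.
set m := l + _.
have m0 : 0 < m by rewrite ltr_wpDr // divr_ge0 // addr_ge0 // sqr_ge0.
have h := xln_increment l0 m0 xy.
have d0 : 0 <= x - y by lra.
have h2 : (x - y) * ((x ^+ 2 + x * y + y ^+ 2) / 3 + l) / m <= x - y.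
  rewrite -mulrA ler_piMr // ler_pdivrMr // mul1r /m.
  have := sqr_ge0 (x - y); lra.
have : 0 <= (x - y) * ((x - y) * (2 + ln m) -
   (x * ln (x ^+ 2 + l) - y * ln (y ^+ 2 + l))).
  by rewrite mulr_ge0 //; lra.
rewrite /kreg'; lra.
Qed.

(** Supplies the quadratic error that [tele_le] needs along Y + r Z. The constant blows up as l
    tends to 0, so l is removed only after the increments have been summed. *)
Lemma kreg_semiconcave l b x y : 0 < l -> l <= 1 -> x ^+ 2 <= b -> y ^+ 2 <= b ->
  kreg l x <= kreg l y + kreg' l y * (x - y) + (b + 1 + 4 * b / l) * (x - y) ^+ 2.
Proof.
move=> l0 l1 xb yb.
have X0 : 0 < x ^+ 2 + l by rewrite ltr_wpDl ?sqr_ge0.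
have Y0 : 0 < y ^+ 2 + l by rewrite ltr_wpDl ?sqr_ge0.
have := xlnx_semiconcave X0 Y0; rewrite -/(kreg l x) -/(kreg l y) => h.
have h1 : (ln (y ^+ 2 + l) + 1) * (x - y) ^+ 2 <= (b + 1) * (x - y) ^+ 2.
  by rewrite ler_wpM2r ?sqr_ge0 //; have := ln_le_subr1 Y0; lra.
have h2 : (x ^+ 2 + l - (y ^+ 2 + l)) ^+ 2 / (y ^+ 2 + l) <=
    4 * b / l * (x - y) ^+ 2.
  have -> : (x ^+ 2 + l - (y ^+ 2 + l)) ^+ 2 = (x - y) ^+ 2 * (x + y) ^+ 2 by ring.
  have -> : 4 * b / l * (x - y) ^+ 2 = (x - y) ^+ 2 * (4 * b) / l by ring.
  have hb : (x + y) ^+ 2 <= 4 * b by have := sqr_ge0 (x - y); lra.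
  apply: ler_pM.
  - by rewrite mulr_ge0 ?sqr_ge0.
  - by rewrite invr_ge0 ltW.
  - by rewrite ler_wpM2l ?sqr_ge0.
  - by rewrite lef_pV2 ?posrE // lerDr sqr_ge0.
rewrite /kreg' in h *; lra.
Qed.

Lemma kreg_le l x : 0 <= l ->
  kreg l x <= x ^+ 2 * ln (x ^+ 2) + l * (x ^+ 2 + l).
Proof.
rewrite le_eqVlt => /orP[/eqP <-|l0]; first by rewrite /kreg !addr0; lra.
have X0 : 0 < x ^+ 2 + l by rewrite ltr_wpDl ?sqr_ge0.
have := xlnx_tangent (sqr_ge0 x) X0.
have : l * ln (x ^+ 2 + l) <= l * (x ^+ 2 + l - 1).
  by rewrite ler_wpM2l ?ln_le_subr1 // ltW.
rewrite /kreg; lra.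
Qed.

Lemma xlnx_add_ge t l : 0 <= t -> 0 < l ->
  t * ln t + l * ln l <= (t + l) * ln (t + l).
Proof.
rewrite le_eqVlt => /orP[/eqP <-|t0] l0; first by rewrite mul0r !add0r.
rewrite mulrDl lerD // ler_wpM2l ?le_ln //; lra.
Qed.

Lemma xlnx_add_le t l : 0 <= t -> 0 < l ->
  (t + l) * ln (t + l) <= t * ln t + l * (t + l).
Proof.
move=> t0 l0; have tl0 : 0 < t + l by lra.
have := xlnx_tangent t0 tl0.
have : l * ln (t + l) <= l * (t + l - 1).
  by rewrite ler_wpM2l ?ln_le_subr1 // ltW.
lra.
Qed.

(** Makes l ln l of order s for l = s^2, so that the error in [entropy_limit] is linear in s. *)
Lemma xlnx_sqr_ge s : 0 < s -> - (2 * s) <= s ^+ 2 * ln (s ^+ 2).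
Proof.
move=> s0; have := @ln_le_subr1 s^-1; rewrite invr_gt0 => /(_ s0).
rewrite lnV ?posrE // => h.
have : s ^+ 2 * (- ln s) <= s ^+ 2 * s^-1.
  by rewrite ler_wpM2l ?sqr_ge0 //; lra.
have -> : s ^+ 2 * s^-1 = s by field; rewrite gt_eqF.
rewrite lnXn // mulr2n; lra.
Qed.

(** Gibbs' variational principle for unnormalised weights: the tangent bound for ln (c i) is taken
    at v_i S / V, which is proportional to v and has the total mass of c. *)
Lemma gibbs n (v c : 'I_n -> R) : (forall i, 0 <= v i) -> (forall i, 0 < c i) ->
  \sum_i v i * ln (c i) <=
  \sum_i v i * ln (v i) + (\sum_i v i) * (ln (\sum_i c i) - ln (\sum_i v i)).
Proof.
move=> v0 c0; set V := \sum_i v i; set S := \sum_i c i.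
have [V0|V0] := eqVneq V 0.
  have vi i : v i = 0.
    have := V0; rewrite /V => /eqP; rewrite psumr_eq0 // => /allP /(_ i).
    by rewrite mem_index_enum => /(_ isT) /eqP.
  rewrite V0 mul0r addr0 ler_sum // => i _; by rewrite vi !mul0r.
have Vp : 0 < V by rewrite lt_def V0 sumr_ge0.
have n0 : (0 < n)%N.
  case: n v c v0 c0 @V @S V0 Vp => // v c v0 c0 V S; by rewrite /V big_ord0 eqxx.
have Sp : 0 < S.
  rewrite /S (bigD1 (Ordinal n0)) //= ltr_wpDr // sumr_ge0 // => i _; exact: ltW.
have key i : v i * ln (c i) <= v i * ln (v i) + v i * (ln S - ln V)
     + (c i * (V / S) - v i).
  have := v0 i; rewrite le_eqVlt => /orP[/eqP <-|vp].
    by rewrite !mul0r !add0r subr0 mulr_ge0 ?divr_ge0 // ltW.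
  have q0 : 0 < v i * S / V by rewrite divr_gt0 // mulr_gt0.
  have := ln_sub_le (c0 i) q0; rewrite -(ler_pM2l vp) => h.
  rewrite ln_div ?posrE ?mulr_gt0 // lnM ?posrE // in h.
  have e : v i * ((c i - v i * S / V) / (v i * S / V)) = c i * (V / S) - v i.
    by field; rewrite !gt_eqF.
  rewrite e in h; lra.
apply: le_trans (ler_sum _ (fun i _ => key i)) _.
rewrite !big_split /= sumrN -!mulr_suml -/V -/S.
have -> : S * (V / S) = V by field; rewrite gt_eqF.
lra.
Qed.

(* The logarithm is, up to a constant, the primitive of -1/(l + _) in l. *)
Lemma sum_ln_le_of_resolvent (I J : finType) (w u : I -> R) (v c : J -> R) l :
  (forall i, 0 <= w i) -> (forall i, 0 <= u i) ->
  (forall j, 0 <= v j) -> (forall j, 0 <= c j) ->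
  \sum_i w i = \sum_j v j ->
  (forall s, 0 < s -> \sum_j v j / (s + c j) <= \sum_i w i / (s + u i)) ->
  0 < l -> \sum_i w i * ln (l + u i) <= \sum_j v j * ln (l + c j).
Proof.
move=> w0 u0 v0 c0 wv res l0.
pose F s := \sum_i w i * ln (s + u i) - \sum_j v j * ln (s + c j).
suff : F l <= 0 by rewrite /F subr_le0.
pose W := \sum_i w i.
have W0 : 0 <= W by exact: sumr_ge0.
have mono L : l <= L -> F l <= F L.
  move=> lL; apply: (@tele_le F l L (W / l ^+ 2)) => // s t ls st tL.
  have s0 : 0 < s by lra.
  have t0 : 0 < t by lra.
  have hw : \sum_i w i / (s + u i) * (t - s) - W / l ^+ 2 * (t - s) ^+ 2 <=
     \sum_i (w i * ln (t + u i) - w i * ln (s + u i)).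
    rewrite /W -!mulrA !mulr_suml -sumrB ler_sum // => i _.
    have su : 0 < s + u i by rewrite ltr_wpDr.
    have tu : 0 < t + u i by rewrite ltr_wpDr.
    rewrite -!mulrBr -!mulrA -mulrBr ler_wpM2l //.
    apply: le_trans (ln_sub_ge tu su).
    have -> : t + u i - (s + u i) = t - s by ring.
    rewrite -subr_ge0.
    have -> : (t - s) / (t + u i) - ((s + u i)^-1 * (t - s) - (l ^+ 2)^-1 * (t - s) ^+ 2)
       = (t - s) ^+ 2 * ((l ^+ 2)^-1 - ((t + u i) * (s + u i))^-1).
      by field; rewrite !gt_eqF.
    rewrite mulr_ge0 ?sqr_ge0 // subr_ge0 lef_pV2 ?posrE ?mulr_gt0 //.
    by rewrite expr2 ler_pM //; have := u0 i; lra.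
  have hv : \sum_j (v j * ln (t + c j) - v j * ln (s + c j)) <=
     (\sum_j v j / (s + c j)) * (t - s).
    rewrite mulr_suml ler_sum // => j _.
    have su : 0 < s + c j by rewrite ltr_wpDr.
    have tu : 0 < t + c j by rewrite ltr_wpDr.
    rewrite -mulrBr -mulrA ler_wpM2l // mulrC.
    have -> : t - s = t + c j - (s + c j) by ring.
    exact: ln_sub_le.
  have hr : (\sum_j v j / (s + c j)) * (t - s) <= (\sum_i w i / (s + u i)) * (t - s).
    by rewrite ler_wpM2r ?res //; lra.
  rewrite !sumrB in hw hv; rewrite /F.
  rewrite -mulr_suml in hw.
  lra.
(* The total masses agree, so the [ln L] terms cancel at L = l + n + 1 and at most O(1 / n) is left
   of F. *)
apply: (@le0_of_le_divn _ (\sum_i w i * u i)) => n.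
pose L := l + n.+1%:R.
have n0 : 0 < n.+1%:R :> R by rewrite ltr0Sn.
have L0 : 0 < L by rewrite addr_gt0.
apply: le_trans (mono L _) _; first by rewrite lerDl ltW.
have h1 : \sum_i w i * ln (L + u i) <= \sum_i w i * ln L + (\sum_i w i * u i) / n.+1%:R.
  rewrite mulr_suml -big_split /= ler_sum // => i _.
  rewrite -mulrA -mulrDr ler_wpM2l //.
  have Lu : 0 < L + u i by rewrite ltr_wpDr.
  have := ln_sub_le Lu L0; have -> : L + u i - L = u i by ring.
  have : u i / L <= u i / n.+1%:R.
    by rewrite ler_wpM2l // lef_pV2 ?posrE // lerDr ltW.
  set A := u i / L; set B := u i / _; lra.
have h2 : \sum_j v j * ln L <= \sum_j v j * ln (L + c j).
  by rewrite ler_sum // => j _; rewrite ler_wpM2l // le_ln // lerDl.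
rewrite -!mulr_suml wv in h1 h2; rewrite /F.
by move: h1; set D := _ / n.+1%:R; lra.
Qed.

End Scalar.

(** * Spectral calculus *)

Section Adjoint.
Variable R : realType.
Local Notation C := R[i].

Lemma adjE m n (A : 'M[C]_(m, n)) i j : adj A i j = (A j i)^*.
Proof. by rewrite !mxE. Qed.

Lemma adj_trmxC m n (A : 'M[C]_(m, n)) : adj A = map_mx Num.Def.conjC A^T.
Proof. by rewrite /adj map_trmx. Qed.

Lemma adjK m n (A : 'M[C]_(m, n)) : adj (adj A) = A.
Proof. by apply/matrixP => i j; rewrite !adjE conjcK. Qed.

Lemma adjM m n p (A : 'M[C]_(m, n)) (B : 'M[C]_(n, p)) :
  adj (A *m B) = adj B *m adj A.
Proof. by rewrite /adj map_mxM trmx_mul. Qed.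

Lemma adjD m n (A B : 'M[C]_(m, n)) : adj (A + B) = adj A + adj B.
Proof. by rewrite /adj map_mxD linearD. Qed.

Lemma adjN m n (A : 'M[C]_(m, n)) : adj (- A) = - adj A.
Proof. by rewrite /adj map_mxN linearN. Qed.

Lemma adjB m n (A B : 'M[C]_(m, n)) : adj (A - B) = adj A - adj B.
Proof. by rewrite adjD adjN. Qed.

Lemma adj0 m n : adj (0 : 'M[C]_(m, n)) = 0.
Proof. by rewrite /adj map_mx0 trmx0. Qed.

Lemma adjZ m n (r : R) (A : 'M[C]_(m, n)) : adj (r%:C *: A) = r%:C *: adj A.
Proof. by apply/matrixP => i j; rewrite adjE !mxE rmorphM /= oppr0. Qed.

Lemma adj_mx1 n : adj (1%:M : 'M[C]_n) = 1%:M.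
Proof. by rewrite /adj map_mx1 trmx1. Qed.

Definition unitary n (U : 'M[C]_n) := adj U *m U = 1%:M /\ U *m adj U = 1%:M.

Lemma unitaryP n (U : 'M[C]_n) : U \is unitarymx -> unitary U.
Proof.
move=> /unitarymxP; rewrite -adj_trmxC => h; split=> //; exact: mulmx1C.
Qed.

Lemma unitary_adj n (U : 'M[C]_n) : unitary U -> unitary (adj U).
Proof. by case=> h1 h2; split; rewrite adjK. Qed.

Lemma unitaryM n (U V : 'M[C]_n) : unitary U -> unitary V -> unitary (U *m V).
Proof.
case=> u1 u2 [v1 v2]; split; rewrite adjM -mulmxA.
  by rewrite [adj U *m _]mulmxA u1 mul1mx.
by rewrite [V *m _]mulmxA v2 mul1mx.
Qed.

Lemma unitary_invol n (P : 'M[C]_n) : adj P = P -> P *m P = 1%:M -> unitary P.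
Proof. by move=> h1 h2; split; rewrite h1. Qed.

End Adjoint.

(** * Real traces and the Hilbert-Schmidt norm *)

Section RealTrace.
Variable R : realType.
Local Notation C := R[i].

Definition nsq (z : C) : R := complex.Re z ^+ 2 + complex.Im z ^+ 2.

Lemma nsq_ge0 z : 0 <= nsq z.
Proof. by rewrite addr_ge0 // sqr_ge0. Qed.

Lemma nsqE z : (nsq z)%:C = z * z^*.
Proof.
by case: z => a b; rewrite /nsq; simpc; congr (_ +i* _); ring.
Qed.

Lemma ReD (x y : C) : complex.Re (x + y) = complex.Re x + complex.Re y.
Proof. by case: x y => a b []. Qed.

Lemma ReN (x : C) : complex.Re (- x) = - complex.Re x.
Proof. by case: x. Qed.

Lemma ReZ (r : R) (x : C) : complex.Re (r%:C * x) = r * complex.Re x.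
Proof. by case: x => a b; rewrite /= mul0r subr0. Qed.

Lemma Re_sum I (s : seq I) (P : pred I) (F : I -> C) :
  complex.Re (\sum_(i <- s | P i) F i) = \sum_(i <- s | P i) complex.Re (F i).
Proof. by apply: (big_morph _ ReD). Qed.

Definition Tr n (A : 'M[C]_n) : R := complex.Re (\tr A).

Lemma TrD n (A B : 'M[C]_n) : Tr (A + B) = Tr A + Tr B.
Proof. by rewrite /Tr mxtraceD ReD. Qed.

Lemma TrN n (A : 'M[C]_n) : Tr (- A) = - Tr A.
Proof. by rewrite /Tr raddfN ReN. Qed.

Lemma TrB n (A B : 'M[C]_n) : Tr (A - B) = Tr A - Tr B.
Proof. by rewrite TrD TrN. Qed.

Lemma TrZ n (r : R) (A : 'M[C]_n) : Tr (r%:C *: A) = r * Tr A.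
Proof. by rewrite /Tr mxtraceZ ReZ. Qed.

Lemma Tr0 n : Tr (0 : 'M[C]_n) = 0.
Proof. by rewrite /Tr mxtrace0. Qed.

Lemma Tr1 n : Tr (1%:M : 'M[C]_n) = n%:R.
Proof. by rewrite /Tr mxtrace1 -(rmorph_nat (real_complex R)). Qed.

Lemma Tr_sum n I (s : seq I) (P : pred I) (F : I -> 'M[C]_n) :
  Tr (\sum_(i <- s | P i) F i) = \sum_(i <- s | P i) Tr (F i).
Proof. exact: (big_morph _ (@TrD n) (@Tr0 n)). Qed.

Lemma TrC n (A B : 'M[C]_n) : Tr (A *m B) = Tr (B *m A).
Proof. by rewrite /Tr mxtrace_mulC. Qed.

Lemma Tr_adj n (A : 'M[C]_n) : Tr (adj A) = Tr A.
Proof.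
rewrite /Tr /mxtrace !Re_sum; apply: eq_bigr => i _.
by rewrite adjE; case: (A i i).
Qed.

Lemma Tr_conj n (U A : 'M[C]_n) : unitary U -> Tr (U *m A *m adj U) = Tr A.
Proof. by case=> h _; rewrite -mulmxA TrC -mulmxA h mulmx1. Qed.

(** The squared Hilbert-Schmidt norm. *)
Definition hs n (A : 'M[C]_n) : R := Tr (adj A *m A).

Lemma hsE n (A : 'M[C]_n) : hs A = \sum_i \sum_j nsq (A i j).
Proof.
rewrite /hs /Tr /mxtrace Re_sum exchange_big /=; apply: eq_bigr => j _.
rewrite mxE Re_sum; apply: eq_bigr => i _.
by rewrite adjE mulrC -nsqE.
Qed.

Lemma hs_ge0 n (A : 'M[C]_n) : 0 <= hs A.
Proof. by rewrite hsE; do 2!(apply: sumr_ge0 => ? _); rewrite nsq_ge0. Qed.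

End RealTrace.

(** * Functional calculus of hermitian matrices *)

Section Spectral.
Variables (R : realType) (d : nat).
Local Notation C := R[i].
Implicit Types (A B S U V : 'M[C]_d) (f g : R -> R) (v w : 'I_d -> R).

Definition rdiag v : 'M[C]_d := diag_mx (\row_i (v i)%:C).
Definition dg U v : 'M[C]_d := adj U *m rdiag v *m U.
Definition eigU A : 'M[C]_d := spectralmx A.
Definition eig A (i : 'I_d) : R := complex.Re (spectral_diag A 0 i).
(** Functional calculus in the eigenbasis selected by [spectralmx]. For hermitian matrices
    [fnm_intertwine] and [fnm_dg] show that the selection does not matter. *)
Definition fnm f A : 'M[C]_d := dg (eigU A) (fun i => f (eig A i)).

Lemma rdiagE v i j : rdiag v i j = (v i)%:C *+ (i == j).
Proof. by rewrite /rdiag !mxE. Qed.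

Lemma adj_rdiag v : adj (rdiag v) = rdiag v.
Proof.
apply/matrixP => i j; rewrite adjE !rdiagE eq_sym.
by case: eqP => [->|_]; rewrite ?mulr1n ?mulr0n ?conjc_real ?conjc0.
Qed.

Lemma adj_dg U v : adj (dg U v) = dg U v.
Proof. by rewrite /dg !adjM adjK adj_rdiag mulmxA. Qed.

Lemma eigU_unitary A : unitary (eigU A).
Proof. by apply: unitaryP; rewrite spectral_unitarymx. Qed.

Lemma eig_decomp A : adj A = A -> dg (eigU A) (eig A) = A.
Proof.
move=> hA; have hh : A \is hermsymmx.
  apply/is_hermitianmxP; rewrite expr0 scale1r.
  by rewrite -{1}hA /adj map_trmx.
have/orthomx_spectralP := hermitian_normalmx hh.
have -> : invmx (spectralmx A) = adj (spectralmx A).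
  by rewrite adj_trmxC; exact: invmx_unitary (spectral_unitarymx A).
move=> e; rewrite [RHS]e /dg /eigU /rdiag.
have -> : \row_i (eig A i)%:C = spectral_diag A; last by [].
apply/rowP => i; rewrite mxE /eig.
have /mxOverP /(_ 0 i) := hermitian_spectral_diag_real hh.
exact: RRe_real.
Qed.

Lemma adj_fnm f A : adj (fnm f A) = fnm f A.
Proof. exact: adj_dg. Qed.

Lemma fnm_id A : adj A = A -> fnm id A = A.
Proof. exact: eig_decomp. Qed.

Lemma rdiagM v w : rdiag v *m rdiag w = rdiag (fun i => v i * w i).
Proof.
apply/matrixP => i j; rewrite /rdiag mul_diag_mx !mxE.
by case: eqP => [->|_]; rewrite ?mulr1n ?mulr0n ?mulr0 ?rmorphM.
Qed.

Lemma dgM U v w : unitary U -> dg U v *m dg U w = dg U (fun i => v i * w i).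
Proof.
case=> _; rewrite /dg -rdiagM; move: (rdiag v) (rdiag w) (adj U) => M N V h.
by rewrite !mulmxA -[_ *m U *m V]mulmxA h mulmx1.
Qed.

Lemma fnmM f g A : fnm f A *m fnm g A = fnm (fun x => f x * g x) A.
Proof. by rewrite /fnm dgM //; exact: eigU_unitary. Qed.

Lemma fnm_const (c : R) A : fnm (fun=> c) A = c%:C *: 1%:M.
Proof.
rewrite /fnm /dg; have -> : rdiag (fun=> c) = c%:C *: 1%:M.
  by apply/matrixP => i j; rewrite rdiagE !mxE mulr_natr.
have [h _] := eigU_unitary A.
by rewrite -scalemxAr -scalemxAl mulmx1 h.
Qed.

Lemma eq_fnm f g A : f =1 g -> fnm f A = fnm g A.
Proof.
move=> fg; rewrite /fnm /dg /rdiag; congr (_ *m diag_mx _ *m _).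
by apply/rowP => i; rewrite !mxE fg.
Qed.

(** The weights are nonnegative, so a scalar inequality in two variables, summed over pairs of
    eigenvalues, becomes a trace inequality. *)
Lemma Tr_dg_pair U V S v w :
  Tr (dg U v *m S *m dg V w *m adj S) =
  \sum_k \sum_l nsq ((U *m S *m adj V) k l) * (v k * w l).
Proof.
set T := U *m S *m adj V.
have -> : Tr (dg U v *m S *m dg V w *m adj S) = Tr (rdiag v *m T *m rdiag w *m adj T).
  rewrite /dg /T !adjM adjK.
  move: (rdiag v) (rdiag w) (adj U) (adj V) (adj S) => M N U' V' S'.
  transitivity (Tr (U' *m (M *m U *m S *m V' *m N *m V *m S'))).
    by rewrite !mulmxA.
  by rewrite (TrC U') !mulmxA.
move: T => T; rewrite /Tr /mxtrace Re_sum; apply: eq_bigr => k _.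
rewrite mxE Re_sum; apply: eq_bigr => l _.
rewrite adjE /rdiag mul_mx_diag mul_diag_mx !mxE.
rewrite -[X in _ = X]/(complex.Re ((nsq (T k l) * (v k * w l))%:C)).
by congr complex.Re; rewrite !rmorphM /= nsqE; ring.
Qed.

Lemma Tr_dg U v : unitary U -> Tr (dg U v) = \sum_k v k.
Proof.
case=> _ h; rewrite /dg -mulmxA TrC -mulmxA h mulmx1 /Tr /mxtrace Re_sum.
by apply: eq_bigr => k _; rewrite rdiagE eqxx.
Qed.

Lemma Tr_fnm f A : Tr (fnm f A) = \sum_k f (eig A k).
Proof. by rewrite /fnm Tr_dg //; exact: eigU_unitary. Qed.

Lemma sum_nsq_row U k : unitary U -> \sum_l nsq (U k l) = 1.
Proof.
case=> _ h; have := congr1 (fun M : 'M[C]_d => complex.Re (M k k)) h.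
rewrite !mxE eqxx /= Re_sum => <-; apply: eq_bigr => l _.
by rewrite adjE -nsqE.
Qed.

Lemma sum_nsq_col U l : unitary U -> \sum_k nsq (U k l) = 1.
Proof.
move=> /unitary_adj /(@sum_nsq_row _ l) <-; apply: eq_bigr => k _.
by rewrite adjE; case: (U k l) => a b; rewrite /nsq /= sqrrN.
Qed.

(** For unitary [S] the weights of [Tr_dg_pair] are doubly stochastic, and one choice serves all
    functions at once; single sums over eigenvalues can thus be spread over pairs. *)
Lemma pair_unitary A B S f g : unitary S -> 
  exists p : 'I_d -> 'I_d -> R,
  [/\ forall k l, 0 <= p k l, forall k, \sum_l p k l = 1,
      forall l, \sum_k p k l = 1 &
      forall f g, Tr (fnm f A *m S *m fnm g B *m adj S) =
       \sum_k \sum_l p k l * (f (eig A k) * g (eig B l))].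
Proof.
move=> uS; pose T := eigU A *m S *m adj (eigU B).
have uT : unitary T.
  apply: unitaryM; last exact/unitary_adj/eigU_unitary.
  by apply: unitaryM => //; exact: eigU_unitary.
exists (fun k l => nsq (T k l)); split=> [k l|k|l|f' g'].
- exact: nsq_ge0.
- exact: sum_nsq_row.
- exact: sum_nsq_col.
- exact: Tr_dg_pair.
Qed.

(** In the two eigenbases the hypothesis reads T_kl b_l = a_k T_kl, so T_kl vanishes unless b_l =
    a_k, and then f takes the same value at both. *)
Lemma fnm_intertwine f A B S : adj A = A -> adj B = B ->
  S *m B = A *m S -> S *m fnm f B = fnm f A *m S.
Proof.
move=> hA hB h.
have [uA1 uA2] := eigU_unitary A; have [uB1 uB2] := eigU_unitary B.
pose T := eigU A *m S *m adj (eigU B).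
have hT : T *m rdiag (eig B) = rdiag (eig A) *m T.
  rewrite -(eig_decomp hA) -(eig_decomp hB) in h.
  have := congr1 (fun M => eigU A *m M *m adj (eigU B)) h.
  rewrite /dg /T !mulmxA uA2 mul1mx -![_ *m eigU B *m adj (eigU B)]mulmxA uB2 mulmx1.
  done.
have hTf : T *m rdiag (fun i => f (eig B i)) = rdiag (fun i => f (eig A i)) *m T.
  apply/matrixP => k l; have := congr1 (fun M : 'M[C]_d => M k l) hT.
  rewrite /rdiag !mul_mx_diag !mul_diag_mx !mxE => /eqP.
  rewrite mulrC -subr_eq0 -mulrBl mulf_eq0 => /orP[|/eqP ->]; last by rewrite mul0r mulr0.
  by rewrite subr_eq0 => /eqP /complexI ->; rewrite mulrC.
have := congr1 (fun M => adj (eigU A) *m M *m eigU B) hTf.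
rewrite /T /fnm /dg !mulmxA uA1 mul1mx => ->.
by rewrite -mulmxA uB1 mulmx1.
Qed.

Lemma fnm_conj f A U : adj A = A -> unitary U ->
  fnm f (U *m A *m adj U) = U *m fnm f A *m adj U.
Proof.
move=> hA [u1 u2].
have h1 : adj (U *m A *m adj U) = U *m A *m adj U.
  by rewrite !adjM adjK hA mulmxA.
have h2 : U *m A = U *m A *m adj U *m U by rewrite -mulmxA u1 mulmx1.
by rewrite (fnm_intertwine f h1 hA h2) -[RHS]mulmxA u2 mulmx1.
Qed.

(* Writing [U* diag(v) U] in the spectral basis of itself identifies its
   eigenvalues up to a permutation-like matching, by intertwining. *)
Lemma fnm_dg f U v : unitary U -> fnm f (dg U v) = dg U (fun i => f (v i)).
Proof.
move=> [u1 u2]; set A := dg U v.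
have hA : adj A = A by exact: adj_dg.
have [uA1 uA2] := eigU_unitary A.
pose T := eigU A *m adj U.
have hT : rdiag (eig A) *m T = T *m rdiag v.
  have := eig_decomp hA; rewrite {2}/A => /(congr1 (fun M => eigU A *m M *m adj U)).
  rewrite /dg /T !mulmxA uA2 mul1mx -[_ *m U *m adj U]mulmxA u2 mulmx1.
  done.
have hTf : rdiag (fun i => f (eig A i)) *m T = T *m rdiag (fun i => f (v i)).
  apply/matrixP => k l; have := congr1 (fun M : 'M[C]_d => M k l) hT.
  rewrite /rdiag !mul_mx_diag !mul_diag_mx !mxE => /eqP.
  rewrite [X in _ == X]mulrC -subr_eq0 -mulrBl mulf_eq0.
  move=> /orP[|/eqP ->]; last by rewrite mul0r mulr0.
  by rewrite subr_eq0 => /eqP /complexI ->; rewrite mulrC.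
have := congr1 (fun M => adj (eigU A) *m M *m U) hTf.
rewrite /T !mulmxA -!(mulmxA _ (adj U) U) u1 !mulmx1 /fnm /dg => ->.
by rewrite uA1 mul1mx.
Qed.

Lemma fnm_comp f g A : fnm f (fnm g A) = fnm (fun x => f (g x)) A.
Proof. by rewrite {2}/fnm fnm_dg //; exact: eigU_unitary. Qed.

End Spectral.

(** * Two-uniform convexity in entropic form *)

Section Convexity.
Variables (R : realType) (d : nat).
Local Notation C := R[i].
Implicit Types (A B Q W S U V : 'M[C]_d) (f g : R -> R).

Definition sq A : R := Tr (A *m A).
Definition xlnx2 (x : R) : R := x ^+ 2 * ln (x ^+ 2).
(** The unnormalised entropy of A^2, that is Tr A^2 ln A^2 - Tr A^2 ln Tr A^2; for hermitian A it
    depends on A^2 only. *)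
Definition Ent A : R := Tr (fnm xlnx2 A) - sq A * ln (sq A).

Lemma sqE A : adj A = A -> sq A = \sum_i eig A i ^+ 2.
Proof.
move=> hA; rewrite /sq -{1 2}(fnm_id hA) fnmM Tr_fnm.
by apply: eq_bigr => i _; rewrite expr2.
Qed.

Lemma sq_ge0 A : adj A = A -> 0 <= sq A.
Proof. by move=> hA; rewrite sqE //; apply: sumr_ge0 => i _; rewrite sqr_ge0. Qed.

Lemma Tr_fnm2 f g A B : Tr (fnm f A *m fnm g B) =
  \sum_k \sum_l nsq ((eigU A *m adj (eigU B)) k l) * (f (eig A k) * g (eig B l)).
Proof.
have := @Tr_dg_pair R d (eigU A) (eigU B) 1%:M
  (fun i => f (eig A i)) (fun i => g (eig B i)).
by rewrite adj_mx1 !mulmx1.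
Qed.

Lemma Tr_adjM A B : Tr (adj A *m B) =
  \sum_i \sum_j complex.Re ((A i j)^* * B i j).
Proof.
rewrite /Tr /mxtrace Re_sum exchange_big /=; apply: eq_bigr => j _.
by rewrite mxE Re_sum; apply: eq_bigr => i _; rewrite adjE.
Qed.

(** Completing the square, with equality at x = y / m: every test vector x bounds the quadratic form
    of an inverse from below. *)
Lemma nsq_resolvent (x y : C) (m : R) : 0 < m ->
  2 * complex.Re (x^* * y) - m * nsq x <= nsq y / m.
Proof.
move=> m0; case: x y => a b [c e]; rewrite /nsq /=.
rewrite ler_pdivlMr // -subr_ge0.
have -> : c ^+ 2 + e ^+ 2 - (2 * (a * c - - b * e) - m * (a ^+ 2 + b ^+ 2)) * m
  = (c - m * a) ^+ 2 + (e - m * b) ^+ 2 by ring.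
by rewrite addr_ge0 // sqr_ge0.
Qed.

Lemma Tr_mul_dg S U w : Tr (S *m dg U w) =
  \sum_j w j * complex.Re ((U *m S *m adj U) j j).
Proof.
rewrite /dg !mulmxA TrC !mulmxA TrC /Tr /mxtrace Re_sum; apply: eq_bigr => j _.
by rewrite /rdiag mul_diag_mx !mxE ReZ.
Qed.

Lemma eigU_mul A : adj A = A -> eigU A *m A = rdiag (eig A) *m eigU A.
Proof.
move=> hA; have [_ u2] := eigU_unitary A.
have := congr1 (fun M => eigU A *m M) (eig_decomp hA).
by rewrite /dg !mulmxA u2 mul1mx.
Qed.

Lemma mul_eigU A : adj A = A -> A *m adj (eigU A) = adj (eigU A) *m rdiag (eig A).
Proof.
by move=> hA; have := congr1 (@adj _ _ _) (eigU_mul hA); rewrite !adjM hA adj_rdiag.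
Qed.

Lemma nsq_half (x y : C) (r s : R) : 2%:C * x = r%:C * y - y * s%:C ->
  nsq x = (r - s) ^+ 2 / 4 * nsq y.
Proof.
case: x y => x1 x2 [y1 y2] [h1 h2]; rewrite /nsq /=.
have -> : x1 = (r - s) * y1 / 2 by lra.
have -> : x2 = (r - s) * y2 / 2 by lra.
by field.
Qed.

Section Pair.
Variables A B Q : 'M[C]_d.
Hypotheses (hA : adj A = A) (hB : adj B = B) (hQ : A - B = 2%:C *: Q).

Let T := eigU A *m adj (eigU B).
(** With the eigenbasis of [A] on the left and that of [B] on the right, W |-> A^2 W and W |-> W B^2
    are diagonal simultaneously. *)
Let rot W := eigU A *m W *m adj (eigU B).
Let a := eig A.
Let b := eig B.
(** The diagonal of (A^2 + B^2) / 2 in the eigenbasis of [Q]; it suffices because the test matrix in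
    [resolvent] is diagonal there. *)
Let c j := complex.Re
  ((eigU Q *m (2^-1%:C *: (A *m A + B *m B)) *m adj (eigU Q)) j j).

Let herm_Q : adj Q = Q.
Proof.
have -> : Q = 2^-1%:C *: (A - B).
  by rewrite hQ scalerA -rmorphM mulVf ?pnatr_eq0 // scale1r.
by rewrite adjZ adjB hA hB.
Qed.

Let rotQ k l : nsq (rot Q k l) = (a k - b l) ^+ 2 / 4 * nsq (T k l).
Proof.
have [uA1 uA2] := eigU_unitary A; have [uB1 uB2] := eigU_unitary B.
have e : 2%:C *: rot Q = rdiag a *m T - T *m rdiag b.
  transitivity (eigU A *m (A - B) *m adj (eigU B)).
    by rewrite hQ -scalemxAr -scalemxAl.
  rewrite mulmxBr mulmxBl (eigU_mul hA) -[eigU A *m B *m _]mulmxA (mul_eigU hB) /T.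
  by move: (rdiag a) (rdiag b) (adj _) => M N V; rewrite !mulmxA.
have := congr1 (fun M : 'M[C]_d => M k l) e.
rewrite [in RHS]/rdiag mul_diag_mx mul_mx_diag !mxE -!/(rdiag _).
exact: nsq_half.
Qed.

Let rot_mass W f g : \sum_k \sum_l nsq (rot W k l) * (f (a k) * g (b l)) =
  Tr (fnm f A *m W *m fnm g B *m adj W).
Proof. by rewrite /fnm Tr_dg_pair. Qed.

Let rot_inner V W :
  \sum_k \sum_l complex.Re ((rot V k l)^* * rot W k l) = Tr (adj V *m W).
Proof.
have [uA1 uA2] := eigU_unitary A; have [uB1 uB2] := eigU_unitary B.
rewrite -Tr_adjM /rot !adjM adjK -!mulmxA [adj (eigU A) *m _]mulmxA uA1 mul1mx.
by rewrite TrC -!mulmxA uB1 mulmx1.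
Qed.

Let z := sq Q.
Let ze := eig Q.

Let rot_Q_total : \sum_k \sum_l nsq (rot Q k l) = z.
Proof.
transitivity (Tr (adj Q *m Q)); last by rewrite herm_Q.
rewrite -rot_inner; apply: eq_bigr => k _; apply: eq_bigr => l _.
by rewrite mulrC -nsqE.
Qed.

Let c_ge0 j : 0 <= c j.
Proof.
rewrite /c -scalemxAr -scalemxAl mxE ReZ mulr_ge0 ?invr_ge0 // mulmxDr mulmxDl mxE ReD.
have pos M : adj M = M -> 0 <= complex.Re ((eigU Q *m (M *m M) *m adj (eigU Q)) j j).
  move=> hM; have -> : eigU Q *m (M *m M) *m adj (eigU Q) =
     (eigU Q *m M) *m adj (eigU Q *m M) by rewrite adjM hM !mulmxA.
  rewrite mxE Re_sum sumr_ge0 // => i _.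
  by rewrite adjE -nsqE nsq_ge0.
by rewrite addr_ge0 ?pos.
Qed.

Let c_total : \sum_j c j = (sq A + sq B) / 2.
Proof.
have [u1 u2] := eigU_unitary Q.
have -> : \sum_j c j = Tr (eigU Q *m (2^-1%:C *: (A *m A + B *m B)) *m adj (eigU Q)).
  by rewrite /Tr /mxtrace Re_sum.
by rewrite Tr_conj // TrZ TrD mulrC.
Qed.

(* Evaluating the variational form of the inverse of
   W |-> s W + (A^2 W + W B^2)/2 at a matrix W diagonal in the eigenbasis of Q. *)
Let resolvent s : 0 < s ->
  \sum_j ze j ^+ 2 / (s + c j) <=
  \sum_(kl : 'I_d * 'I_d) nsq (rot Q kl.1 kl.2) /
      (s + (a kl.1 ^+ 2 + b kl.2 ^+ 2) / 2).
Proof.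
move=> s0; rewrite -(pair_bigA _ (fun k l => nsq (rot Q k l) /
  (s + (a k ^+ 2 + b l ^+ 2) / 2))) /=.
have uQ := eigU_unitary Q.
(* The maximiser of 2 w ze_j - (s + c_j) w^2, to which the variational bound reduces. *)
pose w j := ze j / (s + c j).
pose W := dg (eigU Q) w.
have hW : adj W = W by exact: adj_dg.
have m0 k l : 0 < s + (a k ^+ 2 + b l ^+ 2) / 2.
  by rewrite ltr_wpDr // divr_ge0 // addr_ge0 // sqr_ge0.
have key : \sum_k \sum_l (2 * complex.Re ((rot W k l)^* * rot Q k l) -
    (s + (a k ^+ 2 + b l ^+ 2) / 2) * nsq (rot W k l)) <=
    \sum_k \sum_l nsq (rot Q k l) / (s + (a k ^+ 2 + b l ^+ 2) / 2).
  by apply: ler_sum => k _; apply: ler_sum => l _; exact: nsq_resolvent.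
apply: le_trans key.
have collect (F G : 'I_d -> 'I_d -> R) :
    \sum_k \sum_l (2 * F k l - (s + (a k ^+ 2 + b l ^+ 2) / 2) * G k l) =
    2 * (\sum_k \sum_l F k l) - s * (\sum_k \sum_l G k l * (1 * 1))
    - 2^-1 * (\sum_k \sum_l G k l * (a k ^+ 2 * 1))
    - 2^-1 * (\sum_k \sum_l G k l * (1 * b l ^+ 2)).
  rewrite !mulr_sumr -!sumrB; apply: eq_bigr => k _.
  rewrite !mulr_sumr -!sumrB; apply: eq_bigr => l _.
  by move: (a k) (b l) (F k l) (G k l) => x y z1 z2; field.
have -> : \sum_k \sum_l (2 * complex.Re ((rot W k l)^* * rot Q k l) -
    (s + (a k ^+ 2 + b l ^+ 2) / 2) * nsq (rot W k l)) =
  2 * Tr (adj W *m Q) - s * Tr (fnm (fun=> 1) A *m W *m fnm (fun=> 1) B *m adj W)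
  - 2^-1 * Tr (fnm (fun x => x ^+ 2) A *m W *m fnm (fun=> 1) B *m adj W)
  - 2^-1 * Tr (fnm (fun=> 1) A *m W *m fnm (fun x => x ^+ 2) B *m adj W).
  apply: etrans (collect (fun k l => complex.Re ((rot W k l)^* * rot Q k l))
    (fun k l => nsq (rot W k l))) _.
  congr (2 * _ - s * _ - 2^-1 * _ - 2^-1 * _).
  - exact: rot_inner.
  - exact: (rot_mass W (fun=> 1) (fun=> 1)).
  - exact: (rot_mass W (fun x => x ^+ 2) (fun=> 1)).
  - exact: (rot_mass W (fun=> 1) (fun x => x ^+ 2)).
rewrite !fnm_const !scale1r !mul1mx !mulmx1 hW.
have sqM M : adj M = M -> fnm (fun x => x ^+ 2) M = M *m M.
  move=> hM; rewrite -{2 3}(fnm_id hM) fnmM; apply: eq_fnm => x; exact: expr2.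
rewrite !sqM //.
have -> : Tr (W *m (B *m B) *m W) = Tr (B *m B *m (W *m W)) by rewrite TrC [RHS]TrC !mulmxA.
have -> : Tr (W *m Q) = \sum_j w j * ze j.
  rewrite TrC Tr_mul_dg; apply: eq_bigr => j _.
  rewrite eigU_mul // -mulmxA; case: uQ => _ ->.
  by rewrite mulmx1 rdiagE eqxx.
rewrite -[A *m A *m W *m W]mulmxA /W dgM // Tr_dg //.
have e : 2^-1 * Tr (A *m A *m dg (eigU Q) (fun i => w i * w i)) +
  2^-1 * Tr (B *m B *m dg (eigU Q) (fun i => w i * w i)) = \sum_j w j * w j * c j.
  by rewrite -mulrDr -TrD -mulmxDl -TrZ scalemxAl Tr_mul_dg.
set X := 2^-1 * _ in e *; set Y := 2^-1 * _ in e *.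
have -> : 2 * (\sum_j w j * ze j) - s * (\sum_i w i * w i) - X - Y =
   2 * (\sum_j w j * ze j) - s * (\sum_i w i * w i) - \sum_j w j * w j * c j.
  by rewrite -e; ring.
rewrite !mulr_sumr -!sumrB; apply: ler_sum => j _.
have sc : 0 < s + c j by rewrite ltr_wpDr.
rewrite /w le_eqVlt; apply/orP; left; apply/eqP; field.
by rewrite gt_eqF.
Qed.

(** [kreg'_increment] is summed over pairs of eigenvalues, where [rotQ] turns (a_k - b_l)^2 |T_kl|^2
    into 4 |Q_kl|^2. The logarithm of l + (a_k^2 + b_l^2) / 2 passes to the eigenbasis of Q by the
    resolvent comparison, and Gibbs' principle turns it into the entropy of Q. *)
Lemma dissipation_le l : 0 < l ->
  Tr ((fnm (kreg' l) A - fnm (kreg' l) B) *m (A - B)) <=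
  4 * (6 * z + 2 * Ent Q + 2 * z * ln (l * d%:R + (sq A + sq B) / 2)).
Proof.
move=> l0.
have trA g : Tr (fnm g A) = \sum_k \sum_l nsq (T k l) * g (a k).
  rewrite -[fnm g A]mulmx1 -[1%:M]scale1r -(fnm_const 1 B) Tr_fnm2.
  by apply: eq_bigr => k _; apply: eq_bigr => j _; rewrite mulr1.
have trB g : Tr (fnm g B) = \sum_k \sum_l nsq (T k l) * g (b l).
  rewrite -[fnm g B]mul1mx -[1%:M]scale1r -(fnm_const 1 A) Tr_fnm2.
  by apply: eq_bigr => k _; apply: eq_bigr => j _; rewrite mul1r.
have -> : Tr ((fnm (kreg' l) A - fnm (kreg' l) B) *m (A - B)) =
    \sum_k \sum_j nsq (T k j) * ((kreg' l (a k) - kreg' l (b j)) * (a k - b j)).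
  have expand M N V W : Tr ((M - N) *m (V - W)) =
      Tr (M *m V) - Tr (M *m W) - (Tr (N *m V) - Tr (N *m W)).
    by rewrite mulmxBl !mulmxBr !TrB.
  rewrite expand [Tr (fnm _ B *m A)]TrC.
  have trAA : Tr (fnm (kreg' l) A *m A) =
      \sum_k \sum_j nsq (T k j) * (kreg' l (a k) * a k).
    by rewrite -(trA (fun x => kreg' l x * x)) -fnmM (fnm_id hA).
  have trBB : Tr (fnm (kreg' l) B *m B) =
      \sum_k \sum_j nsq (T k j) * (kreg' l (b j) * b j).
    by rewrite -(trB (fun x => kreg' l x * x)) -fnmM (fnm_id hB).
  have trAB g h : Tr (fnm g A *m fnm h B) = \sum_k \sum_j nsq (T k j) * (g (a k) * h (b j)).
    exact: Tr_fnm2.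
  rewrite trAA trBB -[X in Tr (fnm _ A *m X)](fnm_id hB) trAB.
  rewrite -[X in Tr (X *m fnm _ B)](fnm_id hA) trAB -!sumrB.
  apply: eq_bigr => k _; rewrite -!sumrB; apply: eq_bigr => j _.
  by move: (nsq _) (a k) (b j) => t x y; ring.
have z_total : \sum_j ze j ^+ 2 = z by rewrite /z (sqE herm_Q).
have lnQ : \sum_(kl : 'I_d * 'I_d) nsq (rot Q kl.1 kl.2) *
    ln (l + (a kl.1 ^+ 2 + b kl.2 ^+ 2) / 2) <= \sum_j ze j ^+ 2 * ln (l + c j).
  apply: sum_ln_le_of_resolvent => //.
  - by move=> i; exact: nsq_ge0.
  - by move=> i; rewrite divr_ge0 // addr_ge0 // sqr_ge0.
  - by move=> j; rewrite sqr_ge0.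
  - by rewrite z_total -rot_Q_total pair_bigA.
rewrite -(pair_bigA _ (fun k j => nsq (rot Q k j) *
  ln (l + (a k ^+ 2 + b j ^+ 2) / 2))) /= in lnQ.
have lc j : 0 < l + c j by rewrite ltr_wpDr.
have := gibbs (fun j => sqr_ge0 (ze j)) lc.
rewrite z_total big_split /= c_total sumr_const card_ord -[l *+ d]mulr_natr.
have -> : \sum_i ze i ^+ 2 * ln (ze i ^+ 2) = Ent Q + z * ln z.
  by rewrite /Ent Tr_fnm -/z subrK.
move=> gib.
have bound : \sum_k \sum_j nsq (T k j) * ((kreg' l (a k) - kreg' l (b j)) * (a k - b j)) <=
   24 * \sum_k \sum_j nsq (rot Q k j) +
   8 * \sum_k \sum_j nsq (rot Q k j) * ln (l + (a k ^+ 2 + b j ^+ 2) / 2).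
  rewrite !mulr_sumr -big_split /=; apply: ler_sum => k _.
  rewrite !mulr_sumr -big_split /=; apply: ler_sum => j _.
  apply: le_trans (ler_wpM2l (nsq_ge0 _) (kreg'_increment _ _ l0)) _.
  by rewrite rotQ le_eqVlt; apply/orP; left; apply/eqP; field.
apply: le_trans bound _; rewrite rot_Q_total; lra.
Qed.

End Pair.

End Convexity.

(** * Klein's inequality and the entropy of an even plus an odd matrix *)

Section TwoPoint.
Variables (R : realType) (d : nat).
Local Notation C := R[i].
Implicit Types (A B Y Z G : 'M[C]_d) (f g : R -> R).

Lemma fnmN f A : fnm (fun x => - f x) A = - fnm f A.
Proof.
rewrite /fnm /dg -mulNmx -mulmxN; congr (_ *m _ *m _).
by apply/matrixP => i j; rewrite !mxE rmorphN mulNrn.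
Qed.

Lemma scale_fnm (r : R) A : adj A = A -> r%:C *: A = fnm (fun x => r * x) A.
Proof.
move=> hA; have := fnmM (fun=> r) id A.
by rewrite fnm_const fnm_id // -scalemxAl mul1mx.
Qed.

Lemma opp_fnm A : adj A = A -> - A = fnm -%R A.
Proof. by move=> hA; rewrite (fnmN id) fnm_id. Qed.

(** Klein's inequality with a quadratic remainder: all the traces are sums over pairs of eigenvalues
    with the same weights |<a_k, b_l>|^2. [G'] may be any slope function. *)
Lemma klein (F G G' : R -> R) (K : R) A B : adj A = A -> adj B = B ->
  (forall k l, G (eig B l) + G' (eig B l) * (eig A k - eig B l) +
     K * (eig A k - eig B l) ^+ 2 <= F (eig A k)) ->
  Tr (fnm G B) + Tr (fnm G' B *m (A - B)) + K * sq (A - B) <= Tr (fnm F A).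
Proof.
move=> hA hB h.
pose T := eigU A *m adj (eigU B).
have trA g : Tr (fnm g A) = \sum_k \sum_l nsq (T k l) * g (eig A k).
  rewrite -[fnm g A]mulmx1 -[1%:M]scale1r -(fnm_const 1 B) Tr_fnm2.
  by apply: eq_bigr => k _; apply: eq_bigr => j _; rewrite mulr1.
have trB g : Tr (fnm g B) = \sum_k \sum_l nsq (T k l) * g (eig B l).
  rewrite -[fnm g B]mul1mx -[1%:M]scale1r -(fnm_const 1 A) Tr_fnm2.
  by apply: eq_bigr => k _; apply: eq_bigr => j _; rewrite mul1r.
have e1 : Tr (fnm G' B *m (A - B)) =
   \sum_k \sum_l nsq (T k l) * (G' (eig B l) * (eig A k - eig B l)).
  rewrite mulmxBr TrB -{1}(fnm_id hA) -{3}(fnm_id hB) fnmM TrC trB Tr_fnm2 -sumrB.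
  by apply: eq_bigr => k _; rewrite -sumrB; apply: eq_bigr => l _; rewrite /T /=; ring.
have e2 : sq (A - B) = \sum_k \sum_l nsq (T k l) * (eig A k - eig B l) ^+ 2.
  have -> : sq (A - B) = Tr (fnm (fun x => x * x) A) - 2 * Tr (fnm id A *m fnm id B)
      + Tr (fnm (fun x => x * x) B).
    rewrite -!(fnmM id id) !fnm_id // /sq mulmxBl !mulmxBr !TrB [Tr (B *m A)]TrC; ring.
  rewrite trA trB Tr_fnm2 mulr_sumr -sumrB -big_split; apply: eq_bigr => k _ /=.
  rewrite mulr_sumr -sumrB -big_split; apply: eq_bigr => l _ /=.
  by rewrite /T; ring.
rewrite e1 e2 trA trB mulr_sumr -!big_split; apply: ler_sum => k _ /=.
rewrite mulr_sumr -!big_split; apply: ler_sum => l _ /=.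
have := ler_wpM2l (nsq_ge0 (T k l)) (h k l); rewrite !mulrDr.
rewrite [nsq _ * (K * _)]mulrCA; exact.
Qed.

Lemma klein_le (F G G' : R -> R) (K : R) A B : adj A = A -> adj B = B ->
  (forall k l, F (eig A k) <= G (eig B l) + G' (eig B l) * (eig A k - eig B l) +
     K * (eig A k - eig B l) ^+ 2) ->
  Tr (fnm F A) <= Tr (fnm G B) + Tr (fnm G' B *m (A - B)) + K * sq (A - B).
Proof.
move=> hA hB h.
have := @klein (fun x => - F x) (fun x => - G x) (fun x => - G' x) (- K) A B hA hB.
rewrite !fnmN mulNmx !TrN => h'; rewrite -lerN2 !opprD -mulNr; apply: h' => k l.
by have := h k l; lra.
Qed.

Lemma Tr_mulBl A B G : Tr ((A - B) *m G) = Tr (A *m G) - Tr (B *m G).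
Proof. by rewrite mulmxBl TrB. Qed.

Lemma Tr_mulZr (r : R) A B : Tr (A *m (r%:C *: B)) = r * Tr (A *m B).
Proof. by rewrite -scalemxAr TrZ. Qed.

Lemma sq_scale (r : R) A : sq (r%:C *: A) = r ^+ 2 * sq A.
Proof. by rewrite /sq -scalemxAl -scalemxAr !TrZ mulrA. Qed.

Lemma Ent_scale (r : R) A : 0 < r -> adj A = A -> Ent (r%:C *: A) = r ^+ 2 * Ent A.
Proof.
move=> r0 hA; rewrite /Ent.
have -> : sq (r%:C *: A) = r ^+ 2 * sq A.
  by rewrite /sq -scalemxAl -scalemxAr !TrZ mulrA.
have xl (x : R) : 0 <= x -> r ^+ 2 * x * ln (r ^+ 2 * x) =
    r ^+ 2 * (x * ln x) + r ^+ 2 * ln (r ^+ 2) * x.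
  rewrite le_eqVlt => /orP[/eqP <-|x0]; first by rewrite !(mulr0, mul0r) addr0.
  by rewrite lnM ?posrE ?exprn_gt0 //; ring.
rewrite (scale_fnm r hA) fnm_comp !Tr_fnm xl ?sq_ge0 //.
have -> : \sum_k xlnx2 (r * eig A k) = r ^+ 2 * (\sum_k xlnx2 (eig A k)) +
   r ^+ 2 * ln (r ^+ 2) * sq A.
  rewrite (sqE hA) !mulr_sumr -big_split; apply: eq_bigr => k _ /=.
  by rewrite /xlnx2 exprMn xl ?sqr_ge0.
ring.
Qed.

Lemma eig_sqr_le A k : adj A = A -> eig A k ^+ 2 <= sq A.
Proof.
move=> hA; rewrite sqE // (bigD1 k) //= lerDl.
by apply: sumr_ge0 => i _; rewrite sqr_ge0.
Qed.

(** One increment of [phi_le_bound], with logarithms made opaque: [Ts] and [Tt] are y + r^2 z + l d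
    at r = s and r = t, with logarithms [lTs] and [lTt]; [lld] is ln (l d), [fs] and [ft] are the
    regularised traces, [ps] is their derivative at s, and [e] is Ent Z. *)
Lemma entropy_step (ft fs ps f0 e lld lTs lTt K Ts Tt z s t M : R) :
  Ts * lTs + (lTs + 1) * ((t ^+ 2 - s ^+ 2) * z) <= Tt * lTt ->
  ft <= fs + (t - s) * ps + K * ((t - s) ^+ 2 * z) ->
  (t - s) * ps <= (t - s) * (s * (6 * z + 2 * e + 2 * z * lTs)) ->
  (t - s) ^+ 2 * z * lld <= (t - s) ^+ 2 * z * lTs ->
  f0 + s ^+ 2 * (2 * z + e) + Ts * lTs - M - fs -
    (K * z - 3 * z - e - z * lld) * (t - s) ^+ 2 <=
  f0 + t ^+ 2 * (2 * z + e) + Tt * lTt - M - ft.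
Proof. by move=> h1 h2 h3 h4; lra. Qed.

(** Removal of the regularisation: with l = s^2 every term in which l appears costs O(s), so that
    [le_of_le_addM] can let s tend to 0. *)
Lemma entropy_limit (TX TY P1 P0 y z e s D : R) : let l := s ^+ 2 in
  0 <= y -> 0 <= z -> 1 <= D -> 0 < s -> s <= 1 ->
  P1 <= P0 + (2 * z + e) + (y + z + l * D) * ln (y + z + l * D)
     - (y + l * D) * ln (y + l * D) ->
  TX + D * (l * ln l) <= P1 -> P0 <= TY + l * (y + D * l) ->
  TX - (y + z) * ln (y + z) <=
  TY - y * ln y + e + 2 * z + (5 * D + y + D * (y + z + D)) * s.
Proof.
move=> l y0 z0 D1 s0 s1 h h1 h2.
have l0 : 0 < l by rewrite exprn_gt0.
have ls : l <= s by rewrite /l expr2 ler_piMl // ltW.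
have lln := xlnx_sqr_ge s0; rewrite -/l in lln.
have D0 : 0 < D by lra.
have ld0 : 0 < l * D by rewrite mulr_gt0.
have h3 := @xlnx_add_le _ (y + z) _ (addr_ge0 y0 z0) ld0.
have h4 := @xlnx_add_ge _ y _ y0 ld0.
rewrite [ln (l * _)]lnM ?posrE // in h4.
have h5 : 0 <= l * D * ln D.
  by rewrite mulr_ge0 ?ln_ge0 // mulr_ge0 //; lra.
have h6 : - (2 * s) * D <= l * ln l * D by rewrite ler_wpM2r // ltW.
have h7 : l * (y + D * l) <= s * (y + D).
  apply: ler_pM => //; first lra; first by rewrite addr_ge0 // mulr_ge0 //; lra.
  by rewrite lerD2l ler_piMr //; lra.
have h8 : l * D * (y + z + l * D) <= s * D * (y + z + D).
  apply: ler_pM; first lra; first by rewrite addr_ge0 //; lra.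
    by rewrite ler_wpM2r // ltW.
  by rewrite lerD2l ler_piMl //; lra.
lra.
Qed.

Definition parity Y Z G : Prop :=
  [/\ adj Y = Y, adj Z = Z, unitary G, G *m Y *m adj G = Y & G *m Z *m adj G = - Z].

Lemma parity_hY Y Z G : parity Y Z G -> adj Y = Y. Proof. by case. Qed.
Lemma parity_hZ Y Z G : parity Y Z G -> adj Z = Z. Proof. by case. Qed.
Lemma parity_unitary Y Z G : parity Y Z G -> unitary G. Proof. by case. Qed.
Lemma parity_even Y Z G : parity Y Z G -> G *m Y *m adj G = Y. Proof. by case. Qed.
Lemma parity_odd Y Z G : parity Y Z G -> G *m Z *m adj G = - Z. Proof. by case. Qed.

(** The path along which the entropy is followed; the parity unitary maps r to - r. *)
Definition pencil Y Z (r : R) : 'M[C]_d := Y + r%:C *: Z.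

Section EvenOdd.
Variables Y Z G : 'M[C]_d.
Hypotheses (d0 : (0 < d)%N) (YZG : parity Y Z G).

Local Notation hY := (parity_hY YZG).
Local Notation hZ := (parity_hZ YZG).
Local Notation uG := (parity_unitary YZG).
Local Notation GY := (parity_even YZG).
Local Notation GZ := (parity_odd YZG).

Local Notation X := (pencil Y Z).
Let y := sq Y.
Let z := sq Z.

Let hX r : adj (X r) = X r.
Proof. by rewrite /pencil adjD adjZ hY hZ. Qed.

Let GX r : G *m X r *m adj G = X (- r).
Proof.
by rewrite /pencil mulmxDr mulmxDl GY -scalemxAr -scalemxAl GZ rmorphN scalerN scaleNr.
Qed.

Lemma Tr_even_odd : Tr (Y *m Z) = 0.
Proof.
have := Tr_conj (Y *m Z) uG.
have -> : G *m (Y *m Z) *m adj G = (G *m Y *m adj G) *m (G *m Z *m adj G).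
  by have [h _] := uG; rewrite !mulmxA -[_ *m adj G *m G]mulmxA h mulmx1.
rewrite GY GZ mulmxN TrN; lra.
Qed.

Let sqX r : sq (X r) = y + r ^+ 2 * z.
Proof.
rewrite /pencil /sq mulmxDl !mulmxDr -!scalemxAl -!scalemxAr !TrD !TrZ.
by rewrite -/(sq Y) -/(sq Z) [Tr (Z *m Y)]TrC Tr_even_odd /y /z; ring.
Qed.

Let diffX s t : X t - X s = (t - s)%:C *: Z.
Proof. by rewrite /pencil opprD addrACA subrr add0r -scalerBl rmorphB. Qed.

Let X1 : X 1 = Y + Z. Proof. by rewrite /pencil scale1r. Qed.
Let X0 : X 0 = Y. Proof. by rewrite /pencil scale0r addr0. Qed.

Opaque pencil fnm Tr.

Local Notation phi' l r := (Tr (fnm (kreg' l) (X r) *m Z)).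

(** Conjugation by G shows that this derivative is odd in r, so it is half the difference of its
    values at r and - r. That difference is governed by [dissipation_le] for A = X r and B = X (-
    r), where Q = r Z. *)
Let phi'_le l r : 0 < l -> 0 <= r ->
  phi' l r <= r * (6 * z + 2 * Ent Z + 2 * z * ln (l * d%:R + (y + r ^+ 2 * z))).
Proof.
move=> l0.
have odd : Tr (fnm (kreg' l) (X (- r)) *m Z) = - phi' l r.
  have eZ : Z = - (G *m Z *m adj G) by rewrite GZ opprK.
  rewrite -GX (fnm_conj _ (hX r) uG) [X in _ *m X]eZ mulmxN TrN; congr (- _).
  rewrite -[in RHS](Tr_conj (_ *m Z) uG); have [h _] := uG; congr Tr.
  by rewrite !mulmxA -[_ *m adj G *m G]mulmxA h mulmx1.
rewrite le_eqVlt => /orP[/eqP r0|r0].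
  move: odd; rewrite -r0 oppr0 mul0r .
  by move: (phi' l 0) => u; lra.
have hQ : X r - X (- r) = 2%:C *: (r%:C *: Z).
  by rewrite diffX scalerA -(rmorphM (real_complex R)); congr (_%:C *: _); ring.
have := dissipation_le (hX r) (hX (- r)) hQ l0.
rewrite (Ent_scale r0 hZ) (sqX r) (sqX (- r)) sqrrN hQ.
rewrite scalerA -(rmorphM (real_complex R)).
rewrite Tr_mulZr.
rewrite Tr_mulBl.
rewrite sq_scale.
rewrite -/z.
rewrite [T in _ * (_ - T)]odd => {odd}; move: (phi' l r) => u.
have -> : (y + r ^+ 2 * z + (y + r ^+ 2 * z)) / 2 = y + r ^+ 2 * z by field.
set L := ln _ => h.
have e : 2 * r * (u - - u) = (4 * r) * u by ring.
rewrite e in h.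
have r4 : 0 < 4 * r by lra.
rewrite -(ler_pM2l r4); apply: le_trans h _.
rewrite le_eqVlt; apply/orP; left; apply/eqP; ring.
Qed.

Local Notation phi l r := (Tr (fnm (kreg l) (X r))).
(** An antiderivative of the bound in [phi'_le]. With T = y + r^2 z + l d, the derivative of T ln T
    is 2 r z (ln T + 1); of the term 6 r z there remains 4 r z, whose integral 2 r^2 z is the origin
    of the constant 2 in [Ent_even_odd_le]. *)
Let bound l r := phi l 0 + r ^+ 2 * (2 * z + Ent Z) +
   (y + r ^+ 2 * z + l * d%:R) * ln (y + r ^+ 2 * z + l * d%:R)
   - (y + l * d%:R) * ln (y + l * d%:R).

Let phi_le_bound l : 0 < l -> l <= 1 -> phi l 1 <= bound l 1.
Proof.
move=> l0 l1; rewrite -subr_ge0.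
have -> : 0 = bound l 0 - phi l 0 by rewrite /bound expr0n !mul0r !addr0; ring.
have y0 : 0 <= y by exact: sq_ge0 hY.
have z0 : 0 <= z by exact: sq_ge0 hZ.
pose b := y + z.
pose K := b + 1 + 4 * b / l.
have ld0 : 0 < l * d%:R by rewrite mulr_gt0 // ltr0n.
apply: (@tele_le _ (fun r => bound l r - phi l r) 0 1
   (K * z - 3 * z - Ent Z - z * ln (l * d%:R))) => // s t s0 st t1.
have t0 : 0 <= t by lra.
pose Ts := y + s ^+ 2 * z + l * d%:R.
pose Tt := y + t ^+ 2 * z + l * d%:R.
have Ts0 : 0 < Ts by rewrite /Ts ltr_wpDl // addr_ge0 // mulr_ge0 // sqr_ge0.
have Tt0 : 0 < Tt by rewrite /Tt ltr_wpDl // addr_ge0 // mulr_ge0 // sqr_ge0.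
have h1 := xlnx_tangent (ltW Tt0) Ts0.
have eT : Tt - Ts = (t ^+ 2 - s ^+ 2) * z by rewrite /Tt /Ts; ring.
rewrite eT in h1.
have h2 : phi l t <= phi l s + (t - s) * phi' l s + K * ((t - s) ^+ 2 * z).
  have sb r : 0 <= r -> r <= 1 -> sq (X r) <= b.
    by move=> r0 r1; rewrite sqX /b lerD2l ler_piMl // expr_le1.
  have hst := diffX t s.
  have := @klein_le (kreg l) (kreg l) (kreg' l) K (X t) (X s) (hX t) (hX s).
  rewrite (diffX s t) Tr_mulZr sq_scale -/z.
  apply=> k j.
  have := @kreg_semiconcave R l b (eig (X t) k) (eig (X s) j) l0 l1.
  rewrite !(le_trans (eig_sqr_le _ (hX _))) ?sb //; last lra.
  by move=> /(_ isT isT); rewrite -/K; lra.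
have h3 := phi'_le l0 s0; rewrite [l * _ + _]addrC -/Ts in h3.
have h4 : (t - s) * phi' l s <=
   (t - s) * (s * (6 * z + 2 * Ent Z + 2 * z * ln Ts)).
  by rewrite ler_wpM2l // subr_ge0.
have h5 : (t - s) ^+ 2 * z * ln (l * d%:R) <= (t - s) ^+ 2 * z * ln Ts.
  apply: ler_wpM2l; first by rewrite mulr_ge0 ?sqr_ge0.
  apply: le_ln => //; rewrite /Ts lerDr addr_ge0 //.
  by rewrite mulr_ge0 // sqr_ge0.
rewrite /bound -/Ts -/Tt.
exact: entropy_step h1 h2 h4 h5.
Qed.

(* Entropic form, at p = 2, of the optimal 2-uniform convexity of the trace
   norms (Ball, Carlen and Lieb). *)
Lemma Ent_even_odd_le : Ent (Y + Z) <= Ent Y + Ent Z + 2 * sq Z.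
Proof.
have y0 : 0 <= y by exact: sq_ge0 hY.
have z0 : 0 <= z by exact: sq_ge0 hZ.
have dR : 1 <= d%:R :> R by rewrite ler1n.
have YZ1 : sq (Y + Z) = y + z by rewrite -X1 sqX expr1n mul1r.
apply: (@le_of_le_addM _ _ _ (5 * d%:R + y + d%:R * (y + z + d%:R))) => s s0 s1.
pose l := s ^+ 2.
have l0 : 0 < l by rewrite exprn_gt0.
have l1 : l <= 1 by rewrite expr_le1 // ltW.
have := phi_le_bound l0 l1.
rewrite /bound X1 X0 !expr1n !mul1r => h.
have h1 : Tr (fnm (@xlnx2 R) (Y + Z)) + d%:R * (l * ln l) <= Tr (fnm (kreg l) (Y + Z)).
  rewrite !Tr_fnm; have -> : d%:R * (l * ln l) = \sum_(k < d) (l * ln l).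
    by rewrite sumr_const card_ord mulr_natl.
  rewrite -big_split /=; apply: ler_sum => k _.
  by apply: xlnx_add_ge => //; rewrite sqr_ge0.
have h2 : Tr (fnm (kreg l) Y) <= Tr (fnm (@xlnx2 R) Y) + l * (y + d%:R * l).
  rewrite !Tr_fnm; have -> : l * (y + d%:R * l) = \sum_(k < d) l * (eig Y k ^+ 2 + l).
    by rewrite -mulr_sumr big_split /= -(sqE hY) sumr_const card_ord mulr_natl.
  rewrite -big_split /=; apply: ler_sum => k _; apply: kreg_le; exact: ltW.
rewrite [leLHS]/Ent YZ1.
exact: (entropy_limit y0 z0 dR s0 s1 h h1 h2).
Qed.

End EvenOdd.
End TwoPoint.

(** * The logarithmic Sobolev inequality *)

Section Commute.
Variables (R : realType) (d : nat).
Local Notation C := R[i].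
Implicit Types (A B P S Y Z G W D : 'M[C]_d) (f g : R -> R).

Definition cm A B := A *m B = B *m A.

Lemma cm_sym A B : cm A B -> cm B A. Proof. by move=> h; rewrite /cm h. Qed.

Lemma cm1 A : cm A 1%:M. Proof. by rewrite /cm mulmx1 mul1mx. Qed.
Lemma cmD A B G : cm A B -> cm A G -> cm A (B + G).
Proof. by move=> h1 h2; rewrite /cm mulmxDl mulmxDr h1 h2. Qed.
Lemma cmN A B : cm A B -> cm A (- B).
Proof. by move=> h1; rewrite /cm mulNmx mulmxN h1. Qed.
Lemma cmB A B G : cm A B -> cm A G -> cm A (B - G).
Proof. by move=> h1 h2; apply: cmD => //; exact: cmN. Qed.
Lemma cmZ (c : C) A B : cm A B -> cm A (c *: B).
Proof. by move=> h1; rewrite /cm -scalemxAl -scalemxAr h1. Qed.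
Lemma cmM A B G : cm A B -> cm A G -> cm A (B *m G).
Proof. by move=> h1 h2; rewrite /cm mulmxA h1 -mulmxA h2 mulmxA. Qed.
Lemma cm_fnm f A B : adj B = B -> cm A B -> cm A (fnm f B).
Proof. by move=> hB h; apply: fnm_intertwine. Qed.

(* A qubit inside C^d is encoded by its pair of Pauli operators (X, Z). *)
Definition site (s : 'M[C]_d * 'M[C]_d) :=
  [/\ adj s.1 = s.1, adj s.2 = s.2, s.1 *m s.1 = 1%:M, s.2 *m s.2 = 1%:M
    & s.1 *m s.2 = - (s.2 *m s.1)].

Definition scm (s t : 'M[C]_d * 'M[C]_d) :=
  [/\ cm s.1 t.1, cm s.1 t.2, cm s.2 t.1 & cm s.2 t.2].

Definition cms (s : 'M[C]_d * 'M[C]_d) A := cm s.1 A /\ cm s.2 A.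

Definition ov S A := Tr (A *m (S *m A *m adj S)).
(* [dir s A] is Tr [A (A - E_s A)], E_s A being the average of the conjugates of A
   by the Pauli operators of s. *)
Definition dir (s : 'M[C]_d * 'M[C]_d) A : R :=
  (3 * sq A - ov s.1 A - ov s.2 A - ov (s.1 *m s.2) A) / 4.

Definition am G Z := G *m Z = - (Z *m G).

Lemma am_cmM G Y Z : cm G Y -> am G Z -> am G (Y *m Z).
Proof. by move=> h1 h2; rewrite /am mulmxA h1 -mulmxA h2 mulmxN mulmxA. Qed.
Lemma amM_cm G Y Z : am G Z -> cm G Y -> am G (Z *m Y).
Proof. by move=> h1 h2; rewrite /am mulmxA h1 mulNmx -[_ *m G *m Y]mulmxA h2 mulmxA. Qed.
Lemma amM_am G Y Z : am G Y -> am G Z -> cm G (Y *m Z).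
Proof. by move=> h1 h2; rewrite /cm mulmxA h1 mulNmx -[_ *m G *m Z]mulmxA h2 mulmxN opprK mulmxA. Qed.
Lemma am_sym G Z : am G Z -> am Z G.
Proof. by move=> h; rewrite /am h opprK. Qed.

Lemma self_opp_eq0 (t : R) : t = - t -> t = 0. Proof. lra. Qed.

Lemma Tr_parity Y Z G : G *m G = 1%:M -> cm G Y -> am G Z -> Tr (Y *m Z) = 0.
Proof.
move=> GG cY aZ; apply: self_opp_eq0.
have e : G *m (Y *m Z) = - (Y *m Z *m G) by apply: am_cmM.
rewrite -{1}[Y *m Z]mulmx1 -GG mulmxA TrC mulmxA e mulNmx TrN.
by rewrite -[_ *m G *m G]mulmxA GG mulmx1.
Qed.

Lemma Tr_parity' Y Z G : G *m G = 1%:M -> cm G Y -> am G Z -> Tr (Z *m Y) = 0.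
Proof. by rewrite TrC; exact: Tr_parity. Qed.

Lemma Tr_mulDD A B Y Z : Tr ((A + B) *m (Y + Z)) =
  Tr (A *m Y) + Tr (A *m Z) + Tr (B *m Y) + Tr (B *m Z).
Proof. by rewrite mulmxDl !mulmxDr !TrD !addrA. Qed.

Lemma sqD Y Z G : G *m G = 1%:M -> cm G Y -> am G Z -> sq (Y + Z) = sq Y + sq Z.
Proof.
move=> GG cY aZ; rewrite /sq Tr_mulDD (Tr_parity GG cY aZ) (Tr_parity' GG cY aZ).
by rewrite !addr0.
Qed.

Lemma ovD S Y Z G : G *m G = 1%:M -> cm G S -> cm G (adj S) ->
  cm G Y -> am G Z -> ov S (Y + Z) = ov S Y + ov S Z.
Proof.
move=> GG cS cS' cY aZ; rewrite /ov mulmxDr mulmxDl Tr_mulDD.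
rewrite (Tr_parity GG cY (amM_cm (am_cmM cS aZ) cS')).
by rewrite (Tr_parity' GG (cmM (cmM cS cY) cS') aZ) !addr0.
Qed.

Lemma dirD s Y Z G : site s -> G *m G = 1%:M -> cms s G ->
  cm G Y -> am G Z -> dir s (Y + Z) = dir s Y + dir s Z.
Proof.
case=> h1 h2 _ _ _ GG [/cm_sym c1 /cm_sym c2] cY aZ.
have c12 : cm G (s.1 *m s.2) by exact: cmM.
have c21 : cm G (adj (s.1 *m s.2)) by rewrite adjM h1 h2; exact: cmM.
have c1' : cm G (adj s.1) by rewrite h1.
have c2' : cm G (adj s.2) by rewrite h2.
rewrite /dir (sqD GG cY aZ) (ovD GG c1 c1' cY aZ) (ovD GG c2 c2' cY aZ).
rewrite (ovD GG c12 c21 cY aZ).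
move: (ov _ Y) (ov _ Y) (ov _ Y) (ov _ Z) (ov _ Z) (ov _ Z) (sq Y) (sq Z).
by clear; move=> *; field.
Qed.

Lemma ov_mul S G Y : G *m G = 1%:M -> cm G S -> cm G Y ->
  ov S (G *m Y) = ov S Y.
Proof.
move=> GG cS cY; rewrite /ov; congr Tr.
rewrite [S *m (G *m Y)]mulmxA -cS -![G *m S *m Y *m _]mulmxA cY.
by rewrite -[Y *m G *m _]mulmxA !mulmxA -[Y *m G *m G]mulmxA GG mulmx1.
Qed.

Lemma sq_mul G Y : G *m G = 1%:M -> cm G Y -> sq (G *m Y) = sq Y.
Proof.
move=> GG cY; rewrite /sq {1}cY; congr Tr.
by rewrite mulmxA -[Y *m G *m G]mulmxA GG mulmx1.
Qed.

Lemma dir_mul s G Y : site s -> G *m G = 1%:M -> cms s G -> cm G Y ->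
  dir s (G *m Y) = dir s Y.
Proof.
case=> h1 h2 _ _ _ GG [/cm_sym c1 /cm_sym c2] cY.
by rewrite /dir (sq_mul GG cY) (ov_mul GG c1 cY) (ov_mul GG c2 cY) (ov_mul GG (cmM c1 c2) cY).
Qed.

(** Complete depolarization of s fixes [Y0] and annihilates [Y3] and [Z], so only the last two
    contribute. The traces [Tr (Z *m V)] arising from x and from x z cancel. *)
Lemma dir_own s Y0 Y3 Z : site s -> cms s Y0 -> cm s.2 Y3 -> am s.1 Y3 -> am s.2 Z ->
  dir s (Y0 + Y3 + Z) = sq Z + sq Y3.
Proof.
case: s => x z [/= hx hz xx zz xz] [cx0 cz0] cz3 ax3 az.
have azx : am z x by apply: am_sym.
have cY : cm z (Y0 + Y3) by exact: cmD.
have xY : x *m (Y0 + Y3) *m x = Y0 - Y3.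
  by rewrite mulmxDr cx0 ax3 mulmxDl mulNmx -!mulmxA xx !mulmx1.
pose V := x *m Z *m x.
have aV : am z V.
  rewrite /am /V !mulmxA azx mulNmx -[x *m z *m Z]mulmxA az mulmxN opprK.
  by rewrite mulmxA -[_ *m z *m x]mulmxA azx mulmxN mulmxA.
have zA : z *m (Y0 + Y3 + Z) *m z = Y0 + Y3 - Z.
  by rewrite mulmxDr cY az mulmxDl mulNmx -!mulmxA zz !mulmx1.
have cYm : cm z (Y0 - Y3) by exact: cmB.
have e1 : ov x (Y0 + Y3 + Z) = sq Y0 - sq Y3 + Tr (Z *m V).
  rewrite /ov hx mulmxDr mulmxDl xY -/V Tr_mulDD.
  rewrite (Tr_parity zz cY aV) (Tr_parity' zz cYm az) !addr0.
  congr (_ + _); rewrite Tr_mulDD !mulmxN !TrN -/(sq Y0) -/(sq Y3).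
  by rewrite (Tr_parity xx cx0 ax3) (Tr_parity' xx cx0 ax3) oppr0 !addr0.
have e2 : ov z (Y0 + Y3 + Z) = sq Y0 + sq Y3 - sq Z.
  rewrite /ov hz zA Tr_mulDD mulmxN TrN (Tr_parity zz cY az) (Tr_parity' zz cY az).
  by rewrite mulmxN TrN -/(sq _) (sqD xx cx0 ax3) oppr0 !addr0.
have e3 : ov (x *m z) (Y0 + Y3 + Z) = sq Y0 - sq Y3 - Tr (Z *m V).
  rewrite /ov adjM hx hz.
  have -> : x *m z *m (Y0 + Y3 + Z) *m (z *m x) = Y0 - Y3 - V.
    rewrite -[x *m z *m _]mulmxA mulmxA -[x *m _ *m z]mulmxA zA.
    by rewrite mulmxBr mulmxBl xY.
  rewrite Tr_mulDD mulmxN TrN.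
  rewrite (Tr_parity zz cY aV) (Tr_parity' zz cYm az) oppr0 !addr0 mulmxN TrN.
  congr (_ - _); rewrite Tr_mulDD !mulmxN !TrN -/(sq Y0) -/(sq Y3).
  by rewrite (Tr_parity xx cx0 ax3) (Tr_parity' xx cx0 ax3) oppr0 !addr0.
rewrite /dir /= e1 e2 e3 (sqD zz cY az) (sqD xx cx0 ax3).
move: (sq Y0) (sq Y3) (sq Z) (Tr _) => a b c t; clear; by field.
Qed.

Definition evn P A : 'M[C]_d := 2^-1%:C *: (A + P *m A *m P).
Definition odd P A : 'M[C]_d := 2^-1%:C *: (A - P *m A *m P).

Lemma evn_odd P A : A = evn P A + odd P A.
Proof.
rewrite /evn /odd -scalerDr addrACA subrr addr0 -[A + A]mulr2n -scaler_nat scalerA.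
rewrite -(rmorph_nat (real_complex R)) -rmorphM mulVf ?pnatr_eq0 //.
by rewrite scale1r.
Qed.

Lemma cm_evn P A : P *m P = 1%:M -> cm P (evn P A).
Proof.
move=> PP; apply: cmZ; rewrite /cm mulmxDr mulmxDl !mulmxA PP mul1mx.
by rewrite -[_ *m P *m P]mulmxA PP mulmx1 addrC.
Qed.

Lemma am_odd P A : P *m P = 1%:M -> am P (odd P A).
Proof.
move=> PP; rewrite /am -scalemxAl -scalemxAr -scalerN mulmxBr mulmxBl !mulmxA PP mul1mx.
by rewrite -[_ *m P *m P]mulmxA PP mulmx1 opprB.
Qed.

Lemma adj_evn P A : adj P = P -> adj A = A -> adj (evn P A) = evn P A.
Proof. by move=> hP hA; rewrite adjZ adjD !adjM hP hA mulmxA. Qed.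

Lemma adj_odd P A : adj P = P -> adj A = A -> adj (odd P A) = odd P A.
Proof. by move=> hP hA; rewrite adjZ adjB !adjM hP hA mulmxA. Qed.

Lemma cm_evn_of Q P A : cm Q P -> cm Q A -> cm Q (evn P A).
Proof. by move=> h1 h2; apply: cmZ; apply: cmD => //; do 2!apply: cmM => //. Qed.

Lemma cm_odd_of Q P A : cm Q P -> cm Q A -> cm Q (odd P A).
Proof. by move=> h1 h2; apply: cmZ; apply: cmB => //; do 2!apply: cmM => //. Qed.

Lemma parity_of Y Z G : adj Y = Y -> adj Z = Z -> adj G = G -> G *m G = 1%:M ->
  cm G Y -> am G Z -> parity Y Z G.
Proof.
move=> hY hZ hG GG cY aZ; split => //; first exact: unitary_invol.
  by rewrite hG cY -mulmxA GG mulmx1.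
by rewrite hG aZ mulNmx -mulmxA GG mulmx1.
Qed.

End Commute.

(** * Induction on the qubits *)

Section LogSobolev.
Variables (R : realType) (d : nat).
Local Notation C := R[i].
Implicit Types (A B P S Y Z G W D x z : 'M[C]_d) (f g : R -> R).

Lemma fnm_odd_even f Z z : adj Z = Z -> am z Z -> (forall t, f (- t) = f t) ->
  cm z (fnm f Z).
Proof.
move=> hZ aZ fe.
have hN : adj (- Z) = - Z by rewrite adjN hZ.
have e : z *m Z = - Z *m z by rewrite aZ mulNmx.
have := fnm_intertwine f hN hZ e.
by rewrite /cm => ->; rewrite (opp_fnm hZ) fnm_comp (eq_fnm _ fe).
Qed.

Lemma half_inj (a b : R) : 2^-1 * a = 2^-1 * b -> b = a. Proof. lra. Qed.

(** The odd part Z anticommutes with the Pauli operator z, which keeps it out of reach of the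
    induction hypothesis. Its absolute value commutes with z, has the same square, hence the same
    entropy, and no larger Dirichlet form. *)
Definition absm Z : 'M[C]_d := fnm Num.norm Z.

Lemma absm_sqr Z : adj Z = Z -> absm Z *m absm Z = Z *m Z.
Proof.
move=> hZ; rewrite -{3 4}(fnm_id hZ) /absm !fnmM; apply: eq_fnm => t.
by rewrite -normrM ger0_norm // -expr2 sqr_ge0.
Qed.

Lemma Ent_eq A B : adj A = A -> adj B = B -> A *m A = B *m B -> Ent A = Ent B.
Proof.
have xl M : adj M = M ->
    Tr (fnm (@xlnx2 R) M) = Tr (fnm (fun t => t * ln t) (M *m M)).
  move=> hM; have -> : M *m M = fnm (fun t => t * t) M by rewrite -(fnmM id id) fnm_id.
  by rewrite fnm_comp !Tr_fnm; apply: eq_bigr => k _; rewrite /xlnx2 expr2.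
by move=> hA hB e; rewrite /Ent /sq !xl // e.
Qed.

Lemma Ent_absm Z : adj Z = Z -> Ent (absm Z) = Ent Z.
Proof.
by move=> hZ; apply: Ent_eq => //; [exact: adj_fnm|exact: absm_sqr].
Qed.

Lemma ov_fnm f S A : ov S (fnm f A) =
  \sum_k \sum_l nsq ((eigU A *m S *m adj (eigU A)) k l) * (f (eig A k) * f (eig A l)).
Proof. by rewrite -Tr_dg_pair /ov !mulmxA. Qed.

(** Overlaps are sums of products of eigenvalues with nonnegative weights, which absolute values can
    only increase. *)
Lemma ov_le_absm S Z : adj Z = Z -> ov S Z <= ov S (absm Z).
Proof.
move=> hZ; rewrite -{1}(fnm_id hZ) /absm !ov_fnm.
apply: ler_sum => k _; apply: ler_sum => l _; apply: ler_wpM2l => /=; first exact: nsq_ge0.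
by rewrite -normrM ler_norm.
Qed.

Lemma dir_absm_le s Z : adj Z = Z -> dir s (absm Z) <= dir s Z.
Proof.
move=> hZ; rewrite /dir /sq (absm_sqr hZ) -/(sq Z).
have := ov_le_absm s.1 hZ; have := ov_le_absm s.2 hZ.
have := ov_le_absm (s.1 *m s.2) hZ.
move: (ov _ Z) (ov _ (absm Z)) => a b; move: (ov _ Z) (ov _ (absm Z)) => a' b'.
move: (ov _ Z) (ov _ (absm Z)) (sq Z) => a'' b'' q h1 h2 h3.
by rewrite ler_pM2r ?invr_gt0 //; lra.
Qed.

Definition hp z : 'M[C]_d := 2^-1%:C *: (1%:M + z).
(** [hp z] projects onto the +1 eigenspace of z. If W is diag(W1, W2) along the eigenspaces of z,
    then [blk x z W] is diag(W1, W1) and [blk x (- z) W] is diag(W2, W2), the copies being carried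
    over by x; both commute with x and z. *)
Definition blk x z W : 'M[C]_d := hp z *m W + x *m (hp z *m W) *m x.

Lemma siteN x z : site (x, z) -> site (x, - z).
Proof.
case=> /= h1 h2 h3 h4 h5; split => //=; first by rewrite adjN h2.
  by rewrite mulNmx mulmxN opprK.
by rewrite mulmxN h5 mulNmx.
Qed.

Lemma half2 (V : lmodType C) (v : V) : 2^-1%:C *: (v + v) = v.
Proof.
rewrite -mulr2n -scaler_nat scalerA -(rmorph_nat (real_complex R)).
by rewrite -(rmorphM (real_complex R)) mulVf ?pnatr_eq0 // scale1r.
Qed.

Lemma hp_split z : hp z + hp (- z) = 1%:M.
Proof. by rewrite /hp -scalerDr addrACA subrr addr0 half2. Qed.

Section Block.
Variables x z W : 'M[C]_d.
Hypotheses (sxz : site (x, z)) (hW : adj W = W) (zW : cm z W).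
Let D := blk x z W.
Let p := hp z.

Let czp : cm z p. Proof. by apply: cmZ; apply: cmD => //; exact: cm1. Qed.
Let cWp : cm W p.
Proof. by apply: cmZ; apply: cmD; [exact: cm1|exact: cm_sym]. Qed.
Let zp : z *m p = p.
Proof.
case: sxz => _ _ _ /= zz _.
by rewrite /p /hp -scalemxAr mulmxDr mulmx1 zz addrC.
Qed.
Let pp : p *m p = p.
Proof. by rewrite {1}/p /hp -scalemxAl mulmxDl mul1mx zp half2. Qed.
Let xp : x *m p = hp (- z) *m x.
Proof.
case: sxz => _ _ _ _ /= xz.
by rewrite /p /hp -scalemxAl -scalemxAr mulmxDl mulmxDr mulmx1 mul1mx xz mulNmx.
Qed.
Let pp' : p *m hp (- z) = 0.
Proof.
rewrite -[hp (- z)](addrK p) [_ + p]addrC hp_split mulmxBr mulmx1 pp subrr.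
by [].
Qed.
Let hp_adj : adj p = p.
Proof. by case: sxz => _ /= hz _ _ _; rewrite /p /hp adjZ adjD adj_mx1 hz. Qed.

Lemma adj_blk : adj D = D.
Proof.
case: sxz => /= hx _ _ _ _.
rewrite /D /blk adjD !adjM hW hx hp_adj -/p cWp.
by rewrite [x *m (_ *m x)]mulmxA.
Qed.

Lemma cm_x_blk : cm x D.
Proof.
case: sxz => /= _ _ xx _ _; rewrite /cm /D /blk mulmxDr mulmxDl.
by rewrite !mulmxA xx mul1mx -[_ *m x *m x]mulmxA xx mulmx1 addrC.
Qed.

Lemma cm_z_blk : cm z D.
Proof.
case: sxz => /= _ _ _ _ xz.
have azx : am z x by exact: am_sym.
apply: cmD; first exact: cmM.
by apply: amM_am => //; apply: amM_cm => //; exact: cmM.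
Qed.

Lemma blk_intertwine : p *m W = D *m p.
Proof.
rewrite /D /blk -/p mulmxDl -[p *m W *m p]mulmxA cWp mulmxA pp.
rewrite -!mulmxA xp.
have -> : p *m (W *m (hp (- z) *m x)) = 0.
  have cWp' : cm W (hp (- z)).
    by apply: cmZ; apply: cmD; [exact: cm1|apply: cmN; exact: cm_sym].
  by rewrite [W *m _]mulmxA cWp' !mulmxA pp' !mul0mx.
by rewrite mulmx0 addr0.
Qed.

Let Tr_half V : cm x V -> Tr (V *m p) = 2^-1 * Tr V.
Proof.
case: sxz => /= _ _ xx _ xz cV.
rewrite /p /hp -scalemxAr TrZ mulmxDr mulmx1 TrD.
by rewrite (Tr_parity xx cV xz) addr0.
Qed.

Lemma Tr_fnm_blk f : Tr (p *m fnm f W) = 2^-1 * Tr (fnm f D).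
Proof.
rewrite (fnm_intertwine f adj_blk hW blk_intertwine).
by apply: Tr_half; apply: cm_fnm cm_x_blk; exact: adj_blk.
Qed.

Lemma ov_blk S : cm x S -> cm z S -> cm x (adj S) -> cm z (adj S) ->
  Tr (p *m (W *m (S *m W *m adj S))) = 2^-1 * ov S D.
Proof.
move=> cxS czS cxS' czS'.
have cpS : p *m S = S *m p.
  by rewrite /p /hp -scalemxAl -scalemxAr mulmxDl mulmxDr mul1mx mulmx1 czS.
have cpS' : p *m adj S = adj S *m p.
  by rewrite /p /hp -scalemxAl -scalemxAr mulmxDl mulmxDr mul1mx mulmx1 czS'.
have -> : p *m (W *m (S *m W *m adj S)) = D *m (S *m D *m adj S) *m p.
  rewrite !mulmxA blk_intertwine -[D *m p *m S]mulmxA cpS.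
  rewrite -!mulmxA [p *m (W *m _)]mulmxA blk_intertwine -!mulmxA cpS'.
  by [].
apply: Tr_half; apply: cmM; first exact: cm_x_blk.
by apply: cmM => //; apply: cmM => //; exact: cm_x_blk.
Qed.

End Block.

Section Blocks.
Variables x z W : 'M[C]_d.
Hypotheses (sxz : site (x, z)) (hW : adj W = W) (zW : cm z W).
Let zW' : cm (- z) W. Proof. exact/cm_sym/cmN/cm_sym. Qed.
Let D1 := blk x z W.
Let D2 := blk x (- z) W.

Let split_Tr V a b : Tr (hp z *m V) = 2^-1 * a -> Tr (hp (- z) *m V) = 2^-1 * b ->
  Tr V = (a + b) / 2.
Proof.
by move=> h1 h2; rewrite -{1}[V]mul1mx -(hp_split z) mulmxDl TrD h1 h2; field.
Qed.

Lemma Tr_fnm_blocks f : Tr (fnm f W) = (Tr (fnm f D1) + Tr (fnm f D2)) / 2.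
Proof. by apply: split_Tr; apply: Tr_fnm_blk => //; exact: siteN. Qed.

Lemma ov_blocks S : cm x S -> cm z S -> cm x (adj S) -> cm z (adj S) ->
  ov S W = (ov S D1 + ov S D2) / 2.
Proof.
move=> h1 h2 h3 h4; apply: split_Tr; apply: ov_blk => //; first exact: siteN.
  exact/cm_sym/cmN/cm_sym.
exact/cm_sym/cmN/cm_sym.
Qed.

Lemma sq_fnm A : adj A = A -> sq A = Tr (fnm (fun t => t * t) A).
Proof. by move=> hA; rewrite -(fnmM id id) !fnm_id. Qed.

(** A vanishing trace gives both blocks of W equal weight. The nonlinear term sq ln sq of the
    entropy is then the same for both, and Ent W is exactly their average. *)
Lemma sq_blk : Tr (z *m (W *m W)) = 0 -> sq D1 = sq W /\ sq D2 = sq W.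
Proof.
have hD1 : adj D1 = D1 by exact: adj_blk.
have hD2 : adj D2 = D2 by apply: adj_blk => //; exact: siteN.
have h1 := Tr_fnm_blk sxz hW zW (fun t => t * t).
have h2 := Tr_fnm_blk (siteN sxz) hW zW' (fun t => t * t).
move=> h0; move: h1 h2; rewrite -!(fnmM id id W) (fnm_id hW) /hp -!scalemxAl !TrZ !mulmxDl.
rewrite mulNmx !TrD TrN h0 mul1mx -/(sq W) oppr0 addr0 => h1 h2.
split; first by rewrite (sq_fnm hD1) (half_inj h1).
by rewrite (sq_fnm hD2) (half_inj h2).
Qed.

End Blocks.

Definition dirs (ss : seq ('M[C]_d * 'M[C]_d)) A : R := \sum_(s <- ss) dir s A.

Fixpoint sites (ss : seq ('M[C]_d * 'M[C]_d)) : Prop :=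
  if ss is s :: ss' then [/\ site s, forall t, t \in ss' -> scm s t & sites ss']
  else True.

Lemma sites_site ss s : sites ss -> s \in ss -> site s.
Proof.
elim: ss => // t ss IH [h1 h2 h3]; rewrite inE => /orP[/eqP ->//|]; exact: IH.
Qed.

Lemma scm_cms1 (s t : 'M[C]_d * 'M[C]_d) : scm s t -> cms t s.1 /\ cms t s.2.
Proof. by case=> h1 h2 h3 h4; split; split; exact: cm_sym. Qed.

Lemma log_sobolev_step (L EA EY EZ E0 E3 e1 e2 y0 y3 zq d0 d3 dZ d1 d2 : R) :
  EA <= EY + EZ + 2 * zq -> EY <= E0 + E3 + 2 * y3 -> EZ = (e1 + e2) / 2 ->
  E0 + y0 * L <= 2 * d0 -> E3 + y3 * L <= 2 * d3 ->
  e1 + zq * L <= 2 * d1 -> e2 + zq * L <= 2 * d2 -> (d1 + d2) / 2 <= dZ ->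
  EA + (y0 + y3 + zq) * L <= 2 * (zq + y3 + (d0 + d3 + dZ)).
Proof. by move=> *; lra. Qed.

Lemma Ent_avg W D1 D2 : sq D1 = sq W -> sq D2 = sq W ->
  Tr (fnm (@xlnx2 R) W) = (Tr (fnm (@xlnx2 R) D1) + Tr (fnm (@xlnx2 R) D2)) / 2 ->
  Ent W = (Ent D1 + Ent D2) / 2.
Proof.
rewrite /Ent => -> -> ->.
by move: (Tr _) (Tr _) (sq W * _) => a b c; clear; field.
Qed.

Lemma cm_blk u x w W : cm u x -> cm u w -> cm u W -> cm u (blk x w W).
Proof.
move=> ux uw uW.
have h : cm u (hp w *m W) := (cmM (cmZ _ (cmD (cm1 u) uw)) uW).
exact: (cmD h (cmM (cmM ux h) ux)).
Qed.

Lemma dir_avg (s : 'M[C]_d * 'M[C]_d) W D1 D2 : sq D1 = sq W -> sq D2 = sq W ->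
  ov s.1 W = (ov s.1 D1 + ov s.1 D2) / 2 -> ov s.2 W = (ov s.2 D1 + ov s.2 D2) / 2 ->
  ov (s.1 *m s.2) W = (ov (s.1 *m s.2) D1 + ov (s.1 *m s.2) D2) / 2 ->
  dir s W = (dir s D1 + dir s D2) / 2.
Proof.
rewrite /dir => -> -> -> -> ->.
move: (ov _ D1) (ov _ D1) (ov _ D1) (ov _ D2) (ov _ D2) (ov _ D2) (sq W).
by clear; move=> *; field.
Qed.

Lemma dir_blocks x z W t : site (x, z) -> adj W = W -> cm z W ->
  Tr (z *m (W *m W)) = 0 -> site t -> scm (x, z) t ->
  dir t W = (dir t (blk x z W) + dir t (blk x (- z) W)) / 2.
Proof.
move=> sxz hW zW aW [t1 t2 _ _ _] [/= x1 x2 z1 z2].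
have [s1 s2] := sq_blk sxz hW zW aW.
have x1' : cm x (adj t.1) by rewrite t1.
have x2' : cm x (adj t.2) by rewrite t2.
have z1' : cm z (adj t.1) by rewrite t1.
have z2' : cm z (adj t.2) by rewrite t2.
have x3' : cm x (adj (t.1 *m t.2)) by rewrite adjM t1 t2; exact: (cmM x2 x1).
have z3' : cm z (adj (t.1 *m t.2)) by rewrite adjM t1 t2; exact: (cmM z2 z1).
exact: (dir_avg (s := t) s1 s2 (ov_blocks sxz zW x1 z1 x1' z1')
  (ov_blocks sxz zW x2 z2 x2' z2')
  (ov_blocks sxz zW (cmM x1 x2) (cmM z1 z2) x3' z3')).
Qed.

(* Gross's logarithmic Sobolev inequality for the qubits ss, on the commutant of
   the already treated qubits; irreducibility enters only when ss is empty. *)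
Lemma log_sobolev ss : (0 < d)%N -> forall (done : seq ('M[C]_d * 'M[C]_d)) A,
  adj A = A -> sites ss -> (forall u t, u \in done -> t \in ss -> scm u t) ->
  (forall u, u \in done -> cms u A) ->
  (forall B, adj B = B -> (forall u, u \in done ++ ss -> cms u B) ->
     exists c : R, B = c%:C *: 1%:M) ->
  Ent A + sq A * ln d%:R <= 2 * dirs ss A.
Proof.
move=> d0; elim: ss => [|[x z] ss IH] done A hA.
  (* With no qubit left A commutes with every site and is a scalar, for which equality holds. *)
  move=> _ _ cA /(_ A hA); rewrite cats0 => /(_ cA) [c ->].
  have cE : c%:C *: 1%:M = fnm (fun=> c) 1%:M :> 'M[C]_d by rewrite fnm_const.
  have hc : adj (c%:C *: 1%:M) = c%:C *: 1%:M :> 'M[C]_d by rewrite cE adj_fnm.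
  rewrite /dirs big_nil mulr0 /Ent (sq_fnm hc) cE !fnm_comp !Tr_fnm !sumr_const card_ord.
  rewrite -[xlnx2 c *+ d]mulr_natl -[c * c *+ d]mulr_natl /xlnx2 -expr2.
  have dR : 0 < d%:R :> R by rewrite ltr0n.
  have [->|c0] := eqVneq c 0; first by rewrite expr0n !(mul0r, mulr0) subr0 addr0.
  have c2 : 0 < c ^+ 2 by rewrite exprn_even_gt0.
  rewrite (@lnM _ d%:R) ?posrE //.
  rewrite le_eqVlt; apply/orP; left; apply/eqP; ring.
move=> [sxz cxz sss] cds cA irr.
have [/= hx hz xx zz xz] := sxz.
have azx : am z x by exact: am_sym.
pose Y := evn z A; pose Z := odd z A.
have hY : adj Y = Y by exact: adj_evn.
have hZ : adj Z = Z by exact: adj_odd.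
have cY : cm z Y by exact: cm_evn.
have aZ : am z Z by exact: am_odd.
pose Y0 := evn x Y; pose Y3 := odd x Y.
have hY0 : adj Y0 = Y0 by exact: adj_evn.
have hY3 : adj Y3 = Y3 by exact: adj_odd.
have cY0 : cm x Y0 by exact: cm_evn.
have aY3 : am x Y3 by exact: am_odd.
have xYx : cm z (x *m Y *m x).
  by apply: amM_am => //; apply: amM_cm.
have czY0 : cm z Y0 by apply/cmZ/cmD.
have czY3 : cm z Y3 by apply/cmZ/cmB.
(* Both Y3 and z anticommute with x, so their product commutes with it. The factor z changes neither
   the square nor the Dirichlet forms of the other qubits. *)
pose A3 := z *m Y3.
have hA3 : adj A3 = A3 by rewrite /A3 adjM hY3 hz czY3.
have czA3 : cm z A3 by exact: cmM.
have cxA3 : cm x A3 by exact: amM_am.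
pose W := absm Z.
have hW : adj W = W by exact: adj_fnm.
have cW : cm z W by apply: fnm_odd_even => // t; rewrite normrN.
(* W^2 = Z^2 and Z anticommutes with z, so the two blocks of W have equal weight. *)
have aW : Tr (z *m (W *m W)) = 0.
  rewrite /W (absm_sqr hZ) mulmxA; apply: self_opp_eq0.
  by rewrite {1}aZ mulNmx TrN -[Z *m z *m Z]mulmxA TrC.
have sxz' := siteN sxz.
have cW' : cm (- z) W by exact/cm_sym/cmN/cm_sym.
pose D1 := blk x z W; pose D2 := blk x (- z) W.
have hD1 : adj D1 = D1 by exact: adj_blk.
have hD2 : adj D2 = D2 by exact: adj_blk.
have cxD1 : cm x D1 by exact: cm_x_blk.
have cxD2 : cm x D2 by exact: cm_x_blk.
have czD1 : cm z D1 by exact: cm_z_blk.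
have czD2 : cm z D2.
  have := cm_z_blk sxz' cW'; rewrite /cm mulNmx mulmxN.
  exact: oppr_inj.
have cds' u t : u \in (x, z) :: done -> t \in ss -> scm u t.
  rewrite inE => /orP[/eqP ->|ud] tss; first exact: cxz.
  by apply: cds => //; rewrite inE tss orbT.
have irr' B : adj B = B -> (forall u, u \in ((x, z) :: done) ++ ss -> cms u B) ->
    exists c : R, B = c%:C *: 1%:M.
  move=> hB cB; apply: irr => // u; rewrite mem_cat inE => hu; apply: cB.
  by rewrite mem_cat inE; case/or3P: hu => ->; rewrite ?orbT.
have hdone u : u \in done -> cms u x /\ cms u z.
  move=> ud; have := cds u (x, z) ud; rewrite inE eqxx => /(_ isT) [/= *].
  by split; split.
have IH' B : adj B = B -> cm x B -> cm z B -> (forall u, u \in done -> cms u B) ->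
    Ent B + sq B * ln d%:R <= 2 * dirs ss B.
  move=> hB cxB czB cB; apply: (IH ((x, z) :: done)) => // u.
  by rewrite inE => /orP[/eqP ->|]; [split|exact: cB].
have dY u : u \in done -> cms u Y.
  by move=> ud; have [_ [? ?]] := hdone u ud; have [? ?] := cA u ud; split; exact: cm_evn_of.
have dZ u : u \in done -> cms u Z.
  by move=> ud; have [_ [? ?]] := hdone u ud; have [? ?] := cA u ud; split; exact: cm_odd_of.
have dY0 u : u \in done -> cms u Y0.
  by move=> ud; have [[? ?] _] := hdone u ud; have [? ?] := dY u ud; split; exact: cm_evn_of.
have dA3 u : u \in done -> cms u A3.
  move=> ud; have [[x1 x2] [z1 z2]] := hdone u ud; have [Y1 Y2] := dY u ud.
  by split; [exact: (cmM z1 (cm_odd_of x1 Y1))|exact: (cmM z2 (cm_odd_of x2 Y2))].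
have dW u : u \in done -> cms u W.
  by move=> ud; have [? ?] := dZ u ud; split; exact: cm_fnm.
have dblk u w : u \in done -> cms u w -> cms u (blk x w W).
  move=> ud [w1 w2]; have [[x1 x2] _] := hdone u ud; have [W1 W2] := dW u ud.
  by split; [exact: cm_blk x1 w1 W1|exact: cm_blk x2 w2 W2].
have dD1 u : u \in done -> cms u D1.
  by move=> ud; apply: dblk => //; case: (hdone u ud).
have dD2 u : u \in done -> cms u D2.
  by move=> ud; apply: dblk => //; case: (hdone u ud) => _ [? ?]; split; exact: cmN.
have eA := evn_odd z A; rewrite -/Y -/Z in eA.
have eY := evn_odd x Y; rewrite -/Y0 -/Y3 in eY.
have PA := Ent_even_odd_le d0 (parity_of hY hZ hz zz cY aZ); rewrite -eA in PA.
have PY := Ent_even_odd_le d0 (parity_of hY0 hY3 hx xx cY0 aY3); rewrite -eY in PY.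
have A3sq : A3 *m A3 = Y3 *m Y3.
  by rewrite {1}/A3 czY3 /A3 mulmxA -[Y3 *m z *m z]mulmxA zz mulmx1.
have eE3 : Ent A3 = Ent Y3 by apply: Ent_eq.
have sA3 : sq A3 = sq Y3 by rewrite /sq A3sq.
have [sD1 sD2] := sq_blk sxz hW cW aW; rewrite -/D1 in sD1; rewrite -/D2 in sD2.
have sWZ : sq W = sq Z := congr1 (@Tr R d) (absm_sqr hZ).
have eEZ : Ent Z = (Ent D1 + Ent D2) / 2.
  rewrite -(Ent_absm hZ).
  exact: (Ent_avg sD1 sD2 (Tr_fnm_blocks sxz hW cW (@xlnx2 R))).
have dss t : t \in ss -> site t /\ scm (x, z) t.
  by move=> tss; split; [exact: sites_site sss tss|exact: cxz].
have dir_A : dirs ss A = dirs ss Y0 + dirs ss A3 + dirs ss Z.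
  rewrite /dirs -!big_split /=; apply: eq_big_seq => t tss.
  have [st /scm_cms1[/= tx tz]] := dss t tss.
  rewrite {1}eA (dirD st zz tz cY aZ) {1}eY (dirD st xx tx cY0 aY3).
  by rewrite (dir_mul st zz tz czY3).
have dir_W : (dirs ss D1 + dirs ss D2) / 2 = dirs ss W.
  rewrite /dirs -big_split mulr_suml /=; apply: eq_big_seq => t tss.
  have [st sct] := dss t tss.
  exact: (esym (dir_blocks sxz hW cW aW st sct)).
have dir_Z : (dirs ss D1 + dirs ss D2) / 2 <= dirs ss Z.
  by rewrite dir_W /dirs; apply: ler_sum => t _; exact: dir_absm_le.
have H0 := IH' Y0 hY0 cY0 czY0 dY0.
have H3 := IH' A3 hA3 cxA3 czA3 dA3; rewrite eE3 sA3 in H3.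
have H1 := IH' D1 hD1 cxD1 czD1 dD1; rewrite sD1 sWZ in H1.
have H2 := IH' D2 hD2 cxD2 czD2 dD2; rewrite sD2 sWZ in H2.
(* Twice this is exactly the excess in [PA] and [PY] together. *)
have own : dir (x, z) A = sq Z + sq Y3.
  rewrite {1}eA {1}eY; exact: (dir_own sxz (conj cY0 czY0) czY3 aY3 aZ).
have sA : sq A = sq Y0 + sq Y3 + sq Z.
  by rewrite {1}eA (sqD zz cY aZ) {1}eY (sqD xx cY0 aY3).
rewrite /dirs big_cons own -/(dirs ss A) dir_A sA.
exact: (log_sobolev_step PA PY eEZ H0 H3 H1 H2 dir_Z).
Qed.

End LogSobolev.

(** * Depolarizing noise and entropy contraction *)

Section Dissipation.
Variables (R : realType) (d : nat).
Local Notation C := R[i].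
Local Notation siteT := ('M[C]_d * 'M[C]_d)%type.
Implicit Types (A B P Q S U : 'M[C]_d) (s t : siteT) (f g : R -> R) (v w : nat -> R).

(* The average over the four Pauli conjugations, that is, the complete
   depolarization of the qubit s. *)
Definition Em s A := evn s.1 (evn s.2 A).
(** [v] is the retained fraction, 1 - p for depolarization p. Values above 1 are allowed and undo
    noise; the contraction proof passes in this way from a rate s to a larger rate t. *)
Definition dep (v : R) s A := v%:C *: A + (1 - v)%:C *: Em s A.

Fixpoint deps v (ss : seq siteT) A : 'M[C]_d :=
  if ss is s :: ss' then dep (v 0%N) s (deps (fun i => v i.+1) ss' A) else A.

(* A >= c, read off the diagonal of A in every orthonormal basis. *)
Definition lb (c : R) A := forall U i, unitary U -> c <= complex.Re ((U *m A *m adj U) i i).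

Lemma evnD P A B : evn P (A + B) = evn P A + evn P B.
Proof. by rewrite /evn mulmxDr mulmxDl addrACA scalerDr. Qed.

Lemma evnZ P (c : C) A : evn P (c *: A) = c *: evn P A.
Proof.
by rewrite /evn -scalemxAr -scalemxAl -scalerDr !scalerA mulrC.
Qed.

Lemma evn_id P A : P *m P = 1%:M -> cm P A -> evn P A = A.
Proof. by move=> PP c; rewrite /evn c -mulmxA PP mulmx1 half2. Qed.

Lemma evn_comm P Q A : cm P Q \/ am P Q -> evn P (evn Q A) = evn Q (evn P A).
Proof.
move=> h; have e : P *m (Q *m A *m Q) *m P = Q *m (P *m A *m P) *m Q.
  transitivity (P *m Q *m A *m (Q *m P)); first by rewrite !mulmxA.
  transitivity (Q *m P *m A *m (P *m Q)); last by rewrite !mulmxA.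
  case: h => [h|h].
    by rewrite h.
  by rewrite h !mulNmx mulmxN.
rewrite /evn -!scalemxAr -!scalemxAl -!scalerDr !mulmxDr !mulmxDl e.
by rewrite addrACA.
Qed.

Lemma EmD s A B : Em s (A + B) = Em s A + Em s B.
Proof. by rewrite /Em !evnD. Qed.
Lemma EmZ s (c : C) A : Em s (c *: A) = c *: Em s A.
Proof. by rewrite /Em !evnZ. Qed.
Lemma Tr_evn P A : P *m P = 1%:M -> Tr (evn P A) = Tr A.
Proof.
move=> PP; rewrite /evn TrZ TrD TrC mulmxA PP mul1mx.
by move: (Tr A) => t; field.
Qed.

Lemma Tr_Em s A : site s -> Tr (Em s A) = Tr A.
Proof. by case=> _ _ h1 h2 _; rewrite /Em !Tr_evn. Qed.

Lemma adj_Em s A : site s -> adj A = A -> adj (Em s A) = Em s A.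
Proof. by case=> h1 h2 _ _ _ hA; rewrite /Em !adj_evn. Qed.

Lemma Em_id s A : site s -> Em s (Em s A) = Em s A.
Proof.
case: s => x z [/= _ _ xx zz xz]; rewrite /Em /=.
have zx : cm z x \/ am z x by right; exact: am_sym.
by rewrite (evn_comm _ zx) (evn_id zz (cm_evn A zz)) (evn_id xx (cm_evn _ xx)).
Qed.

Lemma Em_comm s t A : scm s t -> Em s (Em t A) = Em t (Em s A).
Proof.
case=> h1 h2 h3 h4; rewrite /Em.
rewrite (evn_comm _ (or_introl h3)) (evn_comm _ (or_introl h4)).
by rewrite (evn_comm _ (or_introl h1)) (evn_comm _ (or_introl h2)).
Qed.

Opaque Em.

Lemma depD (a : R) s A B : dep a s (A + B) = dep a s A + dep a s B.
Proof. by rewrite /dep EmD !scalerDr addrACA. Qed.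
Lemma depZ (a : R) s (c : C) A : dep a s (c *: A) = c *: dep a s A.
Proof. by rewrite /dep EmZ scalerDr !scalerA ![_ * c]mulrC. Qed.
Lemma depsD v ss A B : deps v ss (A + B) = deps v ss A + deps v ss B.
Proof. by elim: ss v => //= s ss IH v; rewrite IH depD. Qed.
Lemma depsZ v ss (c : C) A : deps v ss (c *: A) = c *: deps v ss A.
Proof. by elim: ss v => //= s ss IH v; rewrite IH depZ. Qed.

Lemma Tr_dep (a : R) s A : site s -> Tr (dep a s A) = Tr A.
Proof. by move=> h; rewrite /dep TrD (TrZ a A) (TrZ (1 - a)) Tr_Em //; move: (Tr A) => t; ring. Qed.

Lemma Tr_deps v ss A : sites ss -> Tr (deps v ss A) = Tr A.
Proof.
by elim: ss v => //= s ss IH v [h1 h2 h3]; rewrite Tr_dep // IH.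
Qed.

Lemma adj_dep (a : R) s A : site s -> adj A = A -> adj (dep a s A) = dep a s A.
Proof. by move=> h hA; rewrite /dep adjD (adjZ a A) (adjZ (1 - a) (Em s A)) adj_Em // hA. Qed.

Lemma adj_deps v ss A : sites ss -> adj A = A -> adj (deps v ss A) = deps v ss A.
Proof.
by elim: ss v => //= s ss IH v [h1 h2 h3] hA; rewrite adj_dep // IH.
Qed.

Lemma dep_comm (a b : R) s t A : scm s t -> dep a s (dep b t A) = dep b t (dep a s A).
Proof.
move=> h; rewrite /dep !EmD (EmZ s b%:C A) (EmZ s (1 - b)%:C (Em t A)).
rewrite (EmZ t a%:C A) (EmZ t (1 - a)%:C (Em s A)) (Em_comm A h).
move: (Em t (Em s A)) (Em s A) (Em t A) => B1 B2 B3.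
rewrite !scalerDr !scalerA [b%:C * a%:C]mulrC [b%:C * (1 - a)%:C]mulrC.
by rewrite [(1 - b)%:C * a%:C]mulrC [(1 - b)%:C * (1 - a)%:C]mulrC addrACA.
Qed.

Lemma dep_deps_comm (a : R) v s ss A : (forall t, t \in ss -> scm s t) ->
  dep a s (deps v ss A) = deps v ss (dep a s A).
Proof.
elim: ss v => [//|t ss IH] v h.
have ht : scm s t by apply: h; rewrite mem_head.
have hss u : u \in ss -> scm s u by move=> us; apply: h; rewrite inE us orbT.
rewrite -[deps v (t :: ss) A]/(dep (v 0%N) t (deps (fun i => v i.+1) ss A)).
by rewrite (dep_comm _ _ _ ht) (IH _ hss).
Qed.

Lemma depM (a b : R) s A : site s -> dep a s (dep b s A) = dep (a * b) s A.
Proof.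
move=> h; rewrite /dep EmD (EmZ s b%:C A) (EmZ s (1 - b)%:C (Em s A)) (Em_id A h).
move: (Em s A) => B; rewrite -scalerDl scalerDr !scalerA -addrA -scalerDl.
rewrite -!(rmorphD (real_complex R)) -!(rmorphM (real_complex R)).
rewrite -!(rmorphD (real_complex R)).
by congr (_ + _%:C *: _); ring.
Qed.

(** Rates multiply because complete depolarization is idempotent and distinct sites commute. It is
    used with a ratio t / s >= 1 to undo noise and with ratios v i / r <= 1 to split it. *)
Lemma depsM v w ss A : sites ss ->
  deps v ss (deps w ss A) = deps (fun i => v i * w i) ss A.
Proof.
elim: ss v w => [//|s ss IH] v w [h1 h2 h3].
have e := dep_deps_comm (w 0%N) (fun i => v i.+1) (deps (fun i => w i.+1) ss A) h2.
transitivity (dep (v 0%N) s (dep (w 0%N) s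
  (deps (fun i => v i.+1) ss (deps (fun i => w i.+1) ss A)))).
  by rewrite e.
by rewrite (depM _ _ _ h1) (IH _ _ h3).
Qed.

Lemma eq_deps v w ss A : v =1 w -> deps v ss A = deps w ss A.
Proof.
elim: ss v w => [//|s ss IH] v w h.
have h' : (fun i => v i.+1) =1 (fun i => w i.+1) by move=> i; exact: h.
transitivity (dep (v 0%N) s (deps (fun i => w i.+1) ss A)).
  exact: congr1 (IH _ _ h').
by rewrite h.
Qed.

Lemma dep1 s A : dep 1 s A = A.
Proof. by rewrite /dep subrr scale1r scale0r addr0. Qed.

Lemma deps1 ss A : deps (fun=> 1) ss A = A.
Proof.
elim: ss => [//|s ss IH]; transitivity (dep 1 s A); last exact: dep1.
exact: congr1 IH.
Qed.

Lemma lb_mix (c a b : R) A B : 0 <= a -> 0 <= b -> a + b = 1 -> lb c A -> lb c B ->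
  lb c (a%:C *: A + b%:C *: B).
Proof.
move=> a0 b0 ab hA hB U i uU.
have {}hA := hA U i uU; have {}hB := hB U i uU; move: hA hB.
rewrite mulmxDr mulmxDl -!scalemxAr -!scalemxAl.
move: (U *m A *m adj U) (U *m B *m adj U) => M N hM hN.
rewrite !mxE ReD !ReZ.
have -> : c = a * c + b * c by rewrite -mulrDl ab mul1r.
by apply: lerD; apply: ler_wpM2l.
Qed.

Lemma lb_conj (c : R) A S : unitary S -> lb c A -> lb c (S *m A *m adj S).
Proof.
move=> uS hA U i uU; have := hA (U *m S) i (unitaryM uU uS).
by rewrite adjM !mulmxA.
Qed.

Lemma half_ge0 : 0 <= 2^-1 :> R. Proof. by rewrite invr_ge0. Qed.
Lemma half_sum : 2^-1 + 2^-1 = 1 :> R. Proof. by field. Qed.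

Lemma lb_evn (c : R) P A : adj P = P -> P *m P = 1%:M -> lb c A -> lb c (evn P A).
Proof.
move=> hP PP hA; have := lb_conj (unitary_invol hP PP) hA; rewrite hP => hPA.
by rewrite /evn scalerDr; exact: (lb_mix half_ge0 half_ge0 half_sum hA hPA).
Qed.

Transparent Em.

Lemma lb_Em (c : R) s A : site s -> lb c A -> lb c (Em s A).
Proof. by case=> h1 h2 h3 h4 _ hA; exact: (lb_evn h1 h3 (lb_evn h2 h4 hA)). Qed.

Opaque Em.

Lemma lb_dep (c a : R) s A : site s -> 0 <= a -> a <= 1 -> lb c A -> lb c (dep a s A).
Proof.
move=> hs a0 a1 hA; have h : 0 <= 1 - a by rewrite subr_ge0.
exact: (lb_mix a0 h (subrKC _ _) hA (lb_Em hs hA)).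
Qed.

Lemma lb_deps (c : R) v ss A : sites ss -> (forall i, (i < size ss)%N -> 0 <= v i <= 1) ->
  lb c A -> lb c (deps v ss A).
Proof.
elim: ss v => //= s ss IH v [h1 h2 h3] hv hA.
have /andP[v0 v1] := hv 0%N isT.
by apply: lb_dep => //; apply: IH => // i; exact: (hv i.+1).
Qed.

Lemma lb_eig (c : R) A k : adj A = A -> lb c A -> c <= eig A k.
Proof.
move=> hA h; have := h _ k (eigU_unitary A).
rewrite eigU_mul // -mulmxA; have [_ ->] := eigU_unitary A.
by rewrite mulmx1 rdiagE eqxx.
Qed.

Lemma le_lb (b c : R) A : b <= c -> lb c A -> lb b A.
Proof. by move=> bc h U i uU; apply: le_trans bc _; exact: h. Qed.

Definition xlnx (t : R) := t * ln t.
(* The relative entropy of A to the maximally mixed state when Tr A = 1. *)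
Definition Dv A := Tr (fnm xlnx A) + ln d%:R.

Lemma klein_xlnx (c : R) A B : adj A = A -> adj B = B -> lb 0 A -> 0 < c -> lb c B ->
  Tr (fnm xlnx B) + Tr (fnm (fun y : R => ln y + 1) B *m (A - B)) <= Tr (fnm xlnx A).
Proof.
move=> hA hB lA c0 lB; rewrite -[leLHS]addr0 -[X in _ + _ + X](mul0r (sq (A - B))).
apply: klein => // k l; rewrite mul0r addr0 /xlnx.
apply: xlnx_tangent; first exact: lb_eig.
by apply: lt_le_trans c0 _; exact: lb_eig.
Qed.

Lemma mix_bound (a b m xA xB tA tB : R) : 0 <= a -> 0 <= b -> a + b = 1 ->
  m + xA <= tA -> m + xB <= tB -> a * xA + b * xB = 0 -> m <= a * tA + b * tB.
Proof.
move=> a0 b0 ab /(ler_wpM2l a0) hA /(ler_wpM2l b0) hB e.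
have -> : m = a * m + b * m by rewrite -mulrDl ab mul1r.
move: e hA hB; clear; lra.
Qed.

Lemma mix_le (a t u : R) : 0 <= 1 - a -> u <= t -> a * t + (1 - a) * u <= t.
Proof. by move=> a0 /(ler_wpM2l a0) h; lra. Qed.

(** Convexity of Tr A ln A: the tangents given by Klein's inequality at the mixture have linear
    terms that cancel in the average. *)
Lemma xlnx_mix (a b c : R) A B : 0 <= a -> 0 <= b -> a + b = 1 -> 0 < c ->
  adj A = A -> adj B = B -> lb c A -> lb c B ->
  Tr (fnm xlnx (a%:C *: A + b%:C *: B)) <= a * Tr (fnm xlnx A) + b * Tr (fnm xlnx B).
Proof.
move=> a0 b0 ab c0 hA hB lA lB; set M := _ + _.
have hM : adj M = M by rewrite adjD !adjZ hA hB.
have lM : lb c M by exact: lb_mix.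
have kA := klein_xlnx hA hM (le_lb (ltW c0) lA) c0 lM.
have kB := klein_xlnx hB hM (le_lb (ltW c0) lB) c0 lM.
set L := fnm (fun y : R => ln y + 1) M in kA kB.
have e : a * Tr (L *m (A - M)) + b * Tr (L *m (B - M)) = 0.
  rewrite -!TrZ -TrD !scalemxAr -mulmxDr !scalerBr.
  have -> : a%:C *: A - a%:C *: M + (b%:C *: B - b%:C *: M) = 0.
    rewrite addrACA -opprD -scalerDl -(rmorphD (real_complex R)) ab scale1r.
    exact: subrr.
  by rewrite mulmx0 Tr0.
exact: (mix_bound a0 b0 ab kA kB e).
Qed.

Lemma xlnx_conj S A : adj A = A -> unitary S ->
  Tr (fnm xlnx (S *m A *m adj S)) = Tr (fnm xlnx A).
Proof. by move=> hA uS; rewrite fnm_conj // Tr_conj. Qed.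

Lemma xlnx_evn (c : R) P A : 0 < c -> adj P = P -> P *m P = 1%:M -> adj A = A ->
  lb c A -> Tr (fnm xlnx (evn P A)) <= Tr (fnm xlnx A).
Proof.
move=> c0 hP PP hA lA; have uP := unitary_invol hP PP.
have hPA : adj (P *m A *m adj P) = P *m A *m adj P by rewrite !adjM adjK hA mulmxA.
have -> : evn P A = 2^-1%:C *: A + 2^-1%:C *: (P *m A *m adj P).
  by rewrite /evn scalerDr hP.
apply: (le_trans (xlnx_mix half_ge0 half_ge0 half_sum c0 hA hPA lA (lb_conj uP lA))).
by rewrite xlnx_conj //; move: (Tr _) => t; rewrite -mulrDl half_sum mul1r.
Qed.

Transparent Em.

Lemma xlnx_Em (c : R) s A : 0 < c -> site s -> adj A = A -> lb c A ->
  Tr (fnm xlnx (Em s A)) <= Tr (fnm xlnx A).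
Proof.
move=> c0 [h1 h2 h3 h4 _] hA lA; rewrite /Em.
apply: le_trans (xlnx_evn c0 h2 h4 hA lA).
exact: (xlnx_evn c0 h1 h3 (adj_evn h2 hA) (lb_evn h2 h4 lA)).
Qed.

Opaque Em.

Lemma xlnx_dep (a c : R) s A : site s -> 0 <= a -> a <= 1 -> 0 < c -> adj A = A -> lb c A ->
  Tr (fnm xlnx (dep a s A)) <= Tr (fnm xlnx A).
Proof.
move=> hs a0 a1 c0 hA lA.
have h := xlnx_Em c0 hs hA lA.
have a1' : 0 <= 1 - a by rewrite subr_ge0.
apply: (le_trans (xlnx_mix a0 a1' (subrKC _ _) c0 hA (adj_Em hs hA) lA (lb_Em hs lA))).
exact: mix_le.
Qed.

(** Depolarization averages unitary conjugations, each of which preserves the entropy, so convexity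
    suffices. *)
Lemma Dv_deps_le (c : R) v ss A : sites ss ->
  (forall i, (i < size ss)%N -> 0 <= v i <= 1) -> 0 < c -> adj A = A -> lb c A ->
  Dv (deps v ss A) <= Dv A.
Proof.
move=> hss hv c0 hA lA; rewrite lerD2r.
elim: ss v hss hv => //= s ss IH v [h1 h2 h3] hv.
have /andP[v0 v1] := hv 0%N isT.
have hv' i : (i < size ss)%N -> 0 <= v i.+1 <= 1 by exact: (hv i.+1).
apply: le_trans (IH (fun i => v i.+1) h3 hv').
apply: (xlnx_dep h1 v0 v1 c0); first exact: adj_deps.
exact: lb_deps.
Qed.

End Dissipation.

(** * Entropy production and its decay under uniform noise *)

Section Contraction.
Variables (R : realType) (d : nat).
Local Notation C := R[i].
Local Notation siteT := ('M[C]_d * 'M[C]_d)%type.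
Implicit Types (f g : R -> R) (A B P Q S U rho : 'M[C]_d) (s : siteT) (ss : seq siteT).

Lemma Tr_mulDr A B G : Tr (G *m (A + B)) = Tr (G *m A) + Tr (G *m B).
Proof. by rewrite mulmxDr TrD. Qed.
Lemma Tr_mulBr A B G : Tr (G *m (A - B)) = Tr (G *m A) - Tr (G *m B).
Proof. by rewrite mulmxBr TrB. Qed.

Lemma Tr_mul_evn A P L : Tr (L *m evn P A) =
  2^-1 * (Tr (L *m A) + Tr (L *m (P *m A *m P))).
Proof. by rewrite /evn Tr_mulZr Tr_mulDr. Qed.

Lemma Tr_mul_Em s A L : site s -> Tr (L *m Em s A) =
  4^-1 * (Tr (L *m A) + Tr (L *m (s.1 *m A *m adj s.1)) +
     Tr (L *m (s.2 *m A *m adj s.2)) +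
     Tr (L *m (s.1 *m s.2 *m A *m adj (s.1 *m s.2)))).
Proof.
case: s => x z [/= hx hz _ _ _].
rewrite /Em Tr_mul_evn adjM hx hz /=.
have -> : x *m evn z A *m x =
    2^-1%:C *: (x *m A *m x + x *m z *m A *m (z *m x)).
  by rewrite /evn -scalemxAr -scalemxAl mulmxDr mulmxDl !mulmxA.
rewrite Tr_mul_evn Tr_mulZr Tr_mulDr.
by move: (Tr _) (Tr _) (Tr _) (Tr _) => a b c e; field.
Qed.

Lemma half_le (a b t u : R) : 4 * (2 * a - 2 * b) <= 2 * t - 2 * u -> 4 * (a - b) <= t - u.
Proof. by move=> h; lra. Qed.

Lemma sv_scalar (p lk ll : R) : 0 <= p -> 0 < lk -> 0 < ll ->
  p * (4 * (Num.sqrt lk * Num.sqrt lk + Num.sqrt ll * Num.sqrt ll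
    - 2 * (Num.sqrt lk * Num.sqrt ll))) <=
  p * (lk * ln lk + ll * ln ll - ln lk * ll - lk * ln ll).
Proof.
move=> p0 k0 l0; apply: ler_wpM2l => //.
have := ln_sqr_dissipation (x := Num.sqrt lk) (y := Num.sqrt ll).
rewrite !sqrtr_gt0 k0 l0 => /(_ isT isT).
have k0' := ltW k0; have l0' := ltW l0.
rewrite !sqr_sqrtr // => h; lra.
Qed.

Section Stroock.
Variables (rho : 'M[C]_d) (c : R).
Hypotheses (c0 : 0 < c) (hrho : adj rho = rho) (lrho : lb c rho).
Let X := fnm Num.sqrt rho.

(** The last trace is computed with the logarithm on either eigenvalue, which is where S has to be
    hermitian or antihermitian (the latter is the case of x z). The average of both forms contains
    (ln a - ln b) (a - b), and [sv_scalar] applies to each pair. *)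
Lemma stroock_varopoulos S : unitary S -> adj S = S \/ adj S = - S ->
  4 * (sq X - ov S X) <=
  Tr (fnm (@ln R) rho *m rho) - Tr (fnm (@ln R) rho *m (S *m rho *m adj S)).
Proof.
move=> uS hS.
have [p [p0 prow pcol pE]] := pair_unitary rho rho id id uS.
have l0 k : 0 < eig rho k by apply: lt_le_trans c0 _; exact: lb_eig.
have e1 : Tr (fnm (@ln R) rho *m (S *m rho *m adj S)) =
    \sum_k \sum_l p k l * (ln (eig rho k) * eig rho l).
  by apply: etrans (pE (@ln R) id); rewrite (fnm_id hrho) !mulmxA.
have e2 : Tr (fnm (@ln R) rho *m (S *m rho *m adj S)) =
    \sum_k \sum_l p k l * (eig rho k * ln (eig rho l)).
  have -> : S *m rho *m adj S = adj S *m rho *m S.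
    by case: hS => ->; rewrite // mulmxN !mulNmx.
  apply: etrans (pE id (@ln R)); rewrite (fnm_id hrho).
  by rewrite [LHS]TrC -!mulmxA [LHS]TrC !mulmxA.
have e3 : Tr (fnm (@ln R) rho *m rho) = \sum_k eig rho k * ln (eig rho k).
  have := congr1 (@Tr R d) (fnmM (@ln R) id rho); rewrite (fnm_id hrho) => ->.
  by rewrite Tr_fnm; apply: eq_bigr => k _; rewrite mulrC.
have e4 : sq X = \sum_k Num.sqrt (eig rho k) * Num.sqrt (eig rho k).
  by rewrite /sq /X fnmM Tr_fnm.
have e5 : ov S X = \sum_k \sum_l p k l * (Num.sqrt (eig rho k) * Num.sqrt (eig rho l)).
  by apply: etrans (pE Num.sqrt Num.sqrt); rewrite /ov /X !mulmxA.
have avg (f : 'I_d -> R) : 2 * \sum_k f k = \sum_k \sum_l p k l * (f k + f l).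
  rewrite mulr2n mulrDl mul1r.
  have -> : \sum_k \sum_l p k l * (f k + f l) =
     \sum_k \sum_l p k l * f k + \sum_k \sum_l p k l * f l.
    by rewrite -big_split; apply: eq_bigr => k _; rewrite -big_split; apply: eq_bigr => l _;
      rewrite mulrDr.
  congr (_ + _); first by apply: eq_bigr => k _; rewrite -mulr_suml prow mul1r.
  by rewrite exchange_big; apply: eq_bigr => k _; rewrite -mulr_suml pcol mul1r.
have key : 4 * (2 * sq X - 2 * ov S X) <=
   2 * Tr (fnm (@ln R) rho *m rho) - 2 * Tr (fnm (@ln R) rho *m (S *m rho *m adj S)).
  have -> : 4 * (2 * sq X - 2 * ov S X) = \sum_k \sum_l p k l *
     (4 * (Num.sqrt (eig rho k) * Num.sqrt (eig rho k) +
       Num.sqrt (eig rho l) * Num.sqrt (eig rho l) -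
       2 * (Num.sqrt (eig rho k) * Num.sqrt (eig rho l)))).
    rewrite e4 e5 avg mulr_sumr -sumrB mulr_sumr; apply: eq_bigr => k _.
    by rewrite mulr_sumr -sumrB mulr_sumr; apply: eq_bigr => l _; ring.
  rewrite e3 avg mulr2n [X in _ - X]mulrDl mul1r {1}e1 e2 -big_split -sumrB.
  apply: ler_sum => k _ /=; rewrite -big_split -sumrB; apply: ler_sum => l _ /=.
  apply: le_trans (sv_scalar (p0 k l) (l0 k) (l0 l)) _.
  by rewrite le_eqVlt; apply/orP; left; apply/eqP; ring.
exact: half_le key.
Qed.

End Stroock.

Definition irreducible ss := forall B, adj B = B ->
  (forall u, u \in ss -> cms u B) -> exists c : R, B = c%:C *: 1%:M.

Lemma mlsi_scalar (t tx tz ty s ox oz oy : R) :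
  4 * (s - ox) <= t - tx -> 4 * (s - oz) <= t - tz -> 4 * (s - oy) <= t - ty ->
  4 * ((3 * s - ox - oz - oy) / 4) <= t - 4^-1 * (t + tx + tz + ty).
Proof. by move=> h1 h2 h3; lra. Qed.

(** For X = sqrt rho, Ent X + ln d is Dv rho. It is at most twice the Dirichlet form of X, and four
    times that form is at most the entropy production. *)
Lemma modified_log_sobolev ss (c : R) rho : (0 < d)%N -> sites ss -> irreducible ss ->
  0 < c -> adj rho = rho -> lb c rho -> Tr rho = 1 ->
  2 * Dv rho <= \sum_(s <- ss) Tr (fnm (@ln R) rho *m (rho - Em s rho)).
Proof.
move=> d0 hss irr c0 hrho lrho tr1.
pose X := fnm Num.sqrt rho.
have hX : adj X = X by exact: adj_fnm.
have l0 k : 0 < eig rho k by apply: lt_le_trans c0 _; exact: lb_eig.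
have sX : sq X = 1.
  rewrite /sq /X fnmM -[RHS]tr1 -[in RHS](fnm_id hrho) !Tr_fnm.
  by apply: eq_bigr => k _; rewrite -expr2 sqr_sqrtr // ltW.
have eX : Dv rho = Ent X + sq X * ln d%:R.
  rewrite /Dv /Ent sX ln1 mulr0 subr0 mul1r /X fnm_comp !Tr_fnm; congr (_ + _).
  by apply: eq_bigr => k _; rewrite /xlnx /xlnx2 sqr_sqrtr // ltW.
have lsi := @log_sobolev R d ss d0 [::] X hX hss.
have {}lsi : Dv rho <= 2 * dirs ss X.
  by rewrite eX; apply: lsi => // B hB cB; exact: irr.
have step : 4 * dirs ss X <= \sum_(s <- ss) Tr (fnm (@ln R) rho *m (rho - Em s rho)).
  rewrite /dirs mulr_sumr big_seq [leRHS]big_seq; apply: ler_sum => s sss.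
  have st := sites_site hss sss; have [h1 h2 h3 h4 h5] := st.
  have u1 := unitary_invol h1 h3; have u2 := unitary_invol h2 h4.
  have h12 : adj (s.1 *m s.2) = - (s.1 *m s.2) by rewrite adjM h1 h2 h5 opprK.
  have f1 := stroock_varopoulos c0 hrho lrho u1 (or_introl h1).
  have f2 := stroock_varopoulos c0 hrho lrho u2 (or_introl h2).
  have f3 := stroock_varopoulos c0 hrho lrho (unitaryM u1 u2) (or_intror h12).
  rewrite Tr_mulBr Tr_mul_Em //.
  exact: mlsi_scalar f1 f2 f3.
move: lsi step; move: (dirs ss X) (Dv rho) (\sum_(_ <- _) _) => a b e; clear; lra.
Qed.

Lemma hs_parallelogram A B : hs (A + B) + hs (A - B) = 2 * hs A + 2 * hs B.
Proof.
rewrite !hsE !mulr_sumr -!big_split; apply: eq_bigr => i _ /=.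
rewrite !mulr_sumr -!big_split; apply: eq_bigr => j _ /=.
rewrite !mxE; case: (A i j) (B i j) => a b [c e]; rewrite /nsq /=; ring.
Qed.

Lemma hsD A B : hs (A + B) <= 2 * hs A + 2 * hs B.
Proof. by rewrite -hs_parallelogram lerDl hs_ge0. Qed.

Lemma hsB A B : hs (A - B) <= 2 * hs A + 2 * hs B.
Proof. by rewrite -hs_parallelogram lerDr hs_ge0. Qed.

Lemma hsZ (r : R) A : hs (r%:C *: A) = r ^+ 2 * hs A.
Proof. by rewrite /hs adjZ -scalemxAl -scalemxAr !TrZ mulrA. Qed.

Lemma hs_conj S A : unitary S -> hs (S *m A *m adj S) = hs A.
Proof.
case=> h1 h2; rewrite /hs !adjM adjK.
rewrite -!mulmxA [adj S *m (S *m _)]mulmxA h1 mul1mx !mulmxA TrC !mulmxA h1 mul1mx.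
by [].
Qed.

Lemma hs_evn P A : adj P = P -> P *m P = 1%:M -> hs (evn P A) <= hs A.
Proof.
move=> hP PP; have h := hs_conj A (unitary_invol hP PP); rewrite hP in h.
have := hsD A (P *m A *m P); rewrite /evn hsZ h.
by move: (hs _) (hs _) => a b; lra.
Qed.

Lemma hs_Em s A : site s -> hs (Em s A) <= hs A.
Proof.
case=> h1 h2 h3 h4 _; apply: le_trans (hs_evn A h2 h4).
exact: hs_evn.
Qed.

Lemma hs_sub_Em s A : site s -> hs (A - Em s A) <= 4 * hs A.
Proof.
move=> hs'; have := hsB A (Em s A); have := hs_Em A hs'.
by move: (hs _) (hs _) (hs _) => a b c; lra.
Qed.

(** The derivative of [deps (fun=> 1 + e) ss A] at e = 0. *)
Definition noise_gen ss A : 'M[C]_d := \sum_(s <- ss) (A - Em s A).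

Lemma dep_incr (e : R) s A : dep (1 + e) s A = A + e%:C *: (A - Em s A).
Proof.
rewrite /dep; move: (Em s A) => B.
have -> : 1 - (1 + e) = - e by ring.
by rewrite rmorphN rmorphD scalerDl scale1r scaleNr scalerBr addrA.
Qed.

Lemma noise_gen_bound ss : sites ss -> exists K : R, 0 <= K /\
  forall A, hs (noise_gen ss A) <= K * hs A.
Proof.
elim: ss => [_|s ss IH [h1 h2 h3]].
  exists 0; split=> // A; rewrite /noise_gen big_nil mul0r.
  by rewrite /hs adj0 mul0mx Tr0.
have [K [K0 hK]] := IH h3; exists (8 + 2 * K); split; first lra.
move=> A; rewrite /noise_gen big_cons.
have := hsD (A - Em s A) (noise_gen ss A); have := hs_sub_Em A h1; have := hK A.
rewrite /noise_gen; move: (hs _) (hs _) (hs _) (hs _) => a b c e; lra.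
Qed.

Lemma taylor_lmod (V : lmodType C) (e : R) (A G Q a NG b : V) :
  A + e%:C *: G + (e ^+ 2)%:C *: Q + e%:C *: (a + e%:C *: NG + (e ^+ 2)%:C *: b) =
  A + e%:C *: (a + G) + (e ^+ 2)%:C *: (Q + NG + e%:C *: b).
Proof.
rewrite expr2 rmorphM /=; move: e%:C => r.
rewrite !scalerDr !scalerA [r * r * r]mulrAC -!mulrA -!addrA.
by rewrite [(r * r) *: Q + (r *: a + _)]addrCA [r *: G + (r *: a + _)]addrCA.
Qed.

Lemma taylor_bound (e emax K L h hQ hG hNG hNQ hS hT : R) : 0 <= e -> e <= emax ->
  0 <= hQ -> hT <= 2 * hS + 2 * (e ^+ 2 * hNQ) -> hS <= 2 * hQ + 2 * hNG ->
  hNG <= 4 * hG -> hNQ <= 4 * hQ -> hG <= L * h -> hQ <= K * h ->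
  hT <= (4 * K + 16 * L + 8 * emax ^+ 2 * K) * h.
Proof.
move=> e0 em Q0 h1 h2 h3 h4 h5 h6.
have h7 : e ^+ 2 * hNQ <= e ^+ 2 * (4 * hQ) by rewrite ler_wpM2l ?sqr_ge0.
have h8 : e ^+ 2 * hQ <= emax ^+ 2 * (K * h).
  apply: ler_pM => //; first exact: sqr_ge0.
  by rewrite ler_pXn2r ?nnegrE //; lra.
lra.
Qed.

(** What matters is uniformity: K depends neither on A nor on e. *)
Lemma deps_taylor ss (emax : R) : sites ss -> 0 <= emax -> exists K : R, 0 <= K /\
  forall (e : R) A, 0 <= e -> e <= emax -> exists Q,
    deps (fun=> 1 + e) ss A = A + e%:C *: noise_gen ss A + (e ^+ 2)%:C *: Q /\
    hs Q <= K * hs A.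
Proof.
move=> hss m0; elim: ss hss => [_|s ss IH [h1 h2 h3]].
  exists 0; split=> // e A _ _; exists 0.
  rewrite /noise_gen big_nil !scaler0 !addr0 mul0r /hs adj0 mul0mx Tr0.
  by [].
have [K [K0 hK]] := IH h3; have [L [L0 hL]] := noise_gen_bound h3.
exists (4 * K + 16 * L + 8 * emax ^+ 2 * K); split.
  by rewrite !addr_ge0 ?mulr_ge0 ?sqr_ge0.
move=> e A e0 em; have [Q [eQ hQ]] := hK e A e0 em.
pose N B := B - Em s B.
have ND B1 B2 : N (B1 + B2) = N B1 + N B2.
  by rewrite /N EmD opprD addrACA.
have NZ (r : C) B : N (r *: B) = r *: N B.
  by rewrite /N EmZ scalerBr.
exists (Q + N (noise_gen ss A) + e%:C *: N Q); split.
  rewrite -[LHS]/(dep (1 + e) s (deps (fun=> 1 + e) ss A)) eQ dep_incr -/(N _).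
  rewrite !ND !NZ /noise_gen big_cons -/(noise_gen ss A) -/(N A).
  move: (noise_gen ss A) (N (noise_gen ss A)) (N A) (N Q) => G NG a c.
  exact: taylor_lmod.
have h4 := hsD (Q + N (noise_gen ss A)) (e%:C *: N Q).
have h5 := hsD Q (N (noise_gen ss A)).
have h6 := hs_sub_Em (noise_gen ss A) h1; rewrite -/(N _) in h6.
have h7 := hs_sub_Em Q h1; rewrite -/(N _) in h7.
have h8 := hL A.
rewrite hsZ in h4.
exact: (taylor_bound e0 em (hs_ge0 _) h4 h5 h6 h7 h8 hQ).
Qed.

Lemma fnmD f g A : fnm (fun y => f y + g y) A = fnm f A + fnm g A.
Proof.
rewrite /fnm /dg -mulmxDl -mulmxDr; congr (_ *m _ *m _).
by apply/matrixP => i j; rewrite !mxE rmorphD mulrnDl.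
Qed.

Lemma Tr_mul_ge A B : adj A = A -> - (hs A + hs B) / 2 <= Tr (A *m B).
Proof.
move=> hA; have := hs_ge0 (A + B).
have -> : hs (A + B) = hs A + 2 * Tr (A *m B) + hs B.
  rewrite /hs adjD hA Tr_mulDD.
  have -> : Tr (adj B *m A) = Tr (A *m B) by rewrite -Tr_adj adjM adjK hA.
  by move: (Tr _) (Tr _) (Tr _) => a b c; ring.
by move: (hs _) (Tr _) (hs _) => a b c h; lra.
Qed.

Section States.
Variables (rho : 'M[C]_d) (c : R).
Hypotheses (c0 : 0 < c) (hrho : adj rho = rho) (lrho : lb c rho) (tr1 : Tr rho = 1).

Let l_ge k : c <= eig rho k. Proof. exact: lb_eig. Qed.
Let l_gt0 k : 0 < eig rho k. Proof. exact: lt_le_trans c0 (l_ge k). Qed.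
Let l_sum : \sum_k eig rho k = 1.
Proof. by rewrite -tr1 -[in RHS](fnm_id hrho) Tr_fnm. Qed.
Let l_le1 k : eig rho k <= 1.
Proof.
by rewrite -l_sum (bigD1 k) //= lerDl; apply: sumr_ge0 => i _; exact: ltW.
Qed.

Lemma state_hs_le1 : hs rho <= 1.
Proof.
rewrite /hs hrho -/(sq rho) (sqE hrho) -l_sum; apply: ler_sum => k _.
by rewrite expr2 ler_piMl // ltW.
Qed.

Lemma state_hs_ln : hs (fnm (@ln R) rho) <= d%:R * ln c ^+ 2.
Proof.
rewrite /hs adj_fnm fnmM Tr_fnm.
have -> : d%:R * ln c ^+ 2 = \sum_(k < d) ln c ^+ 2.
  by rewrite sumr_const card_ord mulr_natl.
apply: ler_sum => k _; rewrite -expr2 -[leLHS]sqrrN -[leRHS]sqrrN.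
have h1 := le_ln c0 (l_ge k); have h2 := ln_le0 (l_le1 k).
by rewrite ler_pXn2r ?nnegrE ?oppr_ge0 ?lerN2 //; apply: le_trans h1 h2.
Qed.

Lemma state_Dv_le : Dv rho <= ln d%:R.
Proof.
rewrite /Dv gerDr Tr_fnm; apply: sumr_le0 => k _.
by rewrite /xlnx mulr_ge0_le0 ?ln_le0 // ltW.
Qed.

End States.

(** Here t = (1 + e) s. Production at least 2 Ds gives Dt >= (1 + e)^2 Ds up to order e^2, so D /
    v^2 does not drop from s to t beyond order (t - s)^2. *)
Lemma contraction_step (Ds Dt D2 s t q B L e TL TQ : R) : 0 < q -> q <= s -> s <= t ->
  e = (t - s) / s -> 0 <= L -> 0 <= B -> Ds <= L -> 2 * Ds <= TL -> - B <= TQ ->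
  Ds + (e * TL + e ^+ 2 * TQ) <= Dt ->
  Ds / s ^+ 2 - (B + L) / q ^+ 4 * (t - s) ^+ 2 <= Dt / t ^+ 2.
Proof.
move=> q0 qs st eE L0 B0 hL hT hQ h.
have s0 : 0 < s by lra.
have t0 : 0 < t by lra.
have e0 : 0 <= e by rewrite eE divr_ge0 //; lra.
have h1 : (1 + e) ^+ 2 * Ds - e ^+ 2 * (B + L) <= Dt.
  have := ler_wpM2l e0 hT; have := ler_wpM2l (sqr_ge0 e) hQ.
  have := ler_wpM2l (sqr_ge0 e) hL; lra.
rewrite ler_pdivlMr ?exprn_gt0 //; apply: le_trans h1.
have et : t = (1 + e) * s by rewrite eE; field; rewrite gt_eqF.
have -> : (Ds / s ^+ 2 - (B + L) / q ^+ 4 * (t - s) ^+ 2) * t ^+ 2 =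
   (1 + e) ^+ 2 * Ds - e ^+ 2 * (B + L) * (s ^+ 2 * t ^+ 2 / q ^+ 4).
  have -> : t - s = e * s by rewrite et; ring.
  by rewrite et; field; rewrite !gt_eqF.
rewrite lerD2l lerN2 ler_peMr ?mulr_ge0 ?sqr_ge0 ?addr_ge0 //.
rewrite ler_pdivlMr ?exprn_gt0 // mul1r -[4%N]/(2 + 2)%N exprD.
by apply: ler_pM; rewrite ?sqr_ge0 // ler_pXn2r ?nnegrE //; lra.
Qed.

(** D(v) / v^2 is shown to be nondecreasing on [q, 1]. Increments go from more noise at s to less at
    t: Klein's inequality with the tangent at rs bounds D(t) from below, so the logarithm at t is
    never expanded. *)
Lemma entropy_contraction ss (c q : R) rho : (0 < d)%N -> sites ss -> irreducible ss ->
  0 < c -> adj rho = rho -> lb c rho -> Tr rho = 1 -> 0 < q -> q <= 1 ->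
  Dv (deps (fun=> q) ss rho) <= q ^+ 2 * Dv rho.
Proof.
move=> d0 hss irr c0 hrho lrho tr1 q0 q1.
pose D v := Dv (deps (fun=> v) ss rho).
have im0 : 0 <= q^-1 by rewrite invr_ge0 ltW.
have [K [K0 hK]] := deps_taylor hss im0.
have L0 : 0 <= ln d%:R :> R by rewrite ln_ge0 // ler1n.
(* Bounds the remainder through |Tr L Q| <= (hs L + hs Q) / 2, where hs L <= d (ln c)^2 because the
   eigenvalues lie in [c, 1]. *)
pose B := (d%:R * ln c ^+ 2 + K) / 2.
have B0 : 0 <= B by rewrite divr_ge0 // addr_ge0 // mulr_ge0 // sqr_ge0.
suff : D q / q ^+ 2 <= D 1 / 1 ^+ 2.
  by rewrite expr1n divr1 ler_pdivrMr ?exprn_gt0 // /D deps1 mulrC.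
apply: (@tele_le _ (fun v => D v / v ^+ 2) q 1 ((B + ln d%:R) / q ^+ 4)) => // s t qs st t1.
have s0 : 0 < s by lra.
have hv v : 0 <= v -> v <= 1 -> forall i, (i < size ss)%N -> 0 <= (v : R) <= 1.
  by move=> v0 v1 i _; rewrite v0 v1.
have s1 : s <= 1 by lra.
have t0 : 0 <= t by lra.
pose rs := deps (fun=> s) ss rho; pose rt := deps (fun=> t) ss rho.
have hrs : adj rs = rs by exact: adj_deps.
have hrt : adj rt = rt by exact: adj_deps.
have lrs : lb c rs by exact: lb_deps hss (hv s (ltW s0) s1) lrho.
have lrt : lb c rt by exact: lb_deps hss (hv t t0 t1) lrho.
have trs : Tr rs = 1 by rewrite Tr_deps.
have trt : Tr rt = 1 by rewrite Tr_deps.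
pose e := (t - s) / s.
have e0 : 0 <= e by rewrite divr_ge0 ?subr_ge0 // ltW.
have em : e <= q^-1.
  rewrite /e; apply: le_trans (_ : 1 / s <= _).
    by rewrite ler_pM2r ?invr_gt0 //; lra.
  by rewrite div1r lef_pV2 ?posrE.
have [Q [eQ hQ]] := hK e rs e0 em.
have ert : rt = rs + e%:C *: noise_gen ss rs + (e ^+ 2)%:C *: Q.
  rewrite -eQ /rs depsM //; apply: eq_deps => i.
  by rewrite /e; field; rewrite gt_eqF.
have kl := klein_xlnx hrt hrs (le_lb (ltW c0) lrt) c0 lrs.
have mls := modified_log_sobolev d0 hss irr c0 hrs lrs trs.
set L := fnm (@ln R) rs in mls.
have eT : Tr (fnm (fun y : R => ln y + 1) rs *m (rt - rs)) =
    e * (\sum_(u <- ss) Tr (L *m (rs - Em u rs))) + e ^+ 2 * Tr (L *m Q).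
  rewrite (fnmD (@ln R) (fun=> 1)) fnm_const scale1r mulmxDl mul1mx TrD.
  have -> : Tr (rt - rs) = 0 by rewrite TrB trt trs subrr.
  rewrite addr0 ert.
  have -> : rs + e%:C *: noise_gen ss rs + (e ^+ 2)%:C *: Q - rs =
     e%:C *: noise_gen ss rs + (e ^+ 2)%:C *: Q by rewrite -[rs + _ + _]addrA addrAC subrr add0r.
  rewrite Tr_mulDr !Tr_mulZr; congr (_ * _ + _).
  by rewrite /noise_gen mulmx_sumr Tr_sum.
have hL := state_hs_ln c0 hrs lrs trs; rewrite -/L in hL.
have hr1 := state_hs_le1 c0 hrs lrs trs.
have hQ' : - B <= Tr (L *m Q).
  apply: le_trans (Tr_mul_ge Q (adj_fnm _ _)).
  have hQ1 : hs Q <= K by apply: le_trans hQ _; rewrite ler_piMr.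
  rewrite /B mulNr lerN2 ler_pM2r ?invr_gt0 //; exact: lerD.
apply: (contraction_step (Dt := D t) 0 q0 qs st (erefl e) L0 B0 (state_Dv_le c0 hrs lrs trs) mls hQ').
rewrite -eT /D -/rt /Dv addrAC lerD2r; exact: kl.
Qed.

End Contraction.

(** * Entropy along a noisy circuit, and Pinsker's inequality *)

Section Circuit.
Variables (R : realType) (d : nat).
Local Notation C := R[i].
Local Notation siteT := ('M[C]_d * 'M[C]_d)%type.
Implicit Types (A U rho : 'M[C]_d) (ss : seq siteT) (v : nat -> R).

Definition state_lb (c : R) rho := [/\ adj rho = rho, lb c rho & Tr rho = 1].

Lemma state_deps (c : R) v ss rho : sites ss ->
  (forall i, (i < size ss)%N -> 0 <= v i <= 1) ->
  state_lb c rho -> state_lb c (deps v ss rho).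
Proof.
move=> hss hv [h1 h2 h3]; split; [exact: adj_deps|exact: lb_deps|].
by rewrite Tr_deps.
Qed.

Lemma state_conj (c : R) U rho : unitary U -> state_lb c rho ->
  state_lb c (U *m rho *m adj U).
Proof.
move=> uU [h1 h2 h3]; split; last by rewrite Tr_conj.
  by rewrite !adjM adjK h1 mulmxA.
exact: lb_conj.
Qed.

Lemma Dv_conj U rho : unitary U -> adj rho = rho -> Dv (U *m rho *m adj U) = Dv rho.
Proof. by move=> uU hr; rewrite /Dv xlnx_conj. Qed.

(** Unequal rates v are uniform noise r followed by noise with rates v / r <= 1, which does not
    increase the entropy. *)
Lemma layer_contraction ss (c q : R) v rho : (0 < d)%N -> sites ss -> irreducible ss ->
  0 < c -> state_lb c rho -> 0 <= q -> q <= 1 ->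
  (forall i, (i < size ss)%N -> 0 <= v i <= q) ->
  Dv (deps v ss rho) <= q ^+ 2 * Dv rho.
Proof.
move=> d0 hss irr c0 srho q0 q1 hv; have [h1 h2 h3] := srho.
have pos r : 0 < r -> r <= 1 -> q <= r -> Dv (deps v ss rho) <= r ^+ 2 * Dv rho.
  move=> r0 r1 qr.
  have -> : deps v ss rho = deps (fun i => v i / r) ss (deps (fun=> r) ss rho).
    by rewrite depsM //; apply: eq_deps => i; rewrite divfK // gt_eqF.
  apply: le_trans (entropy_contraction d0 hss irr c0 h1 h2 h3 r0 r1).
  have hr i : (i < size ss)%N -> 0 <= (r : R) <= 1 by move=> _; rewrite ltW.
  have [h1' h2' _] := state_deps hss hr srho.
  apply: (Dv_deps_le hss _ c0 h1' h2') => i /hv /andP[vi0 viq].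
  apply/andP; split; first by rewrite divr_ge0 // ltW.
  by rewrite ler_pdivrMr // mul1r; exact: le_trans viq qr.
move: q0; rewrite le_eqVlt => /orP[/eqP q0|q0]; last exact: pos.
(* Division by q = 0 is impossible, but every r in (0, 1] is admissible and r can tend to 0. *)
rewrite -q0 expr0n mul0r.
apply: (@le_of_le_addM _ _ _ (ln d%:R)) => s s0 s1; rewrite add0r.
apply: le_trans (pos s s0 s1 _) _; first by rewrite -q0 ltW.
have hD := state_Dv_le c0 h1 h2 h3.
apply: le_trans (ler_wpM2l (sqr_ge0 s) hD) _.
rewrite mulrC ler_wpM2l ?ln_ge0 ?ler1n //.
by rewrite expr2 ler_piMl // ltW.
Qed.

Lemma circuit_contraction ss (c q : R) v (Us : seq 'M[C]_d) rho : (0 < d)%N ->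
  sites ss -> irreducible ss -> 0 < c -> state_lb c rho -> 0 <= q -> q <= 1 ->
  (forall i, (i < size ss)%N -> 0 <= v i <= q) ->
  (forall U, U \in Us -> unitary U) ->
  let sigma := foldl (fun tau U => deps v ss (U *m tau *m adj U)) (deps v ss rho) Us in
  state_lb c sigma /\ Dv sigma <= (q ^+ (size Us).+1) ^+ 2 * Dv rho.
Proof.
move=> d0 hss irr c0 srho q0 q1 hv.
have hv' i : (i < size ss)%N -> 0 <= v i <= 1.
  by move=> /hv /andP[-> h]; exact: le_trans h q1.
elim/last_ind: Us => [_|Us U IH hU] /=.
  by rewrite expr1; split; [exact: state_deps|exact: (layer_contraction d0 hss irr c0 srho q0 q1 hv)].
have uU : unitary U by apply: hU; rewrite mem_rcons mem_head.
have [|h1 h2] := IH; first by move=> V hV; apply: hU; rewrite mem_rcons inE hV orbT.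
rewrite -cats1 foldl_cat /= size_cat addn1.
have h3 := state_conj uU h1.
split; first exact: state_deps.
apply: le_trans (layer_contraction d0 hss irr c0 h3 q0 q1 hv) _.
rewrite Dv_conj //; last by case: h1.
rewrite [q ^+ (size Us).+2]exprS exprMn -[leRHS]mulrA.
by apply: ler_wpM2l; [exact: sqr_ge0|exact: h2].
Qed.

(** The maximally mixed state commutes with rho, so the inequality is classical in the eigenvalues.
    At x = d * eigenvalue [pinsker_scalar] reads |x - 1|^2 <= a b, where a sums to 2 d and b to d Dv
    rho; Cauchy-Schwarz concludes. *)
Lemma pinsker (c : R) rho : (0 < d)%N -> 0 <= c -> state_lb c rho ->
  (\sum_k `|eig rho k - d%:R^-1|) ^+ 2 <= 2 * Dv rho.
Proof.
move=> d0 c0 [h1 h2 h3].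
have l0 k : 0 <= eig rho k by apply: le_trans c0 _; exact: lb_eig.
have l_sum : \sum_k eig rho k = 1 by rewrite -h3 -[in RHS](fnm_id h1) Tr_fnm.
have D0 : 0 < d%:R :> R by rewrite ltr0n.
set D := d%:R in D0 *.
pose x k := D * eig rho k.
pose a k := (2 * x k + 4) / 3.
pose b k := x k * ln (x k) - x k + 1.
pose S := \sum_k `|x k - 1|.
have x0 k : 0 <= x k by rewrite mulr_ge0 // ltW.
have a0 k : 0 < a k by rewrite /a; have := x0 k; lra.
have sum1 : \sum_(k < d) (1 : R) = D by rewrite sumr_const card_ord.
have xS : \sum_k x k = D by rewrite -mulr_sumr l_sum mulr1.
have aS : \sum_k a k = 2 * D.
  rewrite /a -mulr_suml big_split -mulr_sumr xS /=.
  by rewrite -[4 in X in _ + X]mulr1 -mulr_sumr sum1; field.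
have bS : \sum_k b k = D * Dv rho.
  rewrite /b !big_split /= sumrN xS sum1 addrNK /Dv Tr_fnm mulrDr.
  have -> : D * ln D = \sum_k D * (eig rho k * ln D).
    by rewrite -mulr_sumr -mulr_suml l_sum mul1r.
  rewrite mulr_sumr -big_split; apply: eq_bigr => k _ /=.
  rewrite /x /xlnx; have := l0 k; rewrite le_eqVlt => /orP[/eqP <-|lk].
    by rewrite !(mulr0, mul0r) addr0.
  by rewrite lnM ?posrE //; ring.
have key t k : 2 * t * `|x k - 1| <= t ^+ 2 * a k + b k.
  have ps := pinsker_scalar (x0 k).
  rewrite -(ler_pM2l (a0 k)).
  have hab : `|x k - 1| ^+ 2 <= a k * b k.
    by rewrite real_normK ?num_real // /a /b; lra.
  have := sqr_ge0 (t * a k - `|x k - 1|).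
  move: hab; move: (a k) (b k) `|x k - 1| => aa bb u h1' h2'; lra.
have keyS t : 2 * t * S <= t ^+ 2 * (2 * D) + D * Dv rho.
  rewrite -aS -bS /S !mulr_sumr -big_split; apply: ler_sum => k _ /=; exact: key.
have eS : S = D * \sum_k `|eig rho k - D^-1|.
  rewrite /S mulr_sumr; apply: eq_bigr => k _.
  by rewrite -[X in X * `|_|](ger0_norm (ltW D0)) -normrM mulrBr divff // gt_eqF.
(* The optimal t, at which the family [keyS] gives Cauchy-Schwarz. *)
have := keyS (S / (2 * D)); rewrite eS.
move: (\sum_k _) (Dv rho) => T E; clear -D0.
have -> : 2 * (D * T / (2 * D)) * (D * T) = D * T ^+ 2 by field; rewrite gt_eqF.
have -> : (D * T / (2 * D)) ^+ 2 * (2 * D) = D * T ^+ 2 / 2 by field; rewrite gt_eqF.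
move=> h; rewrite -(ler_pM2l D0); lra.
Qed.

End Circuit.

(** * Tensor powers of nearby states *)

Section Decomposition.
Variable R : realType.
Local Notation C := R[i].

(* An explicit witness that the trace norm of T is at most c. *)
Definition dec m (T : 'M[C]_m) (c : R) := exists (I : finType) (a : I -> R) (v : I -> 'cV[C]_m),
  [/\ forall i, adj (v i) *m v i = 1%:M,
      T = \sum_i (a i)%:C *: (v i *m adj (v i)) & \sum_i `|a i| <= c].

Lemma dec_add m (A B : 'M[C]_m) (a b : R) : dec A a -> dec B b -> dec (A + B) (a + b).
Proof.
move=> [I [x [v [h1 -> h3]]]] [J [y [w [k1 -> k3]]]].
exists (I + J)%type, (fun k => match k with inl i => x i | inr j => y j end),
  (fun k => match k with inl i => v i | inr j => w j end); split.
- by case.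
- by rewrite big_sumType.
- by rewrite big_sumType /=; exact: lerD.
Qed.

Definition tensv m n (v : 'cV[C]_m) (w : 'cV[C]_n) : 'cV[C]_(m * n) :=
  \col_k (v (mxtens_unindex k).1 0 * w (mxtens_unindex k).2 0).

Lemma tensv_norm m n (v : 'cV[C]_m) (w : 'cV[C]_n) :
  adj v *m v = 1%:M -> adj w *m w = 1%:M -> adj (tensv v w) *m tensv v w = 1%:M.
Proof.
move=> /matrixP /(_ 0 0) hv /matrixP /(_ 0 0) hw.
apply/matrixP => i j; rewrite !ord1; rewrite !mxE in hv hw *.
transitivity ((\sum_k adj v 0 k * v k 0) * (\sum_k adj w 0 k * w k 0)).
  rewrite mulr_sum; apply: eq_bigr => k _.
  by rewrite !adjE !mxE rmorphM mulrACA.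
by rewrite hv hw mulr1.
Qed.

Lemma tensv_outer m n (v : 'cV[C]_m) (w : 'cV[C]_n) :
  tensv v w *m adj (tensv v w) = (v *m adj v) *t (w *m adj w).
Proof.
apply/matrixP => i j; rewrite !mxE !big_ord1 !adjE !mxE rmorphM /=.
by rewrite mulrACA.
Qed.

Lemma tensmx_suml m n (I : finType) (F : I -> 'M[C]_m) (B : 'M[C]_n) :
  (\sum_i F i) *t B = \sum_i F i *t B.
Proof.
apply/matrixP => k l; rewrite mxE !summxE mulr_suml.
by apply: eq_bigr => i _; rewrite mxE.
Qed.

Lemma tensmx_sumr m n (I : finType) (F : I -> 'M[C]_n) (B : 'M[C]_m) :
  B *t (\sum_i F i) = \sum_i B *t F i.
Proof.
apply/matrixP => k l; rewrite mxE !summxE mulr_sumr.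
by apply: eq_bigr => i _; rewrite mxE.
Qed.

Lemma tensmxZ m n (a b : C) (A : 'M[C]_m) (B : 'M[C]_n) :
  (a *: A) *t (b *: B) = (a * b) *: (A *t B).
Proof. by apply/matrixP => k l; rewrite !mxE mulrACA. Qed.

Lemma tensmxBl m n (A A' : 'M[C]_m) (B : 'M[C]_n) : (A - A') *t B = A *t B - A' *t B.
Proof. by apply/matrixP => k l; rewrite !mxE mulrBl. Qed.

Lemma tensmxBr m n (A : 'M[C]_m) (B B' : 'M[C]_n) : A *t (B - B') = A *t B - A *t B'.
Proof. by apply/matrixP => k l; rewrite !mxE mulrBr. Qed.

Lemma dec_tens m n (A : 'M[C]_m) (B : 'M[C]_n) (a b : R) :
  dec A a -> dec B b -> dec (A *t B) (a * b).
Proof.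
move=> [I [x [v [h1 -> h3]]]] [J [y [w [k1 -> k3]]]].
exists (I * J)%type, (fun k => x k.1 * y k.2), (fun k => tensv (v k.1) (w k.2)); split.
- by move=> [i j]; apply: tensv_norm.
- rewrite -(pair_bigA _ (fun i j => (x i * y j)%:C *:
    (tensv (v i) (w j) *m adj (tensv (v i) (w j))))) /=.
  rewrite tensmx_suml; apply: eq_bigr => i _; rewrite tensmx_sumr.
  by apply: eq_bigr => j _; rewrite tensmxZ -rmorphM tensv_outer.
- rewrite -(pair_bigA _ (fun i j => `|x i * y j|)) /=.
  have -> : \sum_i \sum_j `|x i * y j| = (\sum_i `|x i|) * (\sum_j `|y j|).
    by rewrite mulr_suml; apply: eq_bigr => i _; rewrite mulr_sumr;
      apply: eq_bigr => j _; rewrite normrM.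
  by apply: ler_pM => //; apply: sumr_ge0.
Qed.

Lemma dec_unit m (v : 'cV[C]_m) : adj v *m v = 1%:M -> dec (v *m adj v) 1.
Proof.
move=> hv; exists unit, (fun=> 1), (fun=> v); split=> //.
  by rewrite big_const card_unit /= addr0 scale1r.
by rewrite big_const card_unit /= addr0 normr1.
Qed.

Lemma dec_dg m (U : 'M[C]_m) (a : 'I_m -> R) : unitary U ->
  dec (dg U a) (\sum_k `|a k|).
Proof.
move=> [_ u2]; exists 'I_m, a, (fun k => adj (row k U)); split => //.
- move=> k; rewrite adjK; apply/matrixP => i j; rewrite !ord1.
  have /matrixP /(_ k k) := u2; rewrite !mxE !eqxx => <-.
  by apply: eq_bigr => l _; rewrite !adjE !mxE.
- apply/matrixP => i j; rewrite /dg summxE -mulmxA mxE; apply: eq_bigr => k _.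
  by rewrite /rdiag mul_diag_mx !mxE big_ord1 adjK !adjE !mxE mulrCA mulrA.
Qed.

(** The recursion starts at exponent 2: [m ^ k.+2] unfolds to [m * m ^ k.+1], but [m ^ 1] to [m]. *)
Lemma ntensmx_recS m (A : 'M[C]_m) k : ntensmx A k.+2 = A *t ntensmx A k.+1.
Proof. exact: ntensmxSS. Qed.

Lemma dec_ntens m (A : 'M[C]_m) k : dec A 1 -> dec (ntensmx A k) 1.
Proof.
move=> hA; case: k => [|k].
  rewrite ntensmx0; have h : adj (1%:M : 'cV[C]_1) *m 1%:M = 1%:M by rewrite mulmx1 adj_mx1.
  by have := dec_unit h; rewrite adj_mx1 mulmx1.
elim: k => [|k IH]; first by rewrite ntensmx1.
by rewrite ntensmx_recS -[1](mulr1 1); exact: dec_tens.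
Qed.

Lemma dec_ntens_sub m (A B : 'M[C]_m) (c : R) k : dec A 1 -> dec B 1 -> dec (A - B) c ->
  dec (ntensmx A k.+1 - ntensmx B k.+1) (k.+1%:R * c).
Proof.
move=> hA hB hAB; elim: k => [|k IH]; first by rewrite !ntensmx1 mul1r.
have -> : ntensmx A k.+2 - ntensmx B k.+2 =
    (A - B) *t ntensmx A k.+1 + B *t (ntensmx A k.+1 - ntensmx B k.+1).
  by rewrite !ntensmx_recS tensmxBl tensmxBr addrA subrK.
have -> : k.+2%:R * c = c * 1 + 1 * (k.+1%:R * c) by rewrite -[k.+2%:R]natr1; ring.
exact: (dec_add (dec_tens hAB (dec_ntens k.+1 hA)) (dec_tens hB IH)).
Qed.

Lemma ntensmxZ m (c : C) (A : 'M[C]_m) k : ntensmx (c *: A) k = c ^+ k *: ntensmx A k.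
Proof.
case: k => [|k]; first by rewrite !ntensmx0 expr0 scale1r.
elim: k => [|k IH]; first by rewrite !ntensmx1 expr1.
by rewrite !ntensmx_recS IH tensmxZ -exprS.
Qed.

Lemma cabsE (z : C) : (cabs z)%:C = `|z|.
Proof. by rewrite normc_def. Qed.

Lemma cabsD (x y : C) : cabs (x + y) <= cabs x + cabs y.
Proof. by rewrite -lecR rmorphD /= !cabsE ler_normD. Qed.

Lemma cabs0 : cabs (0 : C) = 0.
Proof. by rewrite /cabs /= expr0n /= addr0 sqrtr0. Qed.

Lemma cabs_sum (I : finType) (F : I -> C) : cabs (\sum_i F i) <= \sum_i cabs (F i).
Proof.
elim/big_rec2: _ => [|i y x _ h]; first by rewrite cabs0.
by apply: le_trans (cabsD _ _) _; rewrite lerD2l.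
Qed.

Lemma cabsZ (r : R) (z : C) : cabs (r%:C * z) = `|r| * cabs z.
Proof.
rewrite /cabs -sqrtr_sqr -sqrtrM ?sqr_ge0 //; congr Num.sqrt.
by case: z => a b /=; ring.
Qed.

Lemma cabs_sqr (z : C) : cabs z ^+ 2 = nsq z.
Proof. by rewrite /cabs sqr_sqrtr // addr_ge0 // sqr_ge0. Qed.

Definition vsq m (v : 'cV[C]_m) : R := \sum_i nsq (v i 0).

Lemma vsq_ge0 m (v : 'cV[C]_m) : 0 <= vsq v.
Proof. by apply: sumr_ge0 => i _; rewrite nsq_ge0. Qed.

Lemma vnormE m (v : 'cV[C]_m) : vnorm v = Num.sqrt (vsq v).
Proof. by rewrite /vnorm; congr Num.sqrt; apply: eq_bigr => i _; rewrite cabs_sqr. Qed.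

Lemma vsqE m (v : 'cV[C]_m) : vsq v = complex.Re ((adj v *m v) 0 0).
Proof.
rewrite mxE Re_sum; apply: eq_bigr => i _; by rewrite adjE mulrC -nsqE.
Qed.

Lemma vnorm_unit m (v : 'cV[C]_m) : vnorm v = 1 -> adj v *m v = 1%:M.
Proof.
rewrite vnormE => h; have h1 : vsq v = 1.
  by rewrite -(sqr_sqrtr (vsq_ge0 v)) h expr1n.
apply/matrixP => i j; rewrite !ord1 [RHS]mxE eqxx mxE.
rewrite -[1%:R]/(1%:C) -h1 /vsq rmorph_sum; apply: eq_bigr => k _.
by rewrite adjE mulrC -nsqE.
Qed.

Lemma unit_vnorm m (v : 'cV[C]_m) : adj v *m v = 1%:M -> vnorm v = 1.
Proof. by move=> h; rewrite vnormE vsqE h mxE /= sqrtr1. Qed.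

(** Expand the squared norm of w minus its projection on v. *)
Lemma cauchy_unit m (v w : 'cV[C]_m) : adj v *m v = 1%:M ->
  nsq ((adj v *m w) 0 0) <= vsq w.
Proof.
move=> hv; set z := (adj v *m w) 0 0.
have ez : adj v *m w = z%:M by apply/matrixP => i j; rewrite !ord1 [RHS]mxE eqxx mulr1n.
have ez' : adj w *m v = (z^*)%:M.
  have := congr1 (@adj R 1 1) ez; rewrite adjM adjK => ->.
  by apply/matrixP => i j; rewrite adjE !mxE !ord1 eqxx !mulr1n.
have := vsq_ge0 (w - z *: v).
rewrite vsqE; have -> : adj (w - z *: v) = adj w - z^* *: adj v.
  by apply/matrixP => i j; rewrite adjE !mxE rmorphB rmorphM.
rewrite mulmxBl !mulmxBr -!scalemxAl -!scalemxAr hv ez ez'.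
rewrite !mxE eqxx !mulr1n !mulr1 ReD ReN.
rewrite subrr ReD ReN -nsqE /= subr0 => h.
by rewrite vsqE [X in _ <= complex.Re X]mxE -subr_ge0.
Qed.

Lemma vsq_mul_le m (X : 'M[C]_m) (v : 'cV[C]_m) : adj v *m v = 1%:M ->
  vsq (X *m v) <= hs X.
Proof.
move=> hv; rewrite hsE; apply: ler_sum => i _.
have := cauchy_unit (adj (row i X)) hv.
have -> : vsq (adj (row i X)) = \sum_j nsq (X i j).
  apply: eq_bigr => j _; rewrite adjE mxE; case: (X i j) => a b.
  by rewrite /nsq /= sqrrN.
suff -> : (X *m v) i 0 = ((adj v *m adj (row i X)) 0 0)^*.
  by case: ((adj v *m _) 0 0) => a b; rewrite /nsq /= sqrrN.
rewrite -adjM adjE conjcK !mxE; apply: eq_bigr => j _.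
by rewrite mxE.
Qed.

(** The supremum is an upper bound because the Hilbert-Schmidt norm bounds the set. *)
Lemma vnorm_le_opnorm m (X : 'M[C]_m) (v : 'cV[C]_m) : adj v *m v = 1%:M ->
  vnorm (X *m v) <= opnorm X.
Proof.
move=> hv; apply: ub_le_sup; last by exists v; split=> //; exact: unit_vnorm.
exists (Num.sqrt (hs X)) => r [w [hw ->]].
rewrite vnormE ler_wsqrtr //; apply: vsq_mul_le; exact: vnorm_unit.
Qed.

Lemma opnorm_ge0 m (X : 'M[C]_m) : 0 <= opnorm X.
Proof.
rewrite /opnorm; set S := [set r | _]%classic.
(* Dimension 0 has no unit vector, and the supremum of the empty set is 0. *)
have [->|/set0P [r [v [hv _]]]] := eqVneq S set0; first by rewrite sup0.
apply: le_trans (vnorm_le_opnorm X (vnorm_unit hv)).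
by rewrite vnormE sqrtr_ge0.
Qed.

Lemma quad_le_opnorm m (X : 'M[C]_m) (v : 'cV[C]_m) : adj v *m v = 1%:M ->
  cabs ((adj v *m (X *m v)) 0 0) <= opnorm X.
Proof.
move=> hv; apply: le_trans (vnorm_le_opnorm X hv).
rewrite vnormE -[cabs _]/(Num.sqrt (nsq _)) ler_wsqrtr //.
exact: cauchy_unit.
Qed.

Lemma dec_tr_le m (X T : 'M[C]_m) (c : R) : dec T c ->
  cabs (\tr (X *m T)) <= opnorm X * c.
Proof.
move=> [I [a [v [h1 -> h3]]]].
apply: le_trans (ler_wpM2l (opnorm_ge0 X) h3).
have -> : \tr (X *m (\sum_i (a i)%:C *: (v i *m adj (v i)))) =
    \sum_i \tr (X *m ((a i)%:C *: (v i *m adj (v i)))).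
  by rewrite mulmx_sumr; exact: raddf_sum.
apply: le_trans (cabs_sum _) _.
rewrite mulr_sumr; apply: ler_sum => i _.
rewrite -scalemxAr mxtraceZ cabsZ mulrC; apply: ler_wpM2r => //.
rewrite mulmxA mxtrace_mulC; have := quad_le_opnorm X (h1 i).
by rewrite /mxtrace big_ord1.
Qed.

End Decomposition.

(** * Registers of qubits *)

Section Pauli.
Variable R : realType.
Local Notation C := R[i].

Definition sigx : 'M[C]_2 := \matrix_(i, j) (i != j)%:R.
Definition sigz : 'M[C]_2 := \matrix_(i, j) (if i == j then (-1) ^+ i else 0).

Lemma mx2P (A B : 'M[C]_2) :
  A 0 0 = B 0 0 -> A 0 1 = B 0 1 -> A 1 0 = B 1 0 -> A 1 1 = B 1 1 -> A = B.
Proof.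
move=> h1 h2 h3 h4; apply/matrixP => -[[|[|//]] hi] -[[|[|//]] hj].
- have -> : Ordinal hi = 0 by exact/val_inj. have -> // : Ordinal hj = 0 by exact/val_inj.
- have -> : Ordinal hi = 0 by exact/val_inj. have -> // : Ordinal hj = 1 by exact/val_inj.
- have -> : Ordinal hi = 1 by exact/val_inj. have -> // : Ordinal hj = 0 by exact/val_inj.
- have -> : Ordinal hi = 1 by exact/val_inj. have -> // : Ordinal hj = 1 by exact/val_inj.
Qed.

Lemma mul2E (A B : 'M[C]_2) i j : (A *m B) i j = A i 0 * B 0 j + A i 1 * B 1 j.
Proof.
rewrite mxE big_ord_recl big_ord1; congr (_ + A i _ * B _ j); exact/val_inj.
Qed.

Lemma sigxE : (sigx 0 0 = 0) * (sigx 0 1 = 1) * (sigx 1 0 = 1) * (sigx 1 1 = 0).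
Proof. by rewrite !mxE. Qed.
Lemma sigzE : (sigz 0 0 = 1) * (sigz 0 1 = 0) * (sigz 1 0 = 0) * (sigz 1 1 = -1).
Proof. by rewrite !mxE. Qed.

Lemma site_sig : site (sigx, sigz).
Proof.
split => /=.
- by apply: mx2P; rewrite adjE !sigxE ?conjc0 ?conjc1.
- by apply: mx2P; rewrite adjE !sigzE ?conjc0 ?conjc1 ?rmorphN1.
- by apply: mx2P; rewrite mul2E !sigxE [RHS]mxE /=; ring.
- by apply: mx2P; rewrite mul2E !sigzE [RHS]mxE /=; ring.
- by apply: mx2P; rewrite mul2E [RHS]mxE mul2E !sigzE !sigxE; ring.
Qed.

Lemma evnE2 P (A : 'M[C]_2) i j : evn P A i j = 2^-1%:C * (A i j + (P *m A *m P) i j).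
Proof. by rewrite mxE; congr (_ * _); rewrite mxE. Qed.

Lemma half2C : 2^-1%:C = 2^-1 :> C.
Proof. by rewrite fmorphV rmorph_nat. Qed.

Transparent Em.

Lemma Em_sig (A : 'M[C]_2) : Em (sigx, sigz) A = (\tr A / 2) *: 1%:M.
Proof.
have -> : \tr A = A 0 0 + A 1 1.
  rewrite /mxtrace big_ord_recl big_ord1; congr (_ + A _ _); exact/val_inj.
rewrite /Em /=; apply: mx2P;
  by rewrite evnE2 !mul2E !evnE2 !mul2E !sigxE !sigzE [RHS]mxE [(1%:M : 'M[C]_2) _ _]mxE half2C /=;
  field.
Qed.

Lemma depol_dep (p : R) A : depol p A = dep (1 - p) (sigx, sigz) A.
Proof.
rewrite /depol /dep Em_sig scalerA; congr (_ + _ *: _).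
by rewrite subKr mulrA.
Qed.

Definition upl m (A : 'M[C]_2) : 'M[C]_(2 * m) := A *t 1%:M.
Definition upr m (A : 'M[C]_m) : 'M[C]_(2 * m) := 1%:M *t A.
Definition uplS m (s : 'M[C]_2 * 'M[C]_2) := (@upl m s.1, @upl m s.2).
Definition uprS m (s : 'M[C]_m * 'M[C]_m) := (upr s.1, upr s.2).

Lemma adj_tens m k (A : 'M[C]_m) (B : 'M[C]_k) : adj (A *t B) = adj A *t adj B.
Proof. by apply/matrixP => i j; rewrite !(adjE, mxE) rmorphM. Qed.

Lemma tens11 m k : (1%:M : 'M[C]_m) *t (1%:M : 'M[C]_k) = 1%:M.
Proof.
apply/matrixP => i j; case: (mxtens_indexP i) => a c; case: (mxtens_indexP j) => b e.
by rewrite tensmxE !mxE (can_eq (@mxtens_indexK _ _)) -natrM mulnb.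
Qed.

Lemma uplM m A B : @upl m A *m upl m B = upl m (A *m B).
Proof. by rewrite tensmx_mul mulmx1. Qed.
Lemma uprM m (A B : 'M[C]_m) : upr A *m upr B = upr (A *m B).
Proof. by rewrite tensmx_mul mulmx1. Qed.
Lemma upl_upr m A (B : 'M[C]_m) : cm (upl m A) (upr B).
Proof. by rewrite /cm !tensmx_mul !mulmx1 !mul1mx. Qed.
Lemma uplN m A : upl m (- A) = - upl m A.
Proof. by apply/matrixP => i j; rewrite !mxE mulNr. Qed.
Lemma uprN m (A : 'M[C]_m) : upr (- A) = - upr A.
Proof. by apply/matrixP => i j; rewrite !mxE mulrN. Qed.

Lemma site_uplS m s : site s -> site (uplS m s).
Proof.
case=> h1 h2 h3 h4 h5; split=> /=; rewrite ?adj_tens ?adj_mx1 ?h1 ?h2 ?uplM //.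
- by rewrite h3 /upl tens11.
- by rewrite h4 /upl tens11.
- by rewrite h5 uplN.
Qed.

Lemma site_uprS m (s : 'M[C]_m * 'M[C]_m) : site s -> site (uprS s).
Proof.
case=> h1 h2 h3 h4 h5; split=> /=; rewrite ?adj_tens ?adj_mx1 ?h1 ?h2 ?uprM //.
- by rewrite h3 /upr tens11.
- by rewrite h4 /upr tens11.
- by rewrite h5 uprN.
Qed.

Lemma cm_upr m (A B : 'M[C]_m) : cm A B -> cm (upr A) (upr B).
Proof. by rewrite /cm !uprM => ->. Qed.

Lemma sites_uprS m (ss : seq ('M[C]_m * 'M[C]_m)) : sites ss -> sites (map (@uprS m) ss).
Proof.
elim: ss => //= s ss IH [h1 h2 h3]; split; [exact: site_uprS| |exact: IH].
move=> _ /mapP [t /h2 [c1 c2 c3 c4] ->].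
by split; exact: cm_upr.
Qed.

(** The expansion by which [tens_map] is defined, so linear maps need only be compared on
    products. *)
Lemma tens_basis m k (T : 'M[C]_(m * k)) :
  T = \sum_(a < m) \sum_(b < m) \sum_(c < k) \sum_(e < k)
     T (mxtens_index (a, c)) (mxtens_index (b, e)) *: (delta_mx a b *t delta_mx c e).
Proof.
apply/matrixP => i j; case: (mxtens_indexP i) => a c; case: (mxtens_indexP j) => b e.
rewrite summxE (bigD1 a) //= summxE (bigD1 b) //= summxE (bigD1 c) //= summxE (bigD1 e) //=.
rewrite mxE tensmxE !mxE !eqxx /= !mulr1 !big1 ?addr0 //.
- move=> a' ha; rewrite summxE big1 // => b' _; rewrite summxE big1 // => c' _.
  rewrite summxE big1 // => e' _; rewrite mxE tensmxE !mxE eq_sym (negbTE ha).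
  by rewrite mul0r mulr0.
- move=> b' hb; rewrite summxE big1 // => c' _.
  rewrite summxE big1 // => e' _; rewrite mxE tensmxE !mxE [b == b']eq_sym (negbTE hb).
  by rewrite andbF mul0r mulr0.
- move=> c' hc; rewrite summxE big1 // => e' _; rewrite mxE tensmxE !mxE [c == c']eq_sym (negbTE hc).
  by rewrite mulr0 mulr0.
- move=> e' he; rewrite mxE tensmxE !mxE [e == e']eq_sym (negbTE he).
  by rewrite andbF mulr0 mulr0.
Qed.

Lemma evn_upl m P A (B : 'M[C]_m) : evn (upl m P) (A *t B) = evn P A *t B.
Proof.
rewrite /evn !tensmx_mul mul1mx mulmx1.
by apply/matrixP => i j; rewrite !mxE; ring.
Qed.

Lemma evn_upr m (P : 'M[C]_m) A B : evn (upr P) (A *t B) = A *t evn P B.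
Proof.
rewrite /evn !tensmx_mul mul1mx mulmx1.
by apply/matrixP => i j; rewrite !mxE; ring.
Qed.

Lemma dep_upl m (a : R) s A (B : 'M[C]_m) : dep a (uplS m s) (A *t B) = dep a s A *t B.
Proof.
rewrite /dep /Em /= !evn_upl; move: (evn _ _) => D.
by apply/matrixP => i j; rewrite !mxE; ring.
Qed.

Lemma dep_upr m (a : R) (s : 'M[C]_m * 'M[C]_m) A B :
  dep a (uprS s) (A *t B) = A *t dep a s B.
Proof.
rewrite /dep /Em /= !evn_upr; move: (evn _ _) => D.
by apply/matrixP => i j; rewrite !mxE; ring.
Qed.

Lemma deps_upr m v (ss : seq ('M[C]_m * 'M[C]_m)) A B :
  deps v (map (@uprS m) ss) (A *t B) = A *t deps v ss B.
Proof.
elim: ss v => [//|s ss IH] v /=; rewrite IH; exact: dep_upr.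
Qed.

End Pauli.

(** * The noise layer as depolarization of commuting sites *)

Section Register.
Variable R : realType.
Local Notation C := R[i].
Local Notation sig := (sigx R, sigz R).

Lemma dep_sum d (a : R) s (I : finType) (F : I -> 'M[C]_d) :
  dep a s (\sum_i F i) = \sum_i dep a s (F i).
Proof.
apply: (big_morph (dep a s) (depD a s)).
by rewrite -[X in dep a s X](scale0r (1%:M : 'M[C]_d)) depZ scale0r.
Qed.

Lemma deps_sum d v ss (I : finType) (F : I -> 'M[C]_d) :
  deps v ss (\sum_i F i) = \sum_i deps v ss (F i).
Proof.
apply: (big_morph (deps v ss) (depsD v ss)).
by rewrite -[X in deps v ss X](scale0r (1%:M : 'M[C]_d)) depsZ scale0r.
Qed.

Lemma tens_map_deps m (p : R) v (ss : seq ('M[C]_m * 'M[C]_m)) tau :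
  tens_map (depol p) (deps v ss) tau =
  dep (1 - p) (uplS m sig) (deps v (map (@uprS R m) ss) tau).
Proof.
rewrite {2}(tens_basis tau) deps_sum dep_sum; apply: eq_bigr => a _.
rewrite deps_sum dep_sum; apply: eq_bigr => b _.
rewrite deps_sum dep_sum; apply: eq_bigr => c _.
rewrite deps_sum dep_sum; apply: eq_bigr => e _.
rewrite (depsZ _ _ (tau _ _)) (depZ _ _ (tau _ _)) deps_upr.
by rewrite (dep_upl _ _ (delta_mx a b)) -(depol_dep p (delta_mx a b)).
Qed.

(** An arbitrary equality of dimensions, so that transport lemmas follow by eliminating it. *)
Definition cst m m' (e : m = m') (A : 'M[C]_m) : 'M[C]_m' := castmx (e, e) A.
Definition cstS m m' (e : m = m') (s : 'M[C]_m * 'M[C]_m) := (cst e s.1, cst e s.2).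

Lemma map_cstS_id m (e : m = m) ss : map (cstS e) ss = ss.
Proof.
rewrite -[RHS]map_id; apply: eq_map => -[a b]; rewrite /cstS /cst /=.
by rewrite !castmx_id.
Qed.

Lemma sites_cst m m' (e : m = m') ss : sites ss -> sites (map (cstS e) ss).
Proof. by case: m' / e; rewrite map_cstS_id. Qed.

Lemma irreducible_cst m m' (e : m = m') ss : irreducible ss -> irreducible (map (cstS e) ss).
Proof. by case: m' / e; rewrite map_cstS_id. Qed.

Lemma deps_cst m m' (e : m = m') v ss A :
  deps v (map (cstS e) ss) A = cst e (deps v ss (cst (esym e) A)).
Proof. by move: A; case: m' / e => A; rewrite map_cstS_id /cst !castmx_id. Qed.

(** The leftmost tensor factor comes first, as in [noise], so that site i carries the rate 1 - p
    i. *)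
Fixpoint pauli n : seq ('M[C]_(2 ^ n) * 'M[C]_(2 ^ n)) :=
  if n is n'.+1 then
    map (cstS (esym (expnS 2 n'))) (uplS _ sig :: map (@uprS R _) (pauli n'))
  else [::].

Lemma size_pauli n : size (pauli n) = n.
Proof. by elim: n => //= n IH; rewrite !size_map IH. Qed.

Lemma sites_pauli n : sites (pauli n).
Proof.
elim: n => // n IH; apply: sites_cst => /=; split.
- exact/site_uplS/site_sig.
- by move=> _ /mapP [t _ ->]; split; exact: upl_upr.
- exact: sites_uprS.
Qed.

Lemma upr_inj m : injective (@upr R m).
Proof.
move=> A B /matrixP h; apply/matrixP => i j.
have := h (mxtens_index (0, i)) (mxtens_index (0, j)).
by rewrite !tensmxE !mxE !eqxx !mul1r.
Qed.

Lemma Em_upl m (A : 'M[C]_2) (B : 'M[C]_m) :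
  Em (uplS m sig) (A *t B) = upr (\tr A / 2 *: B).
Proof.
have := dep_upl 0 sig A B; rewrite /dep subr0 !scale0r !add0r !scale1r => ->.
by rewrite Em_sig; apply/matrixP => i j; rewrite !mxE; ring.
Qed.

Lemma uprD m (A B : 'M[C]_m) : upr (A + B) = upr A + upr B.
Proof. by apply/matrixP => i j; rewrite !mxE mulrDr. Qed.
Lemma uprZ m (c : C) (A : 'M[C]_m) : upr (c *: A) = c *: upr A.
Proof. by apply/matrixP => i j; rewrite !mxE mulrCA. Qed.

Lemma Em_upl_range m (B : 'M[C]_(2 * m)) : exists B', Em (uplS m sig) B = upr B'.
Proof.
pose rg (M : 'M[C]_(2 * m)) := exists B', Em (uplS m sig) M = upr B'.
have rg0 : rg 0.
  exists 0; have := EmZ (uplS m sig) 0 0; rewrite !scale0r => ->.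
  by apply/matrixP => i j; rewrite !mxE mulr0.
have rgD M N : rg M -> rg N -> rg (M + N).
  by move=> [M' eM] [N' eN]; exists (M' + N'); rewrite EmD eM eN uprD.
have rg_sum (I : finType) F : (forall i : I, rg (F i)) -> rg (\sum_i F i).
  by move=> h; apply: (big_ind rg rg0 rgD) => i _; exact: h.
rewrite -/(rg B) (tens_basis B).
apply: (rg_sum _ _) => a; apply: (rg_sum _ _) => b.
apply: (rg_sum _ _) => c; apply: (rg_sum _ _) => e.
exists (B (mxtens_index (a, c)) (mxtens_index (b, e)) *:
  ((\tr (delta_mx a b : 'M[C]_2) / 2) *: delta_mx c e)).
by rewrite (EmZ _ (B _ _)) (Em_upl (delta_mx a b)) (uprZ (B _ _)).
Qed.

(** Commuting with the Paulis of the first qubit makes B a fixed point of its complete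
    depolarization, hence 1 tensor B'; the other sites then constrain B' alone. *)
Lemma irreducible_up m (ss : seq ('M[C]_m * 'M[C]_m)) : irreducible ss ->
  irreducible (uplS m sig :: map (@uprS R m) ss).
Proof.
move=> irr B hB h.
have [B' eB'] := Em_upl_range B.
have e : B = upr B'.
  rewrite -eB'; have [c1 c2] := h _ (mem_head _ _).
  have [_ _ s1 s2 _] := site_uplS m (site_sig R).
  by rewrite /Em (evn_id s2 c2) (evn_id s1 c1).
have hB' : adj B' = B'.
  by apply: upr_inj; rewrite -e -hB e /upr adj_tens adj_mx1.
have [c ec] : exists c : R, B' = c%:C *: 1%:M.
  apply: irr => // u us.
  have [] := h (uprS u); first by rewrite inE map_f ?orbT.
  by rewrite /cm e !uprM => /upr_inj h1 /upr_inj h2; split.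
by exists c; rewrite e ec uprZ /upr tens11.
Qed.

Lemma irreducible_pauli n : irreducible (pauli n).
Proof.
elim: n => [|n IH]; last by apply: irreducible_cst; exact: irreducible_up.
move=> B hB _; exists (complex.Re (B 0 0)); apply/matrixP => i j.
rewrite !ord1 !mxE mulr1; have /matrixP /(_ 0 0) := hB.
rewrite adjE; case: (B 0 0) => a b [] /= h; congr (_ +i* _).
by apply: self_opp_eq0; rewrite h.
Qed.

Lemma noise_deps n (p : nat -> R) tau :
  noise p tau = deps (fun i => 1 - p i) (pauli n) tau.
Proof.
elim: n p tau => [//|n IH] p tau.
transitivity (cst (esym (expnS 2 n)) (tens_map (depol (p 0%N))
   (deps (fun i => 1 - p i.+1) (pauli n)) (cst (expnS 2 n) tau))).
  congr (cst _ _); apply: eq_bigr => a _; apply: eq_bigr => b _.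
  by apply: eq_bigr => c _; apply: eq_bigr => e _; congr (_ *: (_ *t _)); exact: IH.
rewrite tens_map_deps; set v := fun i => 1 - p i.
rewrite -[dep _ _ _]/(deps v (uplS _ sig :: map (@uprS R _) (pauli n)) _).
by rewrite -{2}(esymK (expnS 2 n)) -deps_cst.
Qed.

End Register.

(** * Regularised input states *)

Section MixedInput.
Variables (R : realType) (d : nat).
Local Notation C := R[i].
Local Notation siteT := ('M[C]_d * 'M[C]_d)%type.
Implicit Types (s : siteT) (ss : seq siteT) (A B U rho : 'M[C]_d) (Us : seq 'M[C]_d) (v : nat -> R).

Definition circ v ss Us rho :=
  foldl (fun tau U => deps v ss (U *m tau *m adj U)) (deps v ss rho) Us.
Definition mixed : 'M[C]_d := d%:R^-1%:C *: 1%:M.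

Lemma circD v ss Us A B : circ v ss Us (A + B) = circ v ss Us A + circ v ss Us B.
Proof.
rewrite /circ depsD; elim: Us (deps v ss A) (deps v ss B) => //= U Us IH A' B'.
by rewrite -IH mulmxDr mulmxDl depsD.
Qed.

Lemma circZ v ss Us (c : C) A : circ v ss Us (c *: A) = c *: circ v ss Us A.
Proof.
rewrite /circ depsZ; elim: Us (deps v ss A) => //= U Us IH A'.
by rewrite -IH -scalemxAr -scalemxAl depsZ.
Qed.

Lemma Em1 s : site s -> Em s 1%:M = 1%:M.
Proof.
by case=> _ _ h1 h2 _; rewrite /Em (evn_id h2 (cm1 _)) (evn_id h1 (cm1 _)).
Qed.

Lemma deps_mx1 v ss : sites ss -> deps v ss 1%:M = 1%:M.
Proof.
elim: ss v => //= s ss IH v [h1 _ h3]; rewrite IH // /dep Em1 // -scalerDl.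
by rewrite -(rmorphD (real_complex R)) subrKC scale1r.
Qed.

Lemma circ_mx1 v ss Us : sites ss -> (forall U, U \in Us -> unitary U) ->
  circ v ss Us 1%:M = 1%:M.
Proof.
move=> hss; rewrite /circ deps_mx1 //; elim: Us => //= U Us IH hU.
have [_ u2] := hU U (mem_head _ _).
rewrite mulmx1 u2 deps_mx1 // IH // => V hV; apply: hU.
by rewrite inE hV orbT.
Qed.

Lemma state_circ (c : R) v ss Us rho : sites ss ->
  (forall i, (i < size ss)%N -> 0 <= v i <= 1) ->
  (forall U, U \in Us -> unitary U) -> state_lb c rho -> state_lb c (circ v ss Us rho).
Proof.
move=> hss hv hU h; have := state_deps hss hv h.
rewrite /circ; move: (deps v ss rho) => {h}rho.
elim: Us hU rho => //= U Us IH hU rho h; apply: IH.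
  by move=> V hV; apply: hU; rewrite inE hV orbT.
by apply: state_deps => //; apply: state_conj => //; apply: hU; rewrite mem_head.
Qed.

Lemma state_mixed : (0 < d)%N -> state_lb d%:R^-1 mixed.
Proof.
move=> d0; split.
- by rewrite /mixed (adjZ d%:R^-1) adj_mx1.
- move=> U i [_ u2]; rewrite /mixed -scalemxAr -scalemxAl mulmx1 u2.
  by rewrite mxE ReZ mxE eqxx mulr1.
- by rewrite /mixed (TrZ d%:R^-1) Tr1 mulVf // pnatr_eq0 -lt0n.
Qed.

Lemma state_dec rho : state_lb 0 rho -> dec rho 1.
Proof.
move=> [h l t]; have := dec_dg (eig rho) (eigU_unitary rho); rewrite (eig_decomp h).
suff -> : \sum_k `|eig rho k| = 1 by [].
rewrite -t -{2}(fnm_id h) Tr_fnm; apply: eq_bigr => k _.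
by rewrite ger0_norm //; exact: lb_eig.
Qed.

Lemma dec_le m (T : 'M[C]_m) (a b : R) : a <= b -> dec T a -> dec T b.
Proof. by move=> ab [I [x [w [h1 h2 h3]]]]; exists I, x, w; split=> //; exact: le_trans ab. Qed.

Lemma dec_scale m (T : 'M[C]_m) (a b : R) : 0 < b -> dec (b%:C *: T) a -> dec T (a / b).
Proof.
move=> b0 [I [x [w [h1 h2 h3]]]]; exists I, (fun i => x i / b), w; split=> //.
  apply: (@scalerI _ _ b%:C); first by rewrite fmorph_eq0 gt_eqF.
  rewrite h2 scaler_sumr; apply: eq_bigr => i _; rewrite scalerA.
  by rewrite -(rmorphM (real_complex R)) mulrC divfK // gt_eqF.
have -> : \sum_i `|x i / b| = (\sum_i `|x i|) / b.
  rewrite mulr_suml; apply: eq_bigr => i _.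
  by rewrite normrM (gtr0_norm (x := b^-1)) // invr_gt0.
by rewrite ler_pM2r // invr_gt0.
Qed.

Lemma state_mix (e a : R) rho : (0 < d)%N -> 0 < e -> e <= 1 -> state_lb 0 rho ->
  state_lb (e / d%:R) ((1 - e)%:C *: rho + e%:C *: mixed).
Proof.
move=> d0 e0 e1 [h l t]; have [h' l' t'] := state_mixed d0.
have e1' : 0 <= 1 - e by rewrite subr_ge0.
split.
- by rewrite adjD (adjZ (1 - e)) (adjZ e) h h'.
- move=> U i uU; have {}l := l U i uU; have {}l' := l' U i uU.
  move: mixed l l' => P; rewrite mulmxDr mulmxDl -!scalemxAr -!scalemxAl.
  move: (U *m rho *m adj U) (U *m P *m adj U) => M N hM hN.
  rewrite !mxE ReD !ReZ -[e / _]add0r; apply: lerD; first exact: mulr_ge0.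
  by apply: ler_wpM2l => //; exact: ltW.
- by rewrite TrD (TrZ (1 - e)) (TrZ e) t t' !mulr1 subrK.
Qed.

Lemma sqrt_bound (x y Q : R) : 0 <= Q -> x ^+ 2 <= 2 * (Q ^+ 2 * y) ->
  x <= Num.sqrt (2 * y) * Q.
Proof.
move=> Q0 h; apply: le_trans (ler_norm x) _.
rewrite -sqrtr_sqr -[X in _ * X](ger0_norm Q0) -sqrtr_sqr mulrC -sqrtrM ?sqr_ge0 //.
by apply: ler_wsqrtr; apply: le_trans h _; rewrite mulrCA.
Qed.

(** The circuit is linear and fixes [mixed], so for r = (1 - e) rho + e mixed the deviation of its
    output from [mixed] is 1 - e times the wanted one. Regularising the input costs only the factor
    1 / (1 - e). *)
Lemma circuit_dec ss (q e : R) v Us rho : (0 < d)%N ->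
  sites ss -> irreducible ss -> state_lb 0 rho -> 0 <= q -> q <= 1 ->
  (forall i, (i < size ss)%N -> 0 <= v i <= q) ->
  (forall U, U \in Us -> unitary U) -> 0 < e -> e < 1 ->
  dec (circ v ss Us rho - mixed) (Num.sqrt (2 * ln d%:R) * q ^+ (size Us).+1 / (1 - e)).
Proof.
move=> d0 hss irr st q0 q1 hv hU e0 e1.
have b0 : 0 < 1 - e by rewrite subr_gt0.
have st' := state_mix 0 d0 e0 (ltW e1) st.
have c0 : 0 < e / d%:R by rewrite divr_gt0 // ltr0n.
have [sl Dl] := circuit_contraction d0 hss irr c0 st' q0 q1 hv hU.
move: sl Dl; set r := _ + _; rewrite -[foldl _ _ _]/(circ v ss Us r) => sl Dl.
apply: dec_scale b0 _.
have -> : (1 - e)%:C *: (circ v ss Us rho - mixed) = circ v ss Us r - mixed.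
  rewrite /r circD (circZ v ss Us (1 - e)%:C rho) /mixed.
  rewrite (circZ v ss Us e%:C _) (circZ v ss Us d%:R^-1%:C 1%:M) circ_mx1 //.
  rewrite scalerBr -addrA; congr (_ + _); rewrite rmorphB scalerBl scale1r.
  by rewrite opprB.
have [h1 h2 h3] := sl.
have -> : circ v ss Us r - mixed = dg (eigU (circ v ss Us r))
    (fun k => eig (circ v ss Us r) k - d%:R^-1).
  rewrite -[RHS]/(fnm (fun t => id t + - d%:R^-1) _).
  by rewrite (fnmD id (fun=> - d%:R^-1)) fnm_id // fnm_const rmorphN scaleNr.
apply: dec_le (dec_dg _ (eigU_unitary _)).
apply: sqrt_bound; first exact: exprn_ge0.
apply: le_trans (pinsker d0 (ltW c0) sl) _; apply: ler_wpM2l => //.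
apply: le_trans Dl _; apply: ler_wpM2l; first exact: sqr_ge0.
by case: st' => k1 k2 k3; exact: (state_Dv_le c0 k1 k2 k3).
Qed.

End MixedInput.

(** * Copies, constants and the final estimate *)

Section Copies.
Variable R : realType.
Local Notation C := R[i].

Lemma density_state d (rho : 'M[C]_d) : density rho -> state_lb 0 rho.
Proof.
move=> [h [p t]]; split=> //; last by rewrite /Tr t.
move=> U i _; have := p (adj (row i U)).
suff -> : (adj (adj (row i U)) *m rho *m adj (row i U)) 0 0 = (U *m rho *m adj U) i i.
  by rewrite lecE => /andP[].
rewrite adjK -row_mul !mxE; apply: eq_bigr => k _.
by rewrite !adjE !mxE.
Qed.

Lemma qmax_ge0 n (p : nat -> R) : 0 <= qmax n p.
Proof. exact: bigmax_ge_id. Qed.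

Lemma qmax_le1 n (p : nat -> R) : (forall i, (i < n)%N -> 0 < p i <= 1) -> qmax n p <= 1.
Proof.
move=> hp; apply/bigmax_leP; split=> [|i _]; first exact: ler01.
by have /andP[/ltW h _] := hp i (ltn_ord i); rewrite lerBlDr lerDl.
Qed.

Lemma le_qmax n (p : nat -> R) i : (i < n)%N -> 1 - p i <= qmax n p.
Proof. by move=> hi; exact: (le_bigmax _ (fun i : 'I_n => 1 - p i) (Ordinal hi)). Qed.

Lemma noisy_circuitE n p (Us : seq 'M[C]_(2 ^ n)) rho :
  noisy_circuit p Us rho = circ (fun i => 1 - p i) (pauli R n) Us rho.
Proof.
rewrite /noisy_circuit /circ noise_deps; elim: Us (deps _ _ _) => //= U Us IH tau.
by rewrite noise_deps IH.
Qed.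

(** The 2 is Pinsker's constant, and ln (2^n) is the largest relative entropy to the maximally mixed
    state. *)
Lemma entropy_const n : Num.sqrt (2 * ln (2 ^ n)%:R) = Num.sqrt (ln 4) * Num.sqrt n%:R :> R.
Proof.
rewrite -sqrtrM; last by rewrite ln_ge0 // ler1n.
have -> : (4 : R) = 2 ^+ 2 by ring.
congr Num.sqrt; rewrite natrX !lnXn //.
by rewrite mulr_natr mulrnAr mulr_natl.
Qed.

Lemma tr_copies_le d d' m k (X : 'M[C]_(d ^ m.+1 * d' ^ k)) (A B : 'M[C]_d) (P : 'M[C]_d') (c : R) :
  dec A 1 -> dec B 1 -> dec P 1 -> dec (A - B) c ->
  cabs (\tr (X *m (ntensmx A m.+1 *t ntensmx P k)) -
        \tr (X *m (ntensmx B m.+1 *t ntensmx P k))) <= opnorm X * (m.+1%:R * c).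
Proof.
move=> hA hB hP hAB; have -> : m.+1%:R * c = m.+1%:R * c * 1 by rewrite mulr1.
rewrite -[\tr _ - _](raddfB (@mxtrace C _)) -mulmxBr -tensmxBl.
apply: dec_tr_le; apply: dec_tens; first exact: dec_ntens_sub.
exact: dec_ntens.
Qed.

Lemma le_div_limit (x y : R) : 0 <= y ->
  (forall e, 0 < e -> e < 1 -> x <= y / (1 - e)) -> x <= y.
Proof.
move=> y0 h; apply: (@le_of_le_addM _ _ _ x) => s s0 s1.
have [s1'|s1'] := ltP s 1; last first.
  have -> : s = 1 by apply/le_anti/andP.
  by rewrite mulr1 lerDr.
have := h s s0 s1'; rewrite ler_pdivlMr ?subr_gt0 //.
by rewrite mulrBr mulr1 lerBlDr.
Qed.

End Copies.

Theorem theorem1 (R : realType) (n : nat) (p : nat -> R)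
  (d' : nat) (ket0 : 'cV[R[i]]_d')
  (rho_in : 'M[R[i]]_(2 ^ n)) (Us : seq 'M[R[i]]_(2 ^ n))
  (M k : nat) (X : 'M[R[i]]_((2 ^ n) ^ M * d' ^ k)) :
  (forall i, (i < n)%N -> 0 < p i <= 1) ->
  adj ket0 *m ket0 = 1%:M ->
  density rho_in ->
  (forall U, U \in Us -> U \is unitarymx) ->
  (1 <= M)%N ->
  let sigma := noisy_circuit p Us rho_in in
  let P0 := ket0 *m adj ket0 in
  let q := qmax n p in
  cabs (\tr (X *m (ntensmx sigma M *t ntensmx P0 k))
        - \tr (X *m ((((2 ^ (M * n))%:R)^-1 *: ntensmx (1%:M : 'M[R[i]]_(2 ^ n)) M)
                     *t ntensmx P0 k)))
  <= Num.sqrt (ln (4 : R)) * opnorm X * M%:R * Num.sqrt (n%:R) * q ^+ (size Us).+1.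
Proof.
move=> hp hket hrho hU; case: M X => // m X _; cbv zeta.
set q := qmax n p.
have d0 : (0 < 2 ^ n)%N by rewrite expn_gt0.
have -> : (2 ^ (m.+1 * n))%:R^-1 *: ntensmx (1%:M : 'M[R[i]]_(2 ^ n)) m.+1 =
    ntensmx (mixed R (2 ^ n)) m.+1.
  rewrite ntensmxZ; congr (_ *: _).
  by rewrite mulnC expnM natrX fmorphV rmorph_nat exprVn.
have q0 : 0 <= q := qmax_ge0 n p.
have q1 : q <= 1 := qmax_le1 hp.
have hv i : (i < size (pauli R n))%N -> 0 <= 1 - p i <= q.
  rewrite size_pauli => hi; have /andP[_ pi1] := hp i hi.
  by rewrite subr_ge0 pi1 /=; exact: le_qmax.
have hv1 i : (i < size (pauli R n))%N -> 0 <= 1 - p i <= 1.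
  by move=> /hv /andP[-> h] /=; exact: le_trans h q1.
have uU U : U \in Us -> unitary U by move=> /hU; exact: unitaryP.
have st := density_state hrho.
have sites_n := sites_pauli R n.
have ss := state_circ sites_n hv1 uU st.
rewrite noisy_circuitE.
have -> : Num.sqrt (ln 4) * opnorm X * m.+1%:R * Num.sqrt n%:R * q ^+ (size Us).+1 =
    opnorm X * (m.+1%:R * (Num.sqrt (2 * ln (2 ^ n)%:R) * q ^+ (size Us).+1)).
  by rewrite entropy_const; ring.
have hc : 0 <= opnorm X * (m.+1%:R * (Num.sqrt (2 * ln (2 ^ n)%:R) * q ^+ (size Us).+1)).
  by rewrite !mulr_ge0 ?opnorm_ge0 ?sqrtr_ge0 ?exprn_ge0.
apply: le_div_limit => // e e0 e1; rewrite -!mulrA.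
have dm : dec (mixed R (2 ^ n)) 1.
  apply: state_dec; have [h1 h2 h3] := state_mixed R d0; split=> //.
  by apply: le_lb h2; rewrite invr_ge0.
have h := circuit_dec d0 sites_n (@irreducible_pauli R n) st q0 q1 hv uU e0 e1.
rewrite -mulrA in h.
exact: (tr_copies_le (k:=k) X (state_dec ss) dm (dec_unit hket) h).
Qed.
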